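(* Let $n\ge 1$ and let $0\le t<1$. For any partition $\lambda$, all matrix elements of the operator $\Theta(P_\lambda): V^{\otimes n}\to V^{\otimes n}$ with respect to the basis $\{\mathsf 1,\mathsf 2\}^{\otimes n}$ of $V^{\otimes n}$ are polynomials in $a_1,a_2,\ldots,a_n$ with non-negative coefficients.
   Context: Fix $n\ge1$ and a real number $t$ with $0\le t<1$; $a_1,\dots,a_n$ are (formal or real) parameters and $\alpha$ is a formal variable. Hall-Littlewood polynomials. $\Lambda_n$ is the algebra of symmetric polynomials in $n$ variables $x_1,\dots,x_n$ over $\mathbb R$. For a partition $\lambda=(\lambda_1\ge\dots\ge\lambda_n\ge0)$ with at most $n$ nonzero parts, let $m_k(\lambda)$ be the number of $i\in\{1,\dots,n\}$ with $\lambda_i=k$ and $$P_\lambda=\frac1{v_\lambda(t)}\sum_{w\in S_n}w\Big(x_1^{\lambda_1}\cdots x_n^{\lambda_n}\prod_{1\le i<j\le n}\frac{x_i-tx_j}{x_i-x_j}\Big),\qquad v_\lambda(t)=\prod_{k\ge0}\prod_{i=1}^{m_k(\lambda)}\frac{1-t^i}{1-t},$$ where $w$ permutes the variables. If $\lambda$ has more than $n$ nonzero parts, $P_\lambda=0$. Put $g_k=(1-t)P_{(k)}$ for $k\ge1$; then $1+\sum_{k\ge1}g_k\alpha^k=\prod_{i=1}^n\frac{1-t\alpha x_i}{1-\alpha x_i}$ and $\Lambda_n=\mathbb R[g_1,\dots,g_n]$ with $g_1,\dots,g_n$ algebraically independent. Six-vertex operators. $V$ is the two-dimensional vector space with basis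 $\mathsf 1,\mathsf 2$; $\{\mathsf 1,\mathsf 2\}^{\otimes n}$ is the basis of $V^{\otimes n}$ of vectors $e_1\otimes\cdots\otimes e_n$ with each $e_i\in\{\mathsf 1,\mathsf 2\}$. Define $R=R(a,t):V\otimes V\to V\otimes V$ by $R(\mathsf2\otimes\mathsf2)=\mathsf2\otimes\mathsf2$, $R(\mathsf1\otimes\mathsf1)=\mathsf1\otimes\mathsf1$, $R(\mathsf2\otimes\mathsf1)=\frac{1-a}{1-ta}\,\mathsf2\otimes\mathsf1+\frac{(1-t)a}{1-ta}\,\mathsf1\otimes\mathsf2$, $R(\mathsf1\otimes\mathsf2)=\frac{1-t}{1-ta}\,\mathsf2\otimes\mathsf1+\frac{t(1-a)}{1-ta}\,\mathsf1\otimes\mathsf2$. Here $R$ is read as a vertex (bottom edge)$\otimes$(left edge) $\mapsto$ (top edge)$\otimes$(right edge); write $R(a,t)[b,l;u,r]$ for the coefficient of $u\otimes r$ in $R(a,t)(b\otimes l)$. The transfer operator $T(\alpha):V^{\otimes n}\to V^{\otimes n}$, with left boundary fixed to be $\mathsf 1$ and free right boundary, has matrix elements: the coefficient of $e_1'\otimes\cdots\otimes e_n'$ in $T(\alpha)(e_1\otimes\cdots\otimes e_n)$ is $$\sum_{h_1,\dots,h_n\in\{\mathsf1,\mathsf2\}}\ \prod_{i=1}^nR(\alpha a_i,t)[e_i,h_{i-1};e_i',h_i],\qquad h_0=\mathsf1.$$ Set $\widetilde T(\alpha)=\Big(\prod_{i=1}^n\frac{1-t\alpha a_i}{1-\alpha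 a_i}\Big)T(\alpha)$ and expand in powers of $\alpha$: $\widetilde T(\alpha)=\mathrm{Id}+\sum_{k\ge1}T_k\alpha^k$. The matrix elements of $T_k$ are polynomials in $a_1,\dots,a_n$, and the operators $T_k$ ($k\ge1$) commute with each other. $\Theta$ is the $\mathbb R$-algebra homomorphism from $\Lambda_n$ to operators on $V^{\otimes n}$ determined by $\Theta(g_k)=T_k$ for $1\le k\le n$. *)

(* Defs.v *)
From HB Require Import structures.
From mathcomp Require Import all_boot all_order all_fingroup all_algebra.
From mathcomp Require Import boolp reals.
From mathcomp Require Import mpoly.

Set Implicit Arguments.
Unset Strict Implicit.
Unset Printing Implicit Defensive.

Import Order.TTheory GRing.Theory Num.Theory.
Local Open Scope ring_scope.

Notation "x %:F" := (@FracField.tofrac _ x) : ring_scope.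

Record sympoly (R : idomainType) (n : nat) := Sympoly {
  sympoly_val :> {mpoly R[n]};
  _ : sympoly_val \is symmetric }.

HB.instance Definition _ (R : idomainType) (n : nat) :=
  [isSub for @sympoly_val R n].
HB.instance Definition _ (R : idomainType) (n : nat) :=
  [Choice of sympoly R n by <:].
HB.instance Definition _ (R : idomainType) (n : nat) :=
  [SubChoice_isSubAlgebra of sympoly R n by <:].

Definition is_partition (la : seq nat) : bool :=
  sorted geq la && (0%N \notin la).

(* The number of i in {1, ..., n} with la_i = k; this counts the padding zeroes
   of la, so that mult n la 0 = n - size la. *)
Definition mult (n : nat) (la : seq nat) (k : nat) : nat :=
  #|[set i : 'I_n | nth 0%N la i == k]|.

(* The factors with k > la_1 are empty products. *)
Definition HL_v (R : fieldType) (n : nat) (t : R) (la : seq nat) : R :=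
  \prod_(0 <= k < (head 0%N la).+1)
    \prod_(1 <= i < (mult n la k).+1) ((1 - t ^+ i) / (1 - t)).

Definition fracX (R : idomainType) (n : nat) (i : 'I_n) :
  {fraction {mpoly R[n]}} := ('X_i)%:F.

Definition fracC (R : idomainType) (n : nat) (c : R) :
  {fraction {mpoly R[n]}} := (c%:MP_[n])%:F.

Definition HL_frac (R : fieldType) (n : nat) (t : R) (la : seq nat) :
  {fraction {mpoly R[n]}} :=
  (fracC n (HL_v n t la))^-1 *
  \sum_(w : 'S_n)
    (\prod_(i < n) fracX R (w i) ^+ nth 0%N la i) *
    \prod_(i < n) \prod_(j < n | (i < j)%N)
      ((fracX R (w i) - fracC n t * fracX R (w j)) /
       (fracX R (w i) - fracX R (w j))).

Lemma det_eval_Vandermonde (S : comNzRingType) (n : nat) (x : 'rV[S]_n)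
    (f : 'I_n -> {poly S}) :
  exists c, \det (\matrix_(i < n, j < n) (f i).[x 0 j]) =
            c * \det (Vandermonde n x).
Proof.
pose g : {poly S} := \prod_(j < n) ('X - (x 0 j)%:P).
have gm : g \is monic by apply: monic_prod => j _; apply: monicXsubC.
have sg : size g = n.+1.
  by rewrite /g size_prod_XsubC /index_enum -enumT size_enum_ord.
pose r i := Pdiv.Ring.rmodp (f i) g.
exists (\det (\matrix_(i < n, k < n) (r i)`_k)); rewrite -det_mulmx.
congr (\det _); apply/matrixP=> i j; rewrite !mxE.
have g0 : g.[x 0 j] = 0.
  by rewrite /g horner_prod (bigD1 j) //= hornerXsubC subrr mul0r.
rewrite (Pdiv.RingMonic.rdivp_eq gm (f i)) hornerD hornerM g0 mulr0 add0r.
rewrite -/(r i).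
have sr : (size (r i) <= n)%N.
  by rewrite -ltnS -sg Pdiv.Ring.ltn_rmodpN0 // monic_neq0.
by rewrite (horner_coef_wide _ sr); apply: eq_bigr=> k _; rewrite !mxE.
Qed.

Lemma HL_polynomial (R : fieldType) (n : nat) (t : R) (la : seq nat) :
  exists p : sympoly R n, (sympoly_val p)%:F = HL_frac n t la.
Proof.
pose S := {mpoly R[n]}.
pose X (i : 'I_n) : S := 'X_i.
pose D (w : 'S_n) : S :=
  \prod_(i < n) \prod_(j < n | (i < j)%N) (X (w i) - X (w j)).
pose y : 'rV[S]_n := \row_j (- X j).
have Dw w : D w = (-1) ^+ w * D 1%g.
  have DV (u : 'S_n) : D u = \det (Vandermonde n (\row_j (- X (u j)))).
    rewrite det_Vandermonde; apply: eq_bigr=> i _; apply: eq_bigr=> j _.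
    by rewrite !mxE opprK addrC.
  rewrite !DV.
  have -> : Vandermonde n (\row_j (- X (w j))) =
            col_perm w (Vandermonde n (\row_j (- X ((1%g : 'S_n) j)))).
    by apply/matrixP=> i j; rewrite !mxE perm1.
  by rewrite col_permE det_mulmx det_perm mulrC odd_permV.
have D1V : D 1%g = \det (Vandermonde n y).
  rewrite det_Vandermonde; apply: eq_bigr=> i _; apply: eq_bigr=> j _.
  by rewrite !mxE !perm1 opprK addrC.
have D1n0 : D 1%g != 0.
  apply/prodf_neq0=> i _; apply/prodf_neq0=> j ij; rewrite !perm1 subr_eq0.
  apply/eqP=> /(congr1 (mcoeff U_(i))); rewrite !mcoeffX eqxx.
  case: eqP => [/mnmP /(_ i)|_ /eqP]; last by rewrite oner_eq0.
  rewrite !mnm1E eqxx; case: eqP => // ji.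
  by move: ij; rewrite ji ltnn.
pose num (w : 'S_n) : S :=
  (\prod_(i < n) X (w i) ^+ nth 0%N la i) *
  \prod_(i < n) \prod_(j < n | (i < j)%N) (X (w i) - t%:MP * X (w j)).
have numE w : num w = num 1%g \mPo [tuple X (w i) | i < n].
  rewrite /num rmorphM !rmorph_prod /=; congr (_ * _); apply: eq_bigr=> i _.
    by rewrite rmorphXn /= perm1 comp_mpolyXU -tnth_nth tnth_mktuple.
  rewrite rmorph_prod; apply: eq_bigr=> j _.
  rewrite rmorphB rmorphM /= comp_mpolyC !perm1 !comp_mpolyXU -!tnth_nth.
  by rewrite !tnth_mktuple.
pose N := \sum_(w : 'S_n) (-1) ^+ w * num w.
have [c Nc] : exists c, N = c * D 1%g.
  have mono (m : 'X_{1..n}) : exists c,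
      \sum_(w : 'S_n) (-1) ^+ w * \prod_(i < n) X (w i) ^+ m i = c * D 1%g.
    have [c Hc] := det_eval_Vandermonde y (fun i => (- 'X) ^+ m i).
    exists c; rewrite D1V -Hc; apply: eq_bigr=> w _; congr (_ * _).
    by apply: eq_bigr=> i _; rewrite !mxE horner_exp hornerN hornerX opprK.
  have NE : N = \sum_(m <- msupp (num 1%g)) (num 1%g)@_m *:
      \sum_(w : 'S_n) (-1) ^+ w * \prod_(i < n) X (w i) ^+ m i.
    under [RHS]eq_bigr do rewrite scaler_sumr.
    rewrite exchange_big /=; apply: eq_bigr=> w _.
    rewrite numE comp_mpolyE mulr_sumr; apply: eq_bigr=> m _.
    rewrite -scalerAr; congr (_ *: (_ * _)).
    by apply: eq_bigr=> i _; rewrite tnth_mktuple.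
  rewrite NE; elim: (msupp _) => [|m s [c IH]].
    by exists 0; rewrite big_nil mul0r.
  have [d Hd] := mono m; exists ((num 1%g)@_m *: d + c).
  by rewrite big_cons IH Hd mulrDl scalerAl.
have msX (s : 'S_n) i : msym s (X i) = X (s i).
  rewrite /X msymX; congr ('X_[_]); apply/mnmP=> j; rewrite mnmE !mnm1E.
  by congr (nat_of_bool _); rewrite -(inj_eq (@perm_inj _ s)) permKV.
have cs : c \is symmetric.
  apply/issymP=> s.
  have : msym s N = (-1) ^+ s * N.
    rewrite /N rmorph_sum mulr_sumr.
    rewrite (reindex_inj (mulIg (s^-1)%g)) /=; apply: eq_bigr=> w _.
    rewrite rmorphM rmorphXn rmorphN1 mulrA odd_permM odd_permV signr_addb.
    rewrite [_ ^+ w * _]mulrC; congr (_ * _).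
    rewrite /num rmorphM !rmorph_prod /=; congr (_ * _); apply: eq_bigr=> i _.
      by rewrite rmorphXn /= msX permM permKV.
    rewrite rmorph_prod; apply: eq_bigr=> j _.
    rewrite rmorphB rmorphM /= !msX !permM !permKV; congr (_ - _ * _).
    by rewrite -[t%:MP]alg_mpolyC linearZ /= msym1.
  have msD : msym s (D 1%g) = (-1) ^+ s * D 1%g.
    rewrite -Dw /D rmorph_prod; apply: eq_bigr=> i _.
    rewrite rmorph_prod; apply: eq_bigr=> j _.
    by rewrite rmorphB /= !msX !perm1.
  rewrite Nc rmorphM /= msD mulrCA => /(mulfI _) H.
  by apply: (mulIf D1n0); apply: H; rewrite signr_eq0.
exists ((HL_v n t la)^-1 *: Sympoly cs) => /=.
rewrite -mul_mpolyC tofracM /HL_frac; congr (_ * _).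
  have [->|v0] := eqVneq (HL_v n t la) 0.
    by rewrite invr0 /fracC mpolyC0 tofrac0 invr0.
  have vF0 : fracC n (HL_v n t la) != 0.
    by rewrite /fracC tofrac_eq0 mpolyC_eq0.
  apply: (mulfI vF0); rewrite divff //.
  by rewrite /fracC -tofracM -mpolyCM divff // tofrac1.
have D1F : (D 1%g)%:F != 0 by rewrite tofrac_eq0.
apply: (mulIf D1F); rewrite -tofracM -Nc /N rmorph_sum mulr_suml /=.
apply: eq_bigr=> w _.
have DwF : (D w)%:F != 0.
  by rewrite tofrac_eq0 Dw mulf_neq0 // signr_eq0.
have -> : D 1%g = (-1) ^+ w * D w.
  by rewrite [D w]Dw mulrA -signr_addb addbb mul1r.
rewrite !rmorphM /= [RHS]mulrCA; congr (_ * _).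
rewrite -[RHS]mulrA; congr (_ * _).
  by rewrite rmorph_prod; apply: eq_bigr=> i _; rewrite rmorphXn.
have -> : (D w)%:F = \prod_(i < n) \prod_(j < n | (i < j)%N)
    (fracX R (w i) - fracX R (w j)).
  rewrite rmorph_prod; apply: eq_bigr=> i _.
  by rewrite rmorph_prod; apply: eq_bigr=> j _; rewrite rmorphB.
rewrite rmorph_prod -big_split; apply: eq_bigr=> i _.
rewrite rmorph_prod -big_split; apply: eq_bigr=> j ij /=.
have nz : fracX R (w i) - fracX R (w j) != 0.
  rewrite /fracX -tofracB tofrac_eq0.
  move: DwF; rewrite tofrac_eq0 => /prodf_neq0 /(_ i isT).
  by move=> /prodf_neq0 /(_ j ij).
by rewrite (divfK nz) tofracB tofracM.
Qed.

(* [la] lists the nonzero parts. *)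
Definition HL (R : fieldType) (n : nat) (t : R) (la : seq nat) : sympoly R n :=
  if (size la <= n)%N then sval (cid (HL_polynomial n t la)) else 0.

Lemma HLE (R : fieldType) (n : nat) (t : R) (la : seq nat) :
  (size la <= n)%N -> (sympoly_val (HL n t la))%:F = HL_frac n t la.
Proof. by move=> h; rewrite /HL h; case: (cid _). Qed.

Definition HL_g (R : fieldType) (n : nat) (t : R) (k : nat) : sympoly R n :=
  (1 - t) *: HL n t [:: k].

Inductive state := st1 | st2.

Definition bool_of_state (s : state) : bool := if s is st2 then true else false.
Definition state_of_bool (b : bool) : state := if b then st2 else st1.
Lemma bool_of_stateK : cancel bool_of_state state_of_bool.
Proof. by case. Qed.
HB.instance Definition _ := Finite.copy state (can_type bool_of_stateK).

(* Bottom, left, top, right edges. *)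
Definition six_vertex (K : fieldType) (a t : K) (b l u r : state) : K :=
  match b, l, u, r with
  | st2, st2, st2, st2 => 1
  | st1, st1, st1, st1 => 1
  | st2, st1, st2, st1 => (1 - a) / (1 - t * a)
  | st2, st1, st1, st2 => (1 - t) * a / (1 - t * a)
  | st1, st2, st2, st1 => (1 - t) / (1 - t * a)
  | st1, st2, st1, st2 => t * (1 - a) / (1 - t * a)
  | _, _, _, _ => 0
  end.

(* Words e_1 ... e_n index the basis of the n-th tensor power of V; an operator
   on it, with entries in A, is a square matrix whose rows and columns are
   numbered by [enum_rank] of words and which acts on column vectors. *)
Notation word n := (n.-tuple state).
Notation operator A n := 'M[A]_#|{: word n}|.

Definition mxel (A : Type) (n : nat) (M : operator A n) (e' e : word n) : A :=
  M (enum_rank e') (enum_rank e).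

(* Rational functions of alpha over the polynomials in a_1, ..., a_n. *)
Notation ratfun R n := {fraction {poly {mpoly R[n]}}}.

Definition alphaF (R : idomainType) (n : nat) : ratfun R n := ('X)%:F.
Definition aF (R : idomainType) (n : nat) (i : 'I_n) : ratfun R n :=
  (('X_i : {mpoly R[n]})%:P)%:F.
Definition constF (R : idomainType) (n : nat) (c : R) : ratfun R n :=
  ((c%:MP_[n])%:P)%:F.

(* The edge to the left of vertex i (numbered from 0) is entry i of h_0 :: h. *)
Definition transfer (R : idomainType) (n : nat) (t : R) (e' e : word n) :
  ratfun R n :=
  \sum_(h : word n) \prod_(i < n)
    six_vertex (alphaF R n * aF R i) (constF n t)
      (tnth e i) (nth st1 (st1 :: h) i) (tnth e' i) (tnth h i).

Definition transfer_tilde (R : idomainType) (n : nat) (t : R) (e' e : word n) :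
  ratfun R n :=
  (\prod_(i < n) ((1 - constF n t * alphaF R n * aF R i) /
                  (1 - alphaF R n * aF R i))) * transfer t e' e.

(* f = \sum_k (u k) alpha^k as formal power series: if f = p / q, the Cauchy
   product of q and u is p. *)
Definition is_expansion (A : idomainType) (f : {fraction {poly A}})
    (u : nat -> A) : Prop :=
  exists p q : {poly A}, [/\ q != 0, f = p%:F / q%:F &
    forall k, \sum_(i < k.+1) q`_i * u (k - i)%N = p`_k].

Lemma is_expansion_uniq (A : idomainType) (f : {fraction {poly A}})
    (u v : nat -> A) :
  is_expansion f u -> is_expansion f v -> u =1 v.
Proof.
have key (p q : {poly A}) (w : nat -> A) k :
    (forall k, \sum_(i < k.+1) q`_i * w (k - i)%N = p`_k) ->
    forall N, (k < N)%N -> (q * \poly_(i < N) w i)`_k = p`_k.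
  move=> H N kN; rewrite -H coefM; apply: eq_bigr=> i _; rewrite coef_poly.
  by rewrite (leq_ltn_trans (leq_subr _ _) kN).
move=> [p [q [q0 -> Hu]]] [p' [q' [q'0 E Hv]]] k.
have {E} E : p * q' = p' * q.
  have qF : q%:F != 0 by rewrite tofrac_eq0.
  have q'F : q'%:F != 0 by rewrite tofrac_eq0.
  move/eqP: E; rewrite (eqr_div _ _ qF q'F) -!tofracM tofrac_eq.
  by move=> /eqP.
have Q0 : q * q' != 0 by rewrite mulf_neq0.
pose N := (size (q * q')%R + k)%N.+1.
pose d := \poly_(i < N) u i - \poly_(i < N) v i.
have cd j : (j < N)%N -> (q * q' * d)`_j = 0.
  move=> jN; rewrite /d mulrBr coefB.
  have -> : q * q' * \poly_(i < N) u i = q' * (q * \poly_(i < N) u i).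
    by rewrite mulrAC mulrC mulrA.
  rewrite -[q * q' * _]mulrA; apply/eqP; rewrite subr_eq0; apply/eqP.
  transitivity ((q' * p)`_j); last first.
    rewrite mulrC E mulrC !coefM; apply: eq_bigr=> i _; congr (_ * _).
    by symmetry; apply: key => //; apply: leq_ltn_trans (leq_subr _ _) jN.
  rewrite !coefM; apply: eq_bigr=> i _; congr (_ * _).
  by apply: key => //; apply: leq_ltn_trans (leq_subr _ _) jN.
have ex : exists i, (q * q')`_i != 0.
  by exists (size (q * q')).-1; rewrite -lead_coefE lead_coef_eq0.
pose m := ex_minn ex.
have [m0 mmin] : (q * q')`_m != 0 /\ forall i, (i < m)%N -> (q * q')`_i = 0.
  rewrite /m; case: ex_minnP => i i0 imin; split=> // j ji.
  by apply/eqP; apply: contraLR ji => /imin; rewrite -leqNgt.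
have mN : (m < size (q * q')%R)%N.
  by rewrite ltnNge; apply: contra m0 => /(nth_default 0) ->.
have d0 j : (j <= k)%N -> d`_j = 0.
  elim/ltn_ind: j => j IH jk.
  have jN : (m + j < N)%N by rewrite ltnS leq_add // ltnW.
  have := cd _ jN; rewrite coefM.
  have mj : (m < (m + j).+1)%N by rewrite ltnS leq_addr.
  rewrite (bigD1 (Ordinal mj)) //= big1 ?addr0 => [|i].
    by rewrite addKn => /eqP; rewrite mulf_eq0 (negPf m0) => /eqP.
  rewrite -val_eqE /= => im.
  have [lt|ge] := ltnP i m; first by rewrite mmin ?mul0r.
  have mi : (m < i)%N by rewrite ltn_neqAle eq_sym im.
  have ij : (m + j - i < j)%N.
    by rewrite ltn_subLR 1?ltn_add2r // -ltnS.
  by rewrite IH ?mulr0 // ltnW // (leq_trans ij).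
have kN : (k < N)%N by rewrite ltnS leq_addl.
by have := d0 k (leqnn k); rewrite /d coefB !coef_poly kN => /subr0_eq.
Qed.

Lemma is_expansion_ex (A : idomainType) (p q : {poly A}) :
  q`_0 = 1 -> exists u, is_expansion (p%:F / q%:F) u.
Proof.
move=> q0.
pose next k (s : seq A) := p`_k - \sum_(i < k) q`_i.+1 * s`_(k.-1 - i).
pose s := fix s k := if k is k'.+1 then rcons (s k') (next k' (s k')) else [::].
have ss k : size (s k) = k by elim: k => //= k IH; rewrite size_rcons IH.
pose u k := next k (s k).
have su k j : (j < k)%N -> (s k)`_j = u j.
  elim: k => //= k IH jk; rewrite nth_rcons ss.
  have [/IH //|kj] := ltnP j k.
  have -> : j = k by apply/eqP; rewrite eqn_leq kj -ltnS jk.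
  by rewrite eqxx.
exists u, p, q; split=> //.
  by apply/eqP=> E; move: q0; rewrite E coef0 => /esym/eqP; rewrite oner_eq0.
move=> k; rewrite big_ord_recl q0 mul1r subn0 {1}/u /next.
rewrite -addrA [- _ + _]addrC; apply/eqP; rewrite eq_sym -subr_eq0 opprD.
rewrite addrA subrr add0r oppr_eq0 subr_eq0; apply/eqP.
apply: eq_bigr=> i _; rewrite lift0; congr (_ * _).
case: k i => [[]//|k] i; rewrite subSS su //.
by rewrite ltnS leq_subr.
Qed.

Lemma transfer_tilde_expansion (R : idomainType) (n : nat) (t : R)
    (e' e : word n) :
  exists u, is_expansion (transfer_tilde t e' e) u.
Proof.
pose P (f : ratfun R n) := exists p q : {poly {mpoly R[n]}},
  q`_0 = 1 /\ f = p%:F / q%:F.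
suff [p [q [q0 ->]]] : P (transfer_tilde t e' e) by apply: is_expansion_ex.
have qn0 (q : {poly {mpoly R[n]}}) : q`_0 = 1 -> q%:F != 0.
  move=> q0; rewrite tofrac_eq0; apply/eqP=> E.
  by move: q0; rewrite E coef0 => /esym/eqP; rewrite oner_eq0.
have PF p : P p%:F.
  by exists p, 1; rewrite coef1 tofrac1 divr1.
have PM f g : P f -> P g -> P (f * g).
  move=> [p [q [q0 ->]]] [p' [q' [q'0 ->]]]; exists (p * p'), (q * q').
  by rewrite coef0M q0 q'0 mulr1 !tofracM mulf_div.
have PD f g : P f -> P g -> P (f + g).
  move=> [p [q [q0 ->]]] [p' [q' [q'0 ->]]].
  exists (p * q' + p' * q), (q * q').
  rewrite coef0M q0 q'0 mulr1 tofracD !tofracM; split=> //.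
  by rewrite addf_div ?qn0.
have P0 : P 0 by rewrite -tofrac0.
have P1 : P 1 by rewrite -tofrac1.
have PV (c : {mpoly R[n]}) p : P (p%:F / (1 - c%:P * 'X)%:F).
  exists p, (1 - c%:P * 'X); split=> //.
  by rewrite coefB coef1 coefMX subr0.
have Ea i : 1 - alphaF R n * aF R i = (1 - ('X_i : {mpoly R[n]})%:P * 'X)%:F.
  by rewrite tofracB tofracM tofrac1 mulrC.
have Et i : 1 - constF n t * (alphaF R n * aF R i) =
    (1 - (t%:MP_[n] * 'X_i)%:P * 'X)%:F.
  by rewrite polyCM tofracB tofrac1 !tofracM -mulrA [alphaF R n * _]mulrC.
apply: (PM).
  apply: (big_ind P) => // i _; rewrite -[constF n t * _ * _]mulrA Et Ea.
  exact: PV.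
apply: (big_ind P) => // h _; apply: (big_ind P) => // i _.
have Pt : P (constF n t) by apply: PF.
have Pt1 : P (1 - constF n t) by rewrite -tofrac1 -tofracB; apply: PF.
have Pa : P (alphaF R n * aF R i) by rewrite -tofracM; apply: PF.
have Pa1 : P (1 - alphaF R n * aF R i) by rewrite Ea; apply: PF.
have PI : P (1 - constF n t * (alphaF R n * aF R i))^-1.
  by have := PV (t%:MP_[n] * 'X_i) 1; rewrite tofrac1 div1r -Et.
move: Pt Pt1 Pa Pa1 PI; rewrite /six_vertex.
move: (constF n t) (alphaF R n * aF R i) => T a Pt Pt1 Pa Pa1 PI.
case: (tnth e i) => /=; case: (nth _ _ _) => /=;
  case: (tnth e' i) => /=; case: (tnth h i) => /=;
  first [exact: P1 | exact: P0 | exact: (PM _ _ Pa1 PI)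
    | exact: (PM _ _ Pt1 PI) | exact: (PM _ _ (PM _ _ Pt1 Pa) PI)
    | exact: (PM _ _ (PM _ _ Pt Pa1) PI)].
Qed.

Definition transfer_coef (R : idomainType) (n : nat) (t : R) (k : nat) :
  operator {mpoly R[n]} n :=
  \matrix_(i, j)
    sval (cid (transfer_tilde_expansion t (enum_val i) (enum_val j))) k.

Lemma transfer_coefP (R : idomainType) (n : nat) (t : R) (e' e : word n) :
  is_expansion (transfer_tilde t e' e)
    (fun k => mxel (transfer_coef n t k) e' e).
Proof.
case E : (cid (transfer_tilde_expansion t e' e)) => [u Hu].
suff -> : (fun k => mxel (transfer_coef n t k) e' e) = u by [].
by apply/funext=> k; rewrite /mxel mxE !enum_rankK E.
Qed.

(* Main.v *)
(* Write s_i for the transposition of x_i and x_(i+1).  The operators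
   T_i (f e) = s_i(f) T e + (1 - t) x_i (f - s_i f) / (x_i - x_(i+1)) e, where
   T is the constant braid operator 12 |-> 21, 21 |-> t 12 + (1 - t) 21 on
   positions i, i + 1 of the word e, satisfy the Hecke relations.  By the
   Yang-Baxter equation every transfer operator commutes with all T_i, and the
   vectors 1^j (2 - t^(k-1) 1) ... (2 - t 1) (2 - 1), with j + k = n, are
   eigenvectors, on which the image of a symmetric polynomial f acts by
   f(x_1, ..., x_j, 0, ..., 0).
   A sorted word 1^m 2^k is a sum of Hecke shuffles of such eigenvectors, and
   P_lambda(x_1, ..., x_j) is itself built from products of variables by
   shuffles, column by column.  Combining both, Theta(P_lambda) 1^m 2^k is a
   shuffle of vectors x_I v in which the variables are only moved to the right,
   and such vectors generate a cone of nonnegative vectors stable under all T_i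
   because Tbar_i (x_i v) = x_(i+1) T_i v, with Tbar_i = T_i - (1 - t).  Every
   word is obtained from a sorted one by applying operators T_i. *)

Require Import Defs.
From HB Require Import structures.
From mathcomp Require Import all_boot all_order all_fingroup all_algebra.
From mathcomp Require Import boolp reals.
From mathcomp Require Import mpoly.
From mathcomp Require Import zify ring.

Set Implicit Arguments.
Unset Strict Implicit.
Unset Printing Implicit Defensive.

Import Order.TTheory GRing.Theory Num.Theory.
Local Open Scope ring_scope.

(** * Hecke operators and shuffles *)

(** The obstacle is sign. [Tbar] sends 12 to 21 - (1 - t) 12, and the eigenvectors have coefficients
    of both signs, so neither a shuffle nor a single summand of the resolution of 1^m 2^k is
    positive by itself. The relation between Tbar_i and x_i repairs a shuffle only if every Tbar in
    it moves a variable onto a site without one, and it says nothing about the eigenvectors. These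
    have to be eliminated: the resolution is used once to evaluate Theta(P_lambda), and then
    backwards, to sum the eigenvectors up to words again. In between, the shuffle of the first
    column of lambda must be interchanged with the sum over j, although its sites 0, ..., m + j - 1
    depend on j and overlap only partly with the sites m, ..., n - 1 of the resolution. Positivity
    that persists under all T_i ([T_pos]), rather than mere nonnegativity, is the statement that
    survives the inductions over columns and over unsorted words. *)

Section HeckeOperators.
Variables (R : comNzRingType) (t : R) (V : lmodType R).
Variable T : nat -> {linear V -> V}.

(** By the quadratic relation this is t T_i^(-1), written so that it also makes sense at t = 0,
    where T_i need not be invertible. *)
Definition Tbar (i : nat) (v : V) : V := T i v - (1 - t) *: v.

Fact Tbar_is_linear i : linear (Tbar i).
Proof.
by move=> c u v; rewrite /Tbar linearP !scalerDr !scalerN !scalerA opprD addrACA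
  [(1 - t) * c]mulrC.
Qed.
HB.instance Definition _ i :=
  GRing.isLinear.Build R V V *:%R (Tbar i) (Tbar_is_linear i).

(* The letter in position i is carried to position i + k. *)
Fixpoint carry (i k : nat) (v : V) : V :=
  if k is k'.+1 then Tbar (i + k') (carry i k' v) else v.

Fact carry_is_linear i k : linear (carry i k).
Proof. by move=> c u v; elim: k => //= k ->; rewrite linearP. Qed.
HB.instance Definition _ i k :=
  GRing.isLinear.Build R V V *:%R (carry i k) (carry_is_linear i k).

(* The sum of Tbar_y over the minimal coset representatives y of
   S_r x S_(N - r) in S_N, where S_N acts on the sites o, ..., o + N - 1. *)
Fixpoint shuffle (o r N : nat) (v : V) {struct N} : V :=
  match r, N with
  | 0, _ => v
  | _.+1, 0 => 0
  | r'.+1, N'.+1 =>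
      shuffle o r N' v + shuffle o r' N' (carry (o + r') (N' - r') v)
  end.

Fact shuffle_is_linear o r N : linear (shuffle o r N).
Proof.
elim: N r => [|N IH] [|r] c u v //=; first by rewrite scaler0 addr0.
by rewrite IH linearP IH scalerDr addrACA.
Qed.
HB.instance Definition _ o r N :=
  GRing.isLinear.Build R V V *:%R (shuffle o r N) (shuffle_is_linear o r N).

Lemma shuffle0 o N v : shuffle o 0 N v = v. Proof. by case: N. Qed.

Lemma shuffle_gt o r N v : (N < r)%N -> shuffle o r N v = 0.
Proof.
elim: N r v => [|N IH] [|r] v //= Nr.
by rewrite !IH ?addr0 // ltnW.
Qed.

Lemma shuffle_full o r v : shuffle o r r v = v.
Proof.
elim: r v => //= r IH v.
by rewrite shuffle_gt // add0r subnn IH.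
Qed.

End HeckeOperators.

Section HeckeMorphisms.
Variables (R : comNzRingType) (t : R) (V W : lmodType R).
Variables (T : nat -> {linear V -> V}) (T' : nat -> {linear W -> W}).
Variable f : {linear V -> W}.

Lemma map_Tbar i v :
  f (T i v) = T' i (f v) -> f (Tbar t T i v) = Tbar t T' i (f v).
Proof. by move=> fT; rewrite /Tbar linearB linearZ /= fT. Qed.

Lemma map_carry i k v :
  (forall j u, (i <= j < i + k)%N -> f (T j u) = T' j (f u)) ->
  f (carry t T i k v) = carry t T' i k (f v).
Proof.
elim: k => //= k IH fT.
have fT' j u : (i <= j < i + k)%N -> f (T j u) = T' j (f u).
  by move=> ij; apply: fT; lia.
by rewrite map_Tbar; [rewrite IH | apply: fT; lia].
Qed.

Lemma map_shuffle o r N v :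
  (forall j u, (o <= j)%N -> (j.+1 < o + N)%N -> f (T j u) = T' j (f u)) ->
  f (shuffle t T o r N v) = shuffle t T' o r N (f v).
Proof.
elim: N r v => [|N IH] [|r] v //= fT; first by rewrite linear0.
have fT' j u : (o <= j)%N -> (j.+1 < o + N)%N -> f (T j u) = T' j (f u).
  by move=> oj jN; apply: fT => //; lia.
rewrite linearD !IH // map_carry // => j u ij.
by apply: fT; lia.
Qed.

End HeckeMorphisms.

Section HeckeRelations.
Variables (R : comNzRingType) (t : R) (V : lmodType R) (n : nat).
Variable T : nat -> {linear V -> V}.
Hypothesis quad : forall i v, (i.+1 < n)%N ->
  T i (T i v) = (1 - t) *: T i v + t *: v.
Hypothesis braid : forall i v, (i.+2 < n)%N ->
  T i (T i.+1 (T i v)) = T i.+1 (T i (T i.+1 v)).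
Hypothesis far : forall i j v, (i.+1 < j)%N -> (j.+1 < n)%N ->
  T i (T j v) = T j (T i v).

Local Notation Tb := (Tbar t T).
Local Notation D := (carry t T).
Local Notation S := (shuffle t T).

Lemma T_Tbar i v : (i.+1 < n)%N -> T i (Tb i v) = t *: v.
Proof. by move=> ?; rewrite /Tbar linearB linearZ /= quad // addrC addKr. Qed.

Lemma T_TbarD i v : T i v = Tb i v + (1 - t) *: v.
Proof. by rewrite /Tbar subrK. Qed.

Lemma farC i j v : (i.+1 < j)%N || (j.+1 < i)%N ->
  (i.+1 < n)%N -> (j.+1 < n)%N -> T i (T j v) = T j (T i v).
Proof. by case/orP=> ij ni nj; [apply: far | apply/esym/far]. Qed.

Lemma far_Tbar i j v : (i.+1 < j)%N || (j.+1 < i)%N ->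
  (i.+1 < n)%N -> (j.+1 < n)%N -> T i (Tb j v) = Tb j (T i v).
Proof. by move=> *; apply: map_Tbar; apply: farC. Qed.

(** A braid relation with two factors inverted, obtained without dividing by t: both sides expand to
    the same combination of T_i T_(i+1) T_i, T_i T_(i+1) and the identity. *)
Lemma braid_Tbar i v : (i.+2 < n)%N ->
  T i (Tb i.+1 (Tb i v)) = Tb i.+1 (Tb i (T i.+1 v)).
Proof.
move=> ni; have ni' := ltnW ni; set c := 1 - t.
transitivity (T i (T i.+1 (T i v)) - c *: T i (T i.+1 v) - (c * t) *: v).
  rewrite /Tbar -/c !(linearB, linearZ) /= quad // -/c.
  by congr (_ + _); rewrite opprK opprD addrAC addNr add0r -scalerN scalerA.
rewrite /Tbar -/c !(linearB, linearZ) /= braid // quad // -/c.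
rewrite -scalerA -!addrA -!scalerDr opprK opprD.
congr (_ + c *: _).
by rewrite [RHS]addrC -[RHS]addrA addNKr scalerN.
Qed.

Lemma braid_Tbar' i v : (i.+2 < n)%N ->
  T i.+1 (Tb i (Tb i.+1 v)) = Tb i (Tb i.+1 (T i v)).
Proof.
move=> ni; have ni' := ltnW ni; set c := 1 - t.
transitivity (T i (T i.+1 (T i v)) - c *: T i.+1 (T i v) - (c * t) *: v).
  rewrite /Tbar -/c !(linearB, linearZ) /= -braid // quad // -/c.
  by congr (_ + _); rewrite opprK opprD addrAC addNr add0r -scalerN scalerA.
rewrite /Tbar -/c !(linearB, linearZ) /= quad // -/c.
rewrite -scalerA -!addrA -!scalerDr opprK opprD.
congr (_ + c *: _).
by rewrite [RHS]addrC -[RHS]addrA addNKr scalerN.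
Qed.

Lemma far_carry i k j v : (j.+1 < i)%N || (i + k < j)%N ->
  (i + k < n)%N -> (j.+1 < n)%N -> T j (carry t T i k v) = carry t T i k (T j v).
Proof.
move=> ij ik jn; apply: (@map_carry _ _ _ _ T T (T j)) => l u il.
by apply: farC; lia.
Qed.

Lemma far_carry_Tbar i k j v : (j.+1 < i)%N || (i + k < j)%N ->
  (i + k < n)%N -> (j.+1 < n)%N -> Tb j (D i k v) = D i k (Tb j v).
Proof. by move=> ij ik jn; rewrite {1}/Tbar far_carry // -linearZ -linearB. Qed.

(* The braid relation slides T through the moving letter. *)
Lemma carry_T i k j v : (i <= j)%N -> (j.+1 < i + k)%N -> (i + k < n)%N ->
  T j (D i k v) = D i k (T j.+1 v).
Proof.
elim: k => [|k IH] ij jk ikn; first by lia.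
have [jk'|jk'] := ltnP j.+1 (i + k).
  by rewrite /= far_Tbar ?IH //; lia.
case: k IH jk ikn jk' => [|k] IH jk ikn jk'; first by lia.
have {jk jk'}-> : j = (i + k)%N by lia.
rewrite /= !addnS braid_Tbar; last by lia.
by rewrite far_carry //; lia.
Qed.

Lemma far_shuffle o r N j v : (j.+1 < o)%N || (o + N <= j)%N ->
  (o + N <= n)%N -> (j.+1 < n)%N -> T j (S o r N v) = S o r N (T j v).
Proof.
move=> oj oN jn; apply: (@map_shuffle _ _ _ _ T T (T j)) => l u ol lN.
by apply: farC; lia.
Qed.

(** Two neighbouring letters carried equally far keep their order, so the operator acting on them
    just changes its index. *)
Lemma carry_carry_T i k v : (i.+1 + k < n)%N ->
  T (i + k) (D i k (D i.+1 k v)) = D i k (D i.+1 k (T i v)).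
Proof.
elim: k => [|k IH] ik; first by rewrite addn0.
rewrite /= -!far_carry_Tbar -?IH; try lia.
by rewrite addnS addSn braid_Tbar' //; lia.
Qed.

Lemma carry_first i k v : D i k.+1 v = D i.+1 k (Tb i v).
Proof.
elim: k => [|k IH]; first by rewrite /= addn0.
by rewrite -[LHS]/(Tb (i + k.+1) (D i k.+1 v)) IH /= addnS addSn.
Qed.

Lemma carryD i k l v : D (i + k) l (D i k v) = D i (k + l) v.
Proof.
by elim: l => [|l IH]; rewrite ?addn0 ?addnS //= IH addnA.
Qed.

Lemma shuffle_shift o r N v :
  shuffle t (fun j => T j.+1) o r N v = S o.+1 r N v.
Proof.
elim: N r v => [|N IH] [|r] v //=; rewrite !IH; congr (_ + S _ _ _ _).
by elim: (N - r)%N => //= k ->; rewrite addSn.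
Qed.

(** Carrying letter o to the far end shifts the N letters behind it one site to the left, and the
    shuffle of these letters shifts with them. *)
Lemma carry_shuffle o a N v : (o + N < n)%N ->
  S o a N (D o N v) = D o N (S o.+1 a N v).
Proof.
move=> oN; rewrite -shuffle_shift.
rewrite (@map_shuffle _ _ _ _ (fun j => T j.+1) T (D o N)) // => j u oj jN.
by rewrite carry_T.
Qed.

(** The coset sum is a partial symmetrizer from S_r x S_(N-r) to S_N. Only the last generator
    escapes the induction on N; for it the recursion is unfolded twice, which sorts the terms by
    which of the last two sites receive one of the r letters. *)
Lemma shuffle_inv o r N v :
  (r <= N)%N -> (o + N <= n)%N ->
  (forall i, (o <= i)%N -> (i.+1 < o + r)%N -> T i v = v) ->
  (forall i, (o + r <= i)%N -> (i.+1 < o + N)%N -> T i v = v) ->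
  forall i, (o <= i)%N -> (i.+1 < o + N)%N -> T i (S o r N v) = S o r N v.
Proof.
elim/ltn_ind: N r v => N IH r v rN oN inv1 inv2 i oi iN.
case: r => [|r] in rN inv1 inv2 *.
  by rewrite shuffle0 inv2 // addn0.
have [eN|rN'] := eqVneq r.+1 N; first by rewrite eN shuffle_full inv1 ?eN.
case: N => [|N] in IH rN oN iN inv2 rN' *; first by [].
have {rN rN'}rN : (r < N)%N by lia.
rewrite /=; set w := D _ _ v.
have [iN'|iN'] := ltnP i.+1 (o + N).
  rewrite linearD /= !IH //; try lia.
  - move=> l ol lr; rewrite /w far_carry; try lia.
    by rewrite inv1 //; lia.
  - move=> l ol lr; rewrite /w carry_T; try lia.
    by rewrite inv2 //; lia.
  - by move=> l ol lr; rewrite inv2 //; lia.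
case: N => [|N] in IH oN iN inv2 rN w iN' *; first by [].
have {iN iN' oi}-> : i = (o + N)%N by lia.
have Sv : T (o + N) (S o r.+1 N v) = S o r.+1 N v.
  have [rN'|Nr] := leqP r.+1 N; last by rewrite shuffle_gt ?linear0.
  by rewrite far_shuffle ?inv2 //; lia.
(* [u] and [w], which is Tbar of [u], are the terms in which exactly one of the last two sites is
   reached. Their sum is T u + t u, and T fixes this by the quadratic relation. *)
pose u := D (o + r) (N - r) v.
have wE : w = Tb (o + N) u.
  by rewrite /w /u subSn //= -addnA subnKC.
have Suw : S o r N (u + w) = S o r N (T (o + N) u + t *: u).
  by rewrite wE /Tbar addrCA; congr (S _ _ _ (_ + _));
     rewrite scalerBl scale1r opprB addrCA subrr addr0.
have Tuw : T (o + N) (T (o + N) u + t *: u) = T (o + N) u + t *: u.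
  rewrite linearD linearZ /= quad; last by lia.
  by rewrite addrAC -scalerDl subrK scale1r.
rewrite [S o r N.+1 w]/=; case: r => [|r] in inv1 inv2 rN w u Sv wE Suw Tuw *.
  rewrite /= !shuffle0 -/u -/w in Suw *.
  by rewrite -addrA Suw !linearD /= Sv -[T _ _ + T _ _]linearD Tuw.
(* Here both of the last two sites are reached, and T passes through the two carried letters to
   their original sites, where [v] is invariant. *)
have DDw : T (o + N) (D (o + r) (N - r) w) = D (o + r) (N - r) w.
  have rN' : (o + r + (N - r) = o + N)%N by lia.
  by rewrite /w subSS addnS -rN' carry_carry_T ?inv1 //; lia.
have -> : S o r.+2 N.+1 v + (S o r.+1 N w + S o r N (D (o + r) (N - r) w)) =
    S o r.+2 N v + S o r.+1 N (u + w) + S o r N (D (o + r) (N - r) w).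
  by rewrite linearD /= -/u !addrA.
rewrite Suw.
have farS r' x : T (o + N) x = x -> T (o + N) (S o r' N x) = S o r' N x.
  by move=> Tx; rewrite far_shuffle ?Tx //; lia.
by rewrite 2!(linearD (T (o + N))) /= Sv !farS.
Qed.

Lemma far_foldr_carry o m i k v : (o + m < i)%N -> (i + k < n)%N ->
  foldr Tb (D i k v) (iota o m) = D i k (foldr Tb v (iota o m)).
Proof.
elim: m o => //= m IH o omi ik.
by rewrite IH ?far_carry_Tbar //; lia.
Qed.

(** Sorts the coset representatives by what ends on the first site instead of the last one: either
    letter o stays there, or the first unselected letter comes from o + r + 1, brought past the r +
    1 selected ones by Tbar_o ... Tbar_(o+r). *)
Lemma shuffle_left o r N v : (o + N < n)%N ->
  S o r.+1 N.+1 v =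
  S o.+1 r N v + S o.+1 r.+1 N (foldr Tb v (iota o r.+1)).
Proof.
elim: N r v => [|N IH] r v oN; first by case: r; rewrite /= ?add0r ?addr0.
rewrite -[LHS]/(S o r.+1 N.+1 v + S o r N.+1 (D (o + r) (N.+1 - r) v)).
case: r => [|r].
  rewrite IH; last by lia.
  by rewrite /= !shuffle0 !addn0 subn0 -carry_first [RHS]addrA.
rewrite IH; last by lia.
rewrite IH; last by lia.
set w := D _ _ v; set u := foldr _ v _.
rewrite [S o.+1 r.+1 N.+1 v]/= [S o.+1 r.+2 N.+1 u]/=.
have -> : D (o.+1 + r) (N - r) v = w by rewrite /w subSS addnS addSn.
have <- : S o.+1 r.+1 N (foldr Tb w (iota o r.+1)) =
    S o.+1 r.+1 N (D (o.+1 + r.+1) (N - r.+1) u).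
  have [rN|Nr] := ltnP r N; last by rewrite !shuffle_gt.
  congr (S _ _ _ _); rewrite /w subSS -(subnSK rN) carry_first addSn /u.
  rewrite -[r.+2]addn1 iotaD foldr_cat /=.
  by apply: (@far_foldr_carry o r.+1); lia.
by rewrite -[LHS]addrA [X in _ + X]addrCA [LHS]addrA.
Qed.

(** Both sides sum Tbar_y over the minimal coset representatives of S_r x S_(j-r) x S_(k-j) in
    S_k. *)
Lemma shuffleA o r j k v : (r <= j)%N -> (j <= k)%N -> (o + k <= n)%N ->
  S o j k (S o r j v) = S o r k (S (o + r) (j - r) (k - r) v).
Proof.
elim: k r j v => [|k IH] [|r] [|j] v rj jk okn //.
  by rewrite !shuffle0 addn0 !subn0.
have {jk}[->|jk] : j = k \/ (j < k)%N by lia.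
  by rewrite shuffle_full shuffle_full.
rewrite -[LHS]/(S o j.+1 k (S o r.+1 j.+1 v) +
  S o j k (D (o + j) (k - j) (S o r.+1 j.+1 v))) IH; try lia.
rewrite -[RHS]/(S o r.+1 k _ + S o r k (D (o + r) (k - r) _)).
set w := D (o + r) (k - r) v.
have DE : D (o + j) (k - j) (S o r.+1 j.+1 v) =
    S o r.+1 j (D (o + j) (k - j) v) + S o r j w.
  have comm r' x : D (o + j) (k - j) (S o r' j x) =
      S o r' j (D (o + j) (k - j) x).
    apply: (@map_shuffle _ _ _ _ T T) => l u ol lj.
    by rewrite far_carry //; lia.
  rewrite [S o r.+1 j.+1 v]/= linearD /= !comm; congr (_ + S _ _ _ _).
  have {1}-> : (o + j = o + r + (j - r))%N by lia.
  by rewrite carryD; congr (D _ _ _); lia.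
rewrite DE linearD /= [S o j k (S o r j w)]IH; try lia.
have -> : S (o + r) (j - r) (k - r) w =
    D (o + r) (k - r) (S (o + r).+1 (j - r) (k - r) v).
  by rewrite carry_shuffle //; lia.
rewrite addrA; congr (_ + S _ _ _ _); last by rewrite !subSS addnS.
have {rj}[->|rj] : r = j \/ (r < j)%N by lia.
  by rewrite [S o j.+1 j _]shuffle_gt // linear0 addr0 !subnn !shuffle0.
rewrite IH; try lia.
rewrite -linearD /=; congr (S _ _ _ _).
rewrite !subSS -(subnSK rj) -(subnSK (leq_trans rj (ltnW jk))) /=.
congr (_ + S _ _ _ (D _ _ _)); lia.
Qed.

End HeckeRelations.

(** * Divided differences and the Hecke action on vectors *)

Section DividedDifference.
Variables (R : idomainType) (n : nat).
Local Notation A := {mpoly R[n]}.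

Lemma msymXU (s : 'S_n) i : msym s ('X_i : A) = 'X_(s i).
Proof.
rewrite msymX; congr ('X_[_]); apply/mnmP=> j; rewrite mnmE !mnm1E.
by congr (nat_of_bool _); rewrite -(inj_eq (@perm_inj _ s)) permKV.
Qed.

Lemma msymC (s : 'S_n) (c : R) : msym s (c%:MP : A) = c%:MP.
Proof. by rewrite -alg_mpolyC linearZ /= msym1. Qed.

Lemma mpolyX_inj : injective (fun i : 'I_n => 'X_i : A).
Proof.
move=> i j /(congr1 (mcoeff U_(i))); rewrite !mcoeffX eqxx.
case: eqP => [/mnmP /(_ i)|_ /eqP]; last by rewrite oner_eq0.
by rewrite !mnm1E eqxx; case: eqP.
Qed.

Lemma mpoly_alg_ind (P : A -> Prop) :
  (forall c, P c%:MP) -> (forall i, P 'X_i) ->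
  (forall p q, P p -> P q -> P (p + q)) ->
  (forall p q, P p -> P q -> P (p * q)) -> forall p, P p.
Proof.
move=> PC PX PD PM; elim/mpolyind => [|c m p _ _ Pp]; first by rewrite -mpolyC0.
apply: (PD) => //; rewrite -mul_mpolyC; apply: (PM) => //.
rewrite mpolyXE_id; apply: (big_ind P) => [||i _]; [by rewrite -mpolyC1|exact: PM|].
by elim: (m i) => [|k IH]; rewrite ?expr0 -?mpolyC1 // exprS; apply: PM.
Qed.

Lemma ddiff_exists (i j : 'I_n) (f : A) :
  exists g : A, ('X_i - 'X_j) * g = f - msym (tperm i j) f.
Proof.
elim/mpoly_alg_ind: f => [c|k|p q [g Eg] [h Eh]|p q [g Eg] [h Eh]].
- by exists 0; rewrite msymC subrr mulr0.
- rewrite msymXU; case: tpermP => [->|->|_ _]; last by exists 0; rewrite subrr mulr0.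
    by exists 1; rewrite mulr1.
  by exists (-1); rewrite mulrN1 opprB.
- by exists (g + h); rewrite mulrDr Eg Eh msymD opprD addrACA.
exists (g * q + msym (tperm i j) p * h).
rewrite mulrDr mulrA Eg mulrCA Eh msymM; ring.
Qed.

Definition ddiff i j f : A := sval (cid (ddiff_exists i j f)).

Lemma ddiffP i j f : ('X_i - 'X_j) * ddiff i j f = f - msym (tperm i j) f.
Proof. by rewrite /ddiff; case: (cid _). Qed.

Lemma subX_neq0 (i j : 'I_n) : i != j -> 'X_i - 'X_j != 0 :> A.
Proof. by rewrite subr_eq0 (inj_eq mpolyX_inj). Qed.

Lemma ddiff_eq i j f g : i != j ->
  ('X_i - 'X_j) * g = f - msym (tperm i j) f -> ddiff i j f = g.
Proof. by move=> /subX_neq0 /mulfI I E; apply: I; rewrite ddiffP. Qed.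

End DividedDifference.

Section Sites.
Variables (R : idomainType) (N : nat) (t : R).
Local Notation n := N.+1.
Local Notation A := {mpoly R[n]}.
Local Notation W := {ffun n.-tuple state -> A}.

Definition xvar (i : nat) : A := 'X_(inord i).
Definition adj (i : nat) : 'S_n := tperm (inord i) (inord i.+1).
Definition swapw i (e : n.-tuple state) : n.-tuple state :=
  [tuple tnth e (adj i j) | j < n].

Lemma adj_tperm i : adj i = tperm (inord i) (inord i.+1).
Proof. by []. Qed.

Lemma inord_inj i j : (i < n)%N -> (j < n)%N ->
  (inord i == inord j :> 'I_n) = (i == j).
Proof. by move=> iN jN; rewrite -val_eqE /= !inordK. Qed.

Lemma inord_succ_neq i : (i.+1 < n)%N -> inord i != inord i.+1 :> 'I_n.
Proof. by move=> iN; rewrite inord_inj; lia. Qed.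

Lemma adjE i j : (i.+1 < n)%N -> (j < n)%N ->
  adj i (inord j) = inord (if j == i then i.+1 else if j == i.+1 then i else j).
Proof.
move=> iN jN; rewrite /adj.
have [->|ji] := eqVneq j i; first by rewrite tpermL.
have [->|ji'] := eqVneq j i.+1; first by rewrite tpermR.
by rewrite tpermD // inord_inj //; lia.
Qed.

Lemma adjK i : (adj i * adj i = 1)%g.
Proof. exact: tperm2. Qed.

Lemma adj_braid i : (i.+2 < n)%N ->
  (adj i * (adj i.+1 * adj i) = adj i.+1 * (adj i * adj i.+1))%g.
Proof.
move=> iN; have V j : adj j = ((adj j)^-1)%g by rewrite /adj tpermV.
rewrite {1}[adj i]V {2}[adj i.+1]V -!/(conjg _ _) /adj !tpermJ.
rewrite -/(adj i) -/(adj i.+1) !adjE //; try lia.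
by rewrite !eqxx; repeat case: eqP => //; lia.
Qed.

Lemma adj_far i j : (i.+1 < j)%N -> (j.+1 < n)%N ->
  (adj i * adj j = adj j * adj i)%g.
Proof.
move=> ij jN; apply: (mulgI (adj i)^-1%g).
rewrite mulKg -[RHS]/((adj j) ^ (adj i))%g {2}/adj tpermJ !adjE; try lia.
by repeat case: eqP => //; lia.
Qed.

End Sites.

Section VectorHecke.
Variables (R : idomainType) (N : nat) (t : R).
Local Notation n := N.+1.
Local Notation A := {mpoly R[n]}.
Local Notation word := (n.-tuple state).
Local Notation W := {ffun word -> A}.
Local Notation x := (xvar R N).
Local Notation adj := (adj N).
Local Notation "e `_[ i ]" := (tnth e (inord i)) (at level 2, format "e `_[ i ]").

(** Out of range, [inord] may identify the two sites and the quotient is then arbitrary; the value 0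
    keeps [dd i] linear for every i. *)
Definition dd i (f : A) : A :=
  if (i.+1 < n)%N then ddiff (inord i) (inord i.+1) f else 0.

(* The coefficients of e and of e with positions i, i + 1 exchanged in the
   constant Hecke operator: 12 |-> 21, 21 |-> t 12 + (1 - t) 21. *)
Definition stay_coef (s s' : state) : R :=
  match s, s' with st1, st2 => 0 | st2, st1 => 1 - t | _, _ => 1 end.
Definition swap_coef (s s' : state) : R :=
  match s, s' with st1, st2 => t | st2, st1 => 1 | _, _ => 0 end.

(** Here [e] is the output word: the coefficient of 12 collects t times that of 21, and the
    coefficient of 21 collects those of 12 and of 21 itself. *)
Definition Hecke i (v : W) : W :=
  [ffun e => stay_coef e`_[i] e`_[i.+1] *: msym (adj i) (v e)
           + swap_coef e`_[i] e`_[i.+1] *: msym (adj i) (v (swapw i e))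
           + (1 - t) *: (x i * dd i (v e))].

Lemma HeckeE i v e : Hecke i v e =
  stay_coef e`_[i] e`_[i.+1] *: msym (adj i) (v e)
  + swap_coef e`_[i] e`_[i.+1] *: msym (adj i) (v (swapw i e))
  + (1 - t) *: (x i * dd i (v e)).
Proof. by rewrite ffunE. Qed.

Definition mulw (p : A) (v : W) : W := [ffun e => p * v e].

Lemma ddiff_linear (i j : 'I_n) : i != j -> linear (@ddiff R n i j).
Proof.
move=> ij c f g; apply: ddiff_eq => //.
rewrite mulrDr -scalerAr !ddiffP linearP /= scalerBr opprD !addrA.
by congr (_ - _); rewrite addrAC.
Qed.

Lemma ddP i f : (i.+1 < n)%N ->
  (x i - x i.+1) * dd i f = f - msym (adj i) f.
Proof. by move=> iN; rewrite /dd iN ddiffP. Qed.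

Lemma dd_eq i f g : (i.+1 < n)%N ->
  (x i - x i.+1) * g = f - msym (adj i) f -> dd i f = g.
Proof. by move=> iN E; rewrite /dd iN; apply: ddiff_eq (inord_succ_neq iN) E. Qed.

Lemma dd_linear i : linear (dd i).
Proof.
rewrite /dd => c f g; case: ifP => iN; last by rewrite scaler0 addr0.
exact: ddiff_linear (inord_succ_neq iN) _ _ _.
Qed.
HB.instance Definition _ i := GRing.isLinear.Build R A A *:%R (dd i) (dd_linear i).

Lemma dd_mul i f g : (i.+1 < n)%N ->
  dd i (f * g) = dd i f * g + msym (adj i) f * dd i g.
Proof.
move=> iN; apply: dd_eq => //.
by rewrite mulrDr mulrA ddP // mulrCA ddP // msymM; ring.
Qed.

Lemma dd_sym i f : (i.+1 < n)%N -> msym (adj i) f = f -> dd i f = 0.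
Proof. by move=> iN E; apply: dd_eq => //; rewrite E subrr mulr0. Qed.

Lemma msym_x i j : (j < n)%N -> (i.+1 < n)%N -> msym (adj i) (x j) =
  x (if j == i then i.+1 else if j == i.+1 then i else j).
Proof. by move=> jn iN; rewrite /xvar msymXU adjE. Qed.

Lemma dd_x i : (i.+1 < n)%N -> dd i (x i) = 1.
Proof. by move=> iN; apply: dd_eq => //; rewrite msym_x ?eqxx ?mulr1 // ltnW. Qed.

Fact Hecke_is_linear i : linear (Hecke i).
Proof.
move=> c u v; apply/ffunP=> e.
have atE (f g : W) e' : (c *: f + g) e' = c *: f e' + g e' by rewrite !ffunE.
have ddL f g : dd i (c *: f + g) = c *: dd i f + dd i g := dd_linear i c f g.
have alg (k l : R) (a b a' b' : A) :
    k *: msym (adj i) (c *: a + b) + l *: msym (adj i) (c *: a' + b')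
    + (1 - t) *: (x i * dd i (c *: a + b)) =
    c *: (k *: msym (adj i) a + l *: msym (adj i) a' + (1 - t) *: (x i * dd i a))
    + (k *: msym (adj i) b + l *: msym (adj i) b' + (1 - t) *: (x i * dd i b)).
  rewrite !msymD !msymZ ddL !scalerDr.
  rewrite [RHS]addrACA [X in _ = X + _]addrACA mulrDr scalerDr.
  by rewrite -scalerAr !scalerA ![_ * c]mulrC.
apply: (etrans (HeckeE _ _ _)); apply: (etrans _ (esym (atE _ _ _))).
apply: (etrans _ (congr2 (fun a b => c *: a + b) (esym (HeckeE i u e))
  (esym (HeckeE i v e)))).
apply: (etrans _ (alg _ _ (u e) (v e) (u (swapw i e)) (v (swapw i e)))).
exact: (congr2 +%R (congr2 +%R (congr1 (fun a => _ *: msym _ a) (atE u v e))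
  (congr1 (fun a => _ *: msym _ a) (atE u v (swapw i e))))
  (congr1 (fun a => _ *: (_ * dd i a)) (atE u v e))).
Qed.
HB.instance Definition _ i :=
  GRing.isLinear.Build R W W *:%R (Hecke i) (Hecke_is_linear i).

Fact mulw_is_linear p : linear (mulw p).
Proof.
by move=> c u v; apply/ffunP=> e; rewrite !ffunE mulrDr -scalerAr.
Qed.
HB.instance Definition _ p :=
  GRing.isLinear.Build R W W *:%R (mulw p) (mulw_is_linear p).

Lemma mulwA p q v : mulw p (mulw q v) = mulw (p * q) v.
Proof. by apply/ffunP=> e; rewrite !ffunE mulrA. Qed.

Lemma mulw1 v : mulw 1 v = v.
Proof. by apply/ffunP=> e; rewrite !ffunE mul1r. Qed.

Lemma mulwDl p q v : mulw (p + q) v = mulw p v + mulw q v.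
Proof. by apply/ffunP=> e; rewrite !ffunE mulrDl. Qed.

Lemma mulwZl c p v : mulw (c *: p) v = c *: mulw p v.
Proof. by apply/ffunP=> e; rewrite !ffunE scalerAl. Qed.

Lemma Hecke_mulw i p v : (i.+1 < n)%N ->
  Hecke i (mulw p v) =
  mulw (msym (adj i) p) (Hecke i v) + (1 - t) *: mulw (x i * dd i p) v.
Proof.
move=> iN; apply/ffunP=> e; rewrite !ffunE dd_mul // !msymM !mulrDr -!scalerAr.
rewrite scalerDr -!addrA; congr (_ + (_ + _)).
by rewrite [RHS]addrC; congr (_ *: _ + _ *: _); ring.
Qed.

Lemma Hecke_mulw_sym i p v : (i.+1 < n)%N -> msym (adj i) p = p ->
  Hecke i (mulw p v) = mulw p (Hecke i v).
Proof.
move=> iN E; rewrite Hecke_mulw // E dd_sym // mulr0.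
by rewrite (_ : mulw 0 v = 0) ?scaler0 ?addr0 //; apply/ffunP=> e;
   rewrite !ffunE mul0r.
Qed.

Local Notation Tb := (Tbar t Hecke).

(** The source of all positivity: the divided difference of x_i is 1, so the term -(1 - t) of Tbar_i
    cancels exactly what x_i adds to T_i. *)
Lemma Tbar_mulw i p v : (i.+1 < n)%N -> msym (adj i) p = p ->
  Tb i (mulw (x i * p) v) = mulw (x i.+1 * p) (Hecke i v).
Proof.
move=> iN E; rewrite /Tbar /= Hecke_mulw // msymM E msym_x ?eqxx; try lia.
by rewrite dd_mul // dd_x // (dd_sym iN E) mulr0 addr0 mul1r addrK.
Qed.

End VectorHecke.

(** * Verification of the Hecke relations for the action on vectors *)

Section RationalHecke.
Variables (K : fieldType) (N : nat) (t : K) (z : 'I_N.+1 -> K).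
Hypothesis z_inj : injective z.
Local Notation n := N.+1.
Local Notation word := (n.-tuple state).
Local Notation adj := (adj N).
Local Notation "e `_[ i ]" := (tnth e (inord i)) (at level 2, format "e `_[ i ]").

(* The action of Hecke i on the family of all permuted components. *)
Definition rHecke i (F : 'S_n -> word -> K) (w : 'S_n) (e : word) : K :=
  let p := (1 - t) * z (w (inord i)) / (z (w (inord i)) - z (w (inord i.+1))) in
  p * F w e + (stay_coef t e`_[i] e`_[i.+1] - p) * F (adj i * w)%g e
  + swap_coef t e`_[i] e`_[i.+1] * F (adj i * w)%g (swapw i e).

Lemma tnth_swapw i e j : tnth (swapw i e) j = tnth e (adj i j).
Proof. by rewrite tnth_mktuple. Qed.

Lemma swapwK i (e : word) : swapw i (swapw i e) = e.
Proof. by apply: eq_from_tnth => j; rewrite !tnth_swapw -permM adjK perm1. Qed.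

Lemma swapw_id i (e : word) : e`_[i] = e`_[i.+1] -> swapw i e = e.
Proof.
move=> E; apply: eq_from_tnth => j; rewrite tnth_swapw adj_tperm.
by case: tpermP => [->|->|].
Qed.

Lemma swapw_braid i (e : word) : (i.+2 < n)%N ->
  swapw i (swapw i.+1 (swapw i e)) = swapw i.+1 (swapw i (swapw i.+1 e)).
Proof.
by move=> iN; apply: eq_from_tnth => j; rewrite !tnth_swapw -!permM adj_braid.
Qed.

Lemma swapw_far i j (e : word) : (i.+1 < j)%N -> (j.+1 < n)%N ->
  swapw i (swapw j e) = swapw j (swapw i e).
Proof.
by move=> ij jN; apply: eq_from_tnth => k; rewrite !tnth_swapw -!permM adj_far.
Qed.

Lemma adjL i : (i.+1 < n)%N -> adj i (inord i) = inord i.+1.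
Proof. by move=> iN; rewrite adjE ?eqxx //; lia. Qed.

Lemma adjR i : (i.+1 < n)%N -> adj i (inord i.+1) = inord i.
Proof. by move=> iN; rewrite adjE ?eqxx //; case: eqP => //; lia. Qed.

Lemma adjD i j : (i.+1 < n)%N -> (j < n)%N -> j != i -> j != i.+1 ->
  adj i (inord j) = inord j.
Proof. by move=> iN jN /negPf ji /negPf ji'; rewrite adjE // ji ji'. Qed.

Lemma z_neq (w : 'S_n) i j : (i < n)%N -> (j < n)%N -> i != j ->
  z (w (inord i)) - z (w (inord j)) != 0.
Proof.
move=> iN jN ij; rewrite subr_eq0 (inj_eq z_inj) (inj_eq perm_inj).
by rewrite inord_inj.
Qed.

Lemma adjKg i (w : 'S_n) : (adj i * (adj i * w) = w)%g.
Proof. by rewrite mulgA adjK mul1g. Qed.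

(** On families indexed by permutations and words T_i is a matrix over the field, so its relations
    become rational identities in z and t, one for each choice of the letters involved. *)
Lemma rHecke_quad i F w e : (i.+1 < n)%N ->
  rHecke i (rHecke i F) w e = (1 - t) * rHecke i F w e + t * F w e.
Proof.
move=> iN; rewrite /rHecke !tnth_swapw !permM !adjL ?adjR // !adjKg !swapwK.
have ab : z (w (inord i)) - z (w (inord i.+1)) != 0 by apply: z_neq; lia.
have ba : z (w (inord i.+1)) - z (w (inord i)) != 0 by apply: z_neq; lia.
move: (z _) (z _) ab ba => a b ab ba.
have same : e`_[i] = e`_[i.+1] -> swapw i e = e by apply: swapw_id.
case E: e`_[i] same; case E': e`_[i.+1] => /= same;
  try rewrite (same erefl); field; by rewrite ab ba.
Qed.

Lemma adj_braidg i (w : 'S_n) : (i.+2 < n)%N ->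
  (adj i * (adj i.+1 * (adj i * w)) = adj i.+1 * (adj i * (adj i.+1 * w)))%g.
Proof. by move=> iN; have := adj_braid iN; rewrite !mulgA => ->. Qed.

Lemma rHecke_braid i F w e : (i.+2 < n)%N ->
  rHecke i (rHecke i.+1 (rHecke i F)) w e =
  rHecke i.+1 (rHecke i (rHecke i.+1 F)) w e.
Proof.
move=> iN; have i1N := ltnW iN.
rewrite /rHecke !tnth_swapw !permM !(adjL, adjR, adjD) //; try lia.
rewrite !adjKg !swapwK adj_braidg // swapw_braid //.
have ab : z (w (inord i)) - z (w (inord i.+1)) != 0 by apply: z_neq; lia.
have bc : z (w (inord i.+1)) - z (w (inord i.+2)) != 0 by apply: z_neq; lia.
have ac : z (w (inord i)) - z (w (inord i.+2)) != 0 by apply: z_neq; lia.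
have ba : z (w (inord i.+1)) - z (w (inord i)) != 0 by apply: z_neq; lia.
have cb : z (w (inord i.+2)) - z (w (inord i.+1)) != 0 by apply: z_neq; lia.
have ca : z (w (inord i.+2)) - z (w (inord i)) != 0 by apply: z_neq; lia.
move: (z (w (inord i))) (z (w (inord i.+1))) (z (w (inord i.+2))) ab bc ac ba cb ca
  => a b c ab bc ac ba cb ca.
have s1 : e`_[i] = e`_[i.+1] -> swapw i e = e by apply: swapw_id.
have s2 : e`_[i.+1] = e`_[i.+2] -> swapw i.+1 e = e by apply: swapw_id.
have s3 : e`_[i] = e`_[i.+2] -> swapw i (swapw i.+1 e) = swapw i.+1 e.
  by move=> E; apply: swapw_id; rewrite !tnth_swapw adjL ?adjD //; lia.
have s4 : e`_[i] = e`_[i.+2] -> swapw i.+1 (swapw i e) = swapw i e.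
  by move=> E; apply: swapw_id; rewrite !tnth_swapw adjR ?adjD //; lia.
case: e`_[i] s1 s3 s4; case: e`_[i.+1] s2; case: e`_[i.+2] => /= s2 s1 s3 s4;
  try rewrite (s3 erefl) (s4 erefl); try rewrite (s1 erefl); try rewrite (s2 erefl).
all: field; by rewrite ?ab ?bc ?ac ?ba ?cb ?ca.
Qed.

Lemma rHecke_far i j F w e : (i.+1 < j)%N -> (j.+1 < n)%N ->
  rHecke i (rHecke j F) w e = rHecke j (rHecke i F) w e.
Proof.
move=> ij jN; rewrite /rHecke !tnth_swapw !permM !(adjL, adjR, adjD) //; try lia.
have -> : (adj j * (adj i * w) = adj i * (adj j * w))%g.
  by rewrite !mulgA (adj_far ij jN).
rewrite (swapw_far _ ij jN).
move: (_ / _) (_ / _) => p q; ring.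
Qed.

End RationalHecke.

Section HeckeComponents.
Variables (R : idomainType) (N : nat) (t : R) (K : fieldType).
Local Notation n := N.+1.
Local Notation A := {mpoly R[n]}.
Local Notation word := (n.-tuple state).
Local Notation W := {ffun word -> A}.
Local Notation x := (xvar R N).
Local Notation adj := (adj N).
Local Notation "e `_[ i ]" := (tnth e (inord i)) (at level 2, format "e `_[ i ]").
Local Notation T := (Hecke t).
Variable phi : {rmorphism A -> K}.
Hypothesis phi_inj : injective phi.

(** All permuted copies of the coefficients at once: on this family s_i only permutes the index [w],
    and the divided difference becomes an honest quotient in K. Thus T_i turns into the K-linear
    [rHecke i]. *)
Definition components (v : W) (w : 'S_n) (e : word) : K := phi (msym w (v e)).

Lemma components_inj u v :
  (forall w e, components u w e = components v w e) -> u = v.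
Proof.
move=> uv; apply/ffunP=> e; have := uv 1%g e.
by rewrite /components !msym1m => /phi_inj.
Qed.

Let z (i : 'I_n) : K := phi 'X_i.
Let phiC (c : R) : K := phi c%:MP.

Lemma phiX_inj : injective z.
Proof. by move=> i j /phi_inj /mpolyX_inj. Qed.

Lemma phi_msymZ w (c : R) (p : A) :
  phi (msym w (c *: p)) = phiC c * phi (msym w p).
Proof. by rewrite msymZ -mul_mpolyC rmorphM. Qed.

Lemma phiC_1t : phiC (1 - t) = 1 - phiC t.
Proof. by rewrite /phiC raddfB /= rmorphB /= mpolyC1 rmorph1. Qed.

Lemma components_Hecke i v w e : (i.+1 < n)%N ->
  components (T i v) w e = rHecke (phiC t) z i (components v) w e.
Proof.
move=> iN; rewrite /components /rHecke ffunE.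
have scE s s' : phiC (stay_coef t s s') = stay_coef (phiC t) s s'.
  by case: s; case: s'; rewrite /= /phiC ?mpolyC0 ?rmorph0 ?mpolyC1 ?rmorph1
    // mpolyCB rmorphB /= mpolyC1 rmorph1.
have wcE s s' : phiC (swap_coef t s s') = swap_coef (phiC t) s s'.
  by case: s; case: s'; rewrite /= /phiC ?mpolyC0 ?rmorph0 ?mpolyC1 ?rmorph1.
have ab : z (w (inord i)) - z (w (inord i.+1)) != 0.
  by apply: (z_neq phiX_inj); lia.
have dE : z (w (inord i)) - z (w (inord i.+1)) = phi (msym w (x i - x i.+1)).
  by rewrite msymB !msymXU rmorphB.
have ddE : phi (msym w (dd i (v e))) =
    (phi (msym w (v e)) - phi (msym (adj i * w)%g (v e))) /
    (z (w (inord i)) - z (w (inord i.+1))).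
  apply: (canRL (mulfK ab)); rewrite mulrC dE.
  by rewrite -rmorphM -msymM ddP // msymB msymMm rmorphB.
rewrite !(msymD w).
rewrite !(rmorphD phi) /=.
rewrite !phi_msymZ scE wcE phiC_1t.
rewrite -!msymMm.
rewrite (msymM w).
rewrite (rmorphM phi) /= ddE.
by rewrite msymXU -/(z _); field.
Qed.

Local Notation rT := (rHecke (phiC t) z).

Lemma components_HeckeE i v : (i.+1 < n)%N ->
  components (T i v) = rT i (components v).
Proof. by move=> iN; apply/funext=> w; apply/funext=> e; apply: components_Hecke. Qed.

Lemma Hecke_quad_in i (v : W) : (i.+1 < n)%N ->
  T i (T i v) = (1 - t) *: T i v + t *: v.
Proof.
move=> iN; apply: components_inj => w e.
rewrite !components_HeckeE // rHecke_quad //; last exact: phiX_inj.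
rewrite -components_Hecke // /components -phiC_1t -!phi_msymZ -rmorphD -msymD.
by congr (phi (msym w _)); rewrite [RHS]ffunE; congr (_ + _); rewrite [RHS]ffunE.
Qed.

Lemma Hecke_braid_in i (v : W) : (i.+2 < n)%N ->
  T i (T i.+1 (T i v)) = T i.+1 (T i (T i.+1 v)).
Proof.
move=> iN; have i1N := ltnW iN; apply: components_inj => w e.
have Ei u := components_HeckeE u i1N; have Ej u := components_HeckeE u iN.
have El : components (T i (T i.+1 (T i v))) = rT i (rT i.+1 (rT i (components v))).
  exact: etrans (Ei _) (congr1 _ (etrans (Ej _) (congr1 _ (Ei _)))).
have Er : components (T i.+1 (T i (T i.+1 v))) =
    rT i.+1 (rT i (rT i.+1 (components v))).
  exact: etrans (Ej _) (congr1 _ (etrans (Ei _) (congr1 _ (Ej _)))).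
have E := rHecke_braid (phiC t) phiX_inj (components v) w e iN.
exact: etrans (congr1 (fun F => F w e) El) (etrans E
  (esym (congr1 (fun F => F w e) Er))).
Qed.

Lemma Hecke_far_in i j (v : W) : (i.+1 < j)%N -> (j.+1 < n)%N ->
  T i (T j v) = T j (T i v).
Proof.
move=> ij jN; have iN : (i.+1 < n)%N by lia.
apply: components_inj => w e.
have Ei u := components_HeckeE u iN; have Ej u := components_HeckeE u jN.
have El : components (T i (T j v)) = rT i (rT j (components v)).
  exact: etrans (Ei _) (congr1 _ (Ej _)).
have Er : components (T j (T i v)) = rT j (rT i (components v)).
  exact: etrans (Ej _) (congr1 _ (Ei _)).
have E := rHecke_far (phiC t) z (components v) w e ij jN.
exact: etrans (congr1 (fun F => F w e) El) (etrans E
  (esym (congr1 (fun F => F w e) Er))).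
Qed.

End HeckeComponents.

Section HeckeRelationsOnVectors.
Variables (R : idomainType) (N : nat) (t : R).
Local Notation n := N.+1.
Local Notation W := {ffun n.-tuple state -> {mpoly R[n]}}.
Local Notation T := (Hecke t).

Lemma tofrac_injective (B : idomainType) : injective (@FracField.tofrac B).
Proof. by move=> p q /eqP; rewrite tofrac_eq => /eqP. Qed.

Lemma Hecke_quad i (v : W) : (i.+1 < n)%N ->
  T i (T i v) = (1 - t) *: T i v + t *: v.
Proof. exact: (Hecke_quad_in _ (@tofrac_injective _)). Qed.

Lemma Hecke_braid i (v : W) : (i.+2 < n)%N ->
  T i (T i.+1 (T i v)) = T i.+1 (T i (T i.+1 v)).
Proof. exact: (Hecke_braid_in _ (@tofrac_injective _)). Qed.

Lemma Hecke_far i j (v : W) : (i.+1 < j)%N -> (j.+1 < n)%N ->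
  T i (T j v) = T j (T i v).
Proof. exact: (Hecke_far_in _ (@tofrac_injective _)). Qed.

End HeckeRelationsOnVectors.

Global Opaque Hecke.

(** * Words and the vectors psi *)

Section WordVectors.
Variables (R : comNzRingType) (t : R) (V : lmodType R) (n : nat).
Variable T : nat -> {linear V -> V}.
Variable basisw : seq state -> V.
Hypothesis T_basisw : forall i p a b q, size p = i ->
  (size p + (size q).+2 = n)%N ->
  T i (basisw (p ++ a :: b :: q)) =
  match a, b with
  | st1, st2 => basisw (p ++ st2 :: st1 :: q)
  | st2, st1 => t *: basisw (p ++ st1 :: st2 :: q)
                + (1 - t) *: basisw (p ++ st2 :: st1 :: q)
  | _, _ => basisw (p ++ a :: b :: q)
  end.
Local Notation Tb := (Tbar t T).
Local Notation D := (carry t T).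
Local Notation S := (shuffle t T).

(* p (2 - t^(M-1) 1) ... (2 - t 1) (2 - 1) q. *)
Fixpoint psi (p : seq state) (M : nat) (q : seq state) : V :=
  if M is M'.+1 then psi (rcons p st2) M' q - t ^+ M' *: psi (rcons p st1) M' q
  else basisw (p ++ q).

Lemma T_psi p a b r M q :
  (size p + (size r).+2 + M + size q = n)%N ->
  T (size p) (psi (p ++ a :: b :: r) M q) =
  match a, b with
  | st1, st2 => psi (p ++ st2 :: st1 :: r) M q
  | st2, st1 => t *: psi (p ++ st1 :: st2 :: r) M q
                + (1 - t) *: psi (p ++ st2 :: st1 :: r) M q
  | _, _ => psi (p ++ a :: b :: r) M q
  end.
Proof.
elim: M r => [|M IH] r sz /=.
  by rewrite -!catA /= T_basisw //; rewrite size_cat; lia.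
rewrite linearB linearZ /= !rcons_cat /= !IH ?size_rcons; try lia.
case: a IH; case: b => _; rewrite ?rcons_cat //=.
rewrite !scalerBr !scalerDr !scalerA ![_ * t ^+ M]mulrC -!addrA; congr (_ + _).
by rewrite opprD addrCA.
Qed.

Lemma Tbar_psi p a b M q :
  (size p + M.+2 + size q = n)%N ->
  Tb (size p) (psi (rcons (rcons p a) b) M q) =
  match a, b with
  | st1, st2 => psi (rcons (rcons p st2) st1) M q
                - (1 - t) *: psi (rcons (rcons p st1) st2) M q
  | st2, st1 => t *: psi (rcons (rcons p st1) st2) M q
  | _, _ => t *: psi (rcons (rcons p a) b) M q
  end.
Proof.
move=> sz; rewrite /Tbar /= -!cats1 -!catA /= T_psi //=; last by lia.
by case: a; case: b; rewrite ?addrK // -{1}[psi _ _ _]scale1r -scalerBl opprB addrC subrK.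
Qed.

(** Induction on M moves the letter past the first factor 2 - t^(M-1) 1. The second identity is what
    makes the sum in [psi_resolution] telescope. *)
Lemma carry_psi p M q :
  (size p + M.+1 + size q = n)%N ->
  D (size p) M (psi (rcons p st2) M q) = t ^+ M *: psi p M (st2 :: q) /\
  D (size p) M (psi (rcons p st1) M q) = psi p M (st2 :: q) - psi p M.+1 q.
Proof.
elim: M p => [|M IH] p sz.
  by rewrite /= expr0 !scale1r !cat_rcons opprB addrC subrK.
have sz' c : (size (rcons p c) + M.+1 + size q = n)%N by rewrite size_rcons; lia.
have [IH22 IH21] := IH _ (sz' st2); have [IH12 IH11] := IH _ (sz' st1).
rewrite !size_rcons in IH22 IH21 IH12 IH11.
have psiS p' M' q' : psi p' M'.+1 q' =
    psi (rcons p' st2) M' q' - t ^+ M' *: psi (rcons p' st1) M' q' by [].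
have linD c (u v : V) : D (size p).+1 M (u - c *: v) =
    D (size p).+1 M u - c *: D (size p).+1 M v.
  by rewrite linearB linearZ.
have linT c (u v : V) : Tb (size p) (u - c *: v) =
    Tb (size p) u - c *: Tb (size p) v.
  by rewrite linearB linearZ.
have linZ c (u : V) : D (size p).+1 M (c *: u) = c *: D (size p).+1 M u.
  by rewrite linearZ.
rewrite !carry_first !psiS !linT.
rewrite !Tbar_psi; try lia.
rewrite !linD !linZ IH22 IH12 IH21 IH11 -!psiS !(psiS p).
move: (psi (rcons p st2) M.+1 q) (psi (rcons p st1) M.+1 q)
  (psi (rcons p st2) M _) (psi (rcons p st1) M _) => u2 u1 a b.
rewrite !scalerBr !scalerA exprS [t ^+ M * t]mulrC; split; first by [].
rewrite mulrBl mul1r scalerBl -!addrA; congr (_ + _).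
rewrite !opprB; move: (_ *: b) (_ *: u1) (_ *: b) => c d e.
by rewrite addrC [X in X - u2]addrC addrA subrK [RHS]addrCA [RHS]addrA.
Qed.

(** The last step of each shuffle is evaluated by [carry_psi]. The differences telescope, and what
    remains is the same sum for a smaller k with one more 2 in front of [q]. *)
Lemma psi_resolution m k q : (m + k + size q = n)%N ->
  \sum_(j < k.+1) S m j k (psi (nseq (m + j) st1) (k - j) q) =
  basisw (nseq m st1 ++ nseq k st2 ++ q).
Proof.
elim: k q => [|k IH] q sz.
  by rewrite big_ord1 shuffle0 addn0.
rewrite big_ord_recl shuffle0 /= addn0.
pose a j := S m j k (psi (nseq (m + j) st1) (k.+1 - j) q).
have E (j : 'I_k.+1) : S m j.+1 k.+1 (psi (nseq (m + j.+1) st1) (k.+1 - j.+1) q) =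
    (a j.+1 - a j) + S m j k (psi (nseq (m + j) st1) (k - j) (st2 :: q)).
  rewrite -[LHS]/(a j.+1 + S m j k (D (m + j) (k - j) _)).
  have -> : nseq (m + j.+1) st1 = rcons (nseq (m + j) st1) st1.
    by rewrite addnS; elim: (m + j)%N => //= ? {1}->.
  have := @carry_psi (nseq (m + j) st1) (k - j) q.
  rewrite size_nseq subSS => -[|_ ->]; first by have := ltn_ord j; lia.
  by rewrite linearB /= /a (subSn (leq_ord j)) /= [RHS]addrAC addrA.
rewrite (eq_bigr _ (fun j _ => E j)) big_split /=.
rewrite -(big_mkord xpredT (fun j => a j.+1 - a j)) telescope_sumr //.
(* Of the telescoped sum, [a k.+1] is an empty shuffle and [a 0] cancels the term for j = 0 split
   off at the start. *)
rewrite {1}/a shuffle_gt // sub0r {1}/a addn0 shuffle0 subn0 addrA subrr add0r.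
rewrite IH /=; last by lia.
by congr (basisw (_ ++ _)); elim: (k) => //= ? ->.
Qed.

End WordVectors.

Section BasisWords.
Variables (R : idomainType) (N : nat) (t : R).
Local Notation n := N.+1.
Local Notation A := {mpoly R[n]}.
Local Notation word := (n.-tuple state).
Local Notation W := {ffun word -> A}.
Local Notation T := (@Hecke R N t).
Local Notation Tb := (Tbar t T).
Local Notation D := (carry t T).
Local Notation S := (shuffle t T).

Definition basisw (s : seq state) : W := [ffun e : word => (val e == s)%:R].

Lemma split_word (e : word) i : (i.+1 < n)%N ->
  exists p c d q, val e = p ++ c :: d :: q /\ size p = i.
Proof.
move=> iN; exists (take i e), (nth st1 e i), (nth st1 e i.+1), (drop i.+2 e).
rewrite size_takel ?size_tuple; last by lia.
by rewrite -!drop_nth ?size_tuple ?cat_take_drop //; lia.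
Qed.

Lemma tnth_nth_inord (e : word) i : (i < n)%N -> tnth e (inord i) = nth st1 e i.
Proof. by move=> iN; rewrite (tnth_nth st1) inordK. Qed.

Lemma swapw_cat i (e : word) p c d q : (i.+1 < n)%N ->
  val e = p ++ c :: d :: q -> size p = i ->
  val (swapw i e) = p ++ d :: c :: q.
Proof.
move=> iN E pi; apply: (@eq_from_nth _ st1).
  by rewrite size_tuple -(size_tuple e) E !size_cat.
move=> j; rewrite size_tuple => jN; rewrite -tnth_nth_inord // tnth_swapw.
rewrite adjE // tnth_nth_inord; last by case: ifP => [|_]; [lia|case: ifP; lia].
rewrite E !nth_cat pi.
have [->|ji] := eqVneq j i.
  by rewrite ltnn [(i.+1 < i)%N]ltnNge leqnSn /= subnn subSnn.
have [->|ji'] := eqVneq j i.+1.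
  by rewrite ltnn [(i.+1 < i)%N]ltnNge leqnSn /= subnn subSnn.
case: ltnP => // ij; have -> : (j - i = (j - i.+2).+2)%N by lia.
by [].
Qed.

Lemma Hecke_basisw i p a b q : size p = i -> (size p + (size q).+2 = n)%N ->
  T i (basisw (p ++ a :: b :: q)) =
  match a, b with
  | st1, st2 => basisw (p ++ st2 :: st1 :: q)
  | st2, st1 => t *: basisw (p ++ st1 :: st2 :: q)
                + (1 - t) *: basisw (p ++ st2 :: st1 :: q)
  | _, _ => basisw (p ++ a :: b :: q)
  end.
Proof.
move=> pi pq; have iN : (i.+1 < n)%N by lia.
apply/ffunP=> e; have [p' [c [d [q' [E p'i]]]]] := split_word e iN.
have eb (p1 q1 : seq state) (c1 d1 a1 b1 : state) : size p1 = i ->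
    (p1 ++ c1 :: d1 :: q1 == p ++ a1 :: b1 :: q) =
    [&& p1 == p, c1 == a1, d1 == b1 & q1 == q].
  by move=> p1i; rewrite eqseq_cat ?p1i ?pi // !eqseq_cons.
have bE s (e1 : word) : basisw s e1 = (val e1 == s)%:R by rewrite ffunE.
rewrite HeckeE !bE (swapw_cat iN E p'i) E !eb // !rmorph_nat.
rewrite dd_sym ?rmorph_nat // mulr0 scaler0 addr0.
rewrite !tnth_nth_inord ?E ?nth_cat ?p'i; try lia.
rewrite ltnn [(i.+1 < i)%N]ltnNge leqnSn subnn subSnn /=.
have fE (u v : W) : (u + v) e = u e + v e by rewrite ffunE.
have zE k (u : W) : (k *: u) e = k *: u e by rewrite ffunE.
case: a b c d E => [] [] [] [] E; rewrite ?fE ?zE !bE E !(eb p' q') //=;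
  case: (p' == p); case: (q' == q);
  rewrite /= ?scale0r ?scale1r ?scaler0 ?addr0 ?add0r //.
Qed.

End BasisWords.

(** * Positivity *)

Definition bswap (i : nat) (b : nat -> bool) (j : nat) : bool :=
  b (if j == i then i.+1 else if j == i.+1 then i else j).

Lemma bswapK i : involutive (bswap i).
Proof.
by move=> b; apply/funext=> j; rewrite /bswap; congr (b _); repeat case: eqP => //; lia.
Qed.

Lemma bswapL i (b : nat -> bool) : bswap i b i = b i.+1.
Proof. by rewrite /bswap eqxx. Qed.

Lemma bswapR i (b : nat -> bool) : bswap i b i.+1 = b i.
Proof. by rewrite /bswap eqxx; case: eqP => //; lia. Qed.

Lemma bswapN i (b : nat -> bool) j : j != i -> j != i.+1 -> bswap i b j = b j.
Proof. by rewrite /bswap => /negPf-> /negPf->. Qed.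

Lemma bswapC i j (b : nat -> bool) : (i.+1 < j)%N || (j.+1 < i)%N ->
  bswap i (bswap j b) = bswap j (bswap i b).
Proof.
by move=> ij; apply/funext=> k; rewrite /bswap; congr (b _); repeat case: eqP => //; lia.
Qed.

Section Positivity.
Variables (R : numDomainType) (t : R) (V : lmodType R) (n : nat).
Variable T : nat -> {linear V -> V}.
Hypothesis quad : forall i v, (i.+1 < n)%N ->
  T i (T i v) = (1 - t) *: T i v + t *: v.
Hypothesis braid : forall i v, (i.+2 < n)%N ->
  T i (T i.+1 (T i v)) = T i.+1 (T i (T i.+1 v)).
Hypothesis far : forall i j v, (i.+1 < j)%N -> (j.+1 < n)%N ->
  T i (T j v) = T j (T i v).
Hypotheses (t_ge0 : 0 <= t) (t_le1 : t <= 1).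

Local Notation Tb := (Tbar t T).
Local Notation D := (carry t T).
Local Notation S := (shuffle t T).

(* [P] is the cone of vectors with nonnegative coefficients. *)
Variable P : V -> Prop.
Hypothesis P0 : P 0.
Hypothesis PD : forall u v, P u -> P v -> P (u + v).
Hypothesis PZ : forall (c : R) v, 0 <= c -> P v -> P (c *: v).

(* [X b] multiplies by the product of the variables x_i with b i. *)
Variable X : (nat -> bool) -> V -> V.
Hypothesis PX : forall b v, P v -> P (X b v).
Hypothesis Tbar_X : forall i (b : nat -> bool) v, (i.+1 < n)%N -> b i -> ~~ b i.+1 ->
  Tb i (X b v) = X (bswap i b) (T i v).
Hypothesis T_X : forall i (b : nat -> bool) v, (i.+1 < n)%N -> b i = b i.+1 ->
  T i (X b v) = X b (T i v).

(** The largest part of the cone that is stable under all T_i. Asking for this instead of [P] allows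
    T_i to be applied freely in inductions. *)
Definition T_pos (v : V) : Prop :=
  forall s, all (fun i => i.+1 < n)%N s -> P (foldr T v s).

Lemma foldr_T_linear s : linear (fun v => foldr T v s).
Proof. by elim: s => //= i s IH c u v; rewrite IH linearP. Qed.

Lemma T_pos_comb c u v : 0 <= c -> T_pos u -> T_pos v -> T_pos (c *: u + v).
Proof.
move=> c0 Pu Pv s sn; rewrite foldr_T_linear.
by apply: PD; [apply: PZ => //; apply: Pu | apply: Pv].
Qed.

Lemma T_pos0 : T_pos 0.
Proof.
move=> s _; have := foldr_T_linear s (-1) 0 0.
by rewrite scaler0 addr0 scaleN1r addNr => ->.
Qed.

Lemma T_posD u v : T_pos u -> T_pos v -> T_pos (u + v).
Proof. by rewrite -{2}[u]scale1r; apply: T_pos_comb ler01. Qed.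

Lemma T_pos_T i v : (i.+1 < n)%N -> T_pos v -> T_pos (T i v).
Proof. by move=> iN Pv s sn; rewrite -foldr_rcons; apply: Pv; rewrite all_rcons iN. Qed.

Lemma T_posW v : T_pos v -> P v.
Proof. by move/(_ [::] isT). Qed.

(* The vectors obtained from x_0 ... x_(r-1) v by k inversions of the pattern b
   of variables. *)
Inductive raised (r : nat) : nat -> (nat -> bool) -> V -> Prop :=
| raised_base v : T_pos v -> raised r 0 (fun i => i < r)%N (X (fun i => i < r)%N v)
| raised_step k b w i : raised r k b w -> (i.+1 < n)%N -> b i -> ~~ b i.+1 ->
    raised r k.+1 (bswap i b) (Tb i w).

Lemma far_Tbar_Tbar i j v : (i.+1 < j)%N || (j.+1 < i)%N ->
  (i.+1 < n)%N -> (j.+1 < n)%N -> Tb i (Tb j v) = Tb j (Tb i v).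
Proof.
move=> ij iN jN; rewrite {1}/Tbar (far_Tbar t far) //.
by rewrite -linearZ -linearB.
Qed.

Lemma raised_form r k b w : raised r k b w -> exists2 u, T_pos u & w = X b u.
Proof.
elim=> [v Pv|k1 b1 w1 i _ [u Pu ->] iN bi bi']; first by exists v.
by exists (T i u); [apply: T_pos_T | apply: Tbar_X].
Qed.

(** Any inversion of the pattern can be taken as the last step. A step at j leaves no variable at j
    and one at j + 1, so another inversion cannot sit at a neighbouring index; the two operators
    then commute. *)
Lemma raised_inv r k b w i : raised r k b w -> (i.+1 < n)%N ->
  ~~ b i -> b i.+1 ->
  exists k' w', [/\ k = k'.+1, w = Tb i w' & raised r k' (bswap i b) w'].
Proof.
move=> Z; elim: Z i => [v _|k1 b1 w1 j Z1 IH jN bj bj'] i iN.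
  by move=> r1 r2; exfalso; lia.
have [->|ij] := eqVneq i j; first by exists k1, w1; rewrite bswapK.
have [->|ij'] := eqVneq i j.+1; first by rewrite bswapR bj.
have [E|ji'] := eqVneq j i.+1; first by rewrite -E bswapL (negPf bj').
rewrite !bswapN; try lia.
move=> bi bi'; have [k2 [w2 [-> -> Z2]]] := IH i iN bi bi'.
have ijf : (i.+1 < j)%N || (j.+1 < i)%N by lia.
exists k2.+1, (Tb j w2); split=> //; first by rewrite far_Tbar_Tbar // orbC.
by rewrite bswapC //; apply: raised_step => //; rewrite bswapN //; lia.
Qed.

(** Strong induction on the number of inversions. If the last step is at an index next to i,
    equality of the pattern at i and i + 1 forces another step just before it ([raised_inv]), and
    the braid relation moves T through this pair onto a vector with fewer inversions. *)
Lemma raised_T r k b w i : raised r k b w -> (i.+1 < n)%N ->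
  b i = b i.+1 -> raised r k b (T i w).
Proof.
elim/ltn_ind: k b w i => k IH b w i Z iN.
case: Z IH => {k b w} [v Pv|k b w j Z jN bj bj'] IH.
  by move=> bE; rewrite T_X //; apply: raised_base; apply: T_pos_T.
have [->|ij] := eqVneq i j.
  by rewrite bswapL bswapR (negPf bj') bj.
have [E|ij'] := eqVneq i j.+1.
  move: iN; rewrite {i ij}E => iN.
  rewrite bswapR bswapN ?bj; try lia.
  move/esym=> b2; have [k2 [w2 [Ek -> Z2]]] := raised_inv Z iN bj' b2.
  rewrite (braid_Tbar' quad braid) //.
  have Z3 : raised r k2 (bswap j.+1 b) (T j w2).
    apply: IH => //; first by rewrite Ek.
    by rewrite bswapL b2 bswapN //; lia.
  have Z4 : raised r k b (Tb j.+1 (T j w2)).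
    rewrite Ek -[b](bswapK j.+1); apply: raised_step => //.
      by rewrite bswapL.
    by rewrite bswapR.
  exact: raised_step.
have [E|ji'] := eqVneq j i.+1.
  move: jN bj bj' Z; rewrite {j ij ij'}E => jN bj bj' Z.
  rewrite bswapL bswapN ?(negPf bj'); try lia.
  move/negbT=> b2; have [k2 [w2 [Ek -> Z2]]] := raised_inv Z iN b2 bj.
  rewrite (braid_Tbar quad braid) //.
  have Z3 : raised r k2 (bswap i b) (T i.+1 w2).
    apply: IH => //; first by rewrite Ek.
    by rewrite bswapR bswapN; rewrite ?(negPf b2) ?(negPf bj'); lia.
  have Z4 : raised r k b (Tb i (T i.+1 w2)).
    rewrite Ek -[b](bswapK i); apply: raised_step => //.
      by rewrite bswapL.
    by rewrite bswapR.
  exact: raised_step.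
rewrite !bswapN; try lia.
move=> bE; rewrite (far_Tbar t far) //; last by lia.
by apply: raised_step => //; apply: IH.
Qed.

(** Applying T_i to a raised vector gives a nonnegative combination of raised vectors: T = Tbar + (1
    - t) if the variable is on site i only, T Tbar = t if it is on site i + 1 only, and [raised_T]
    if the pattern is equal on both. This is where 0 <= t <= 1 enters. *)
Lemma raised_pos r k b w : raised r k b w -> T_pos w.
Proof.
move=> Z s; elim/last_ind: s k b w Z => [|s i IH] k b w Z.
  by move=> _; have [u Pu ->] := raised_form Z; apply: PX; apply: T_posW.
rewrite all_rcons foldr_rcons => /andP[iN sn].
case bi: (b i); case bi': (b i.+1).
- by apply: (IH k b) => //; apply: raised_T => //; rewrite bi bi'.
- rewrite (T_TbarD t) addrC foldr_T_linear; apply: PD.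
    by apply: PZ; [rewrite subr_ge0 | apply: (IH k b)].
  by apply: (IH k.+1 (bswap i b)) => //; apply: raised_step; rewrite ?bi ?bi'.
- have [k1 [w1 [_ -> Z1]]] := raised_inv Z iN (negbT bi) bi'.
  rewrite (T_Tbar quad) // -[t *: _]addr0 foldr_T_linear; apply: PD.
    by apply: PZ => //; apply: IH Z1 sn.
  by apply: T_pos0.
- by apply: (IH k b) => //; apply: raised_T => //; rewrite bi bi'.
Qed.

Lemma raised_carry r o l k b w : raised r k b w -> (o + l < n)%N -> b o ->
  (forall j, (o < j <= o + l)%N -> ~~ b j) ->
  exists k', raised r k'
    (fun j => (j == o + l)%N || b j && ~~ (o <= j < o + l)%N) (D o l w).
Proof.
move=> Z + bo; elim: l => [|l IH] oN b0.
  exists k; rewrite /= addn0; set b' := (fun j => _).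
  suff -> : b' = b by [].
  apply/funext=> j; rewrite /b'; have [->|jo] := eqVneq j o; first by rewrite bo.
  by rewrite (_ : (o <= j < o)%N = false) ?andbT //; lia.
have [|j ij|k' Z'] := IH; [lia | by apply: b0; lia |].
have := @raised_step _ _ _ _ (o + l) Z'; rewrite eqxx -addnS => /(_ oN isT) H.
exists k'.+1 => /=; set b' := (fun j => _).
suff -> : b' = bswap (o + l) (fun j => (j == o + l)%N || b j && ~~ (o <= j < o + l)%N).
  apply: H; rewrite negb_or negb_and; apply/andP; split; first by lia.
  by rewrite b0 //; lia.
apply/funext=> j; rewrite /b' /bswap addnS.
have [->|jo] := eqVneq j (o + l)%N.
  have /negPf-> : ~~ b (o + l).+1 by apply: b0; lia.
  rewrite orbF; case: (l) (@b0 (o + l)%N) => [|l'] H'; first by lia.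
  by rewrite (negPf (H' _)); lia.
have [->|jo'] := eqVneq j (o + l).+1; first by rewrite eqxx.
by rewrite (negPf jo) /=; congr (_ && ~~ _); lia.
Qed.

(** Every carry in this shuffle moves a site with a variable over sites without, so each of its Tbar
    is a step of [raised]. *)
Lemma raised_shuffle r o s M k b w : raised r k b w -> (o + M <= n)%N ->
  (forall j, (o <= j < o + s)%N -> b j) ->
  (forall j, (o + s <= j < o + M)%N -> ~~ b j) ->
  T_pos (S o s M w).
Proof.
elim: M s k b w => [|M IH] [|s] k b w Z oM b1 b0 /=.
- exact: raised_pos Z.
- exact: T_pos0.
- exact: raised_pos Z.
apply: T_posD.
  have [sM|Ms] := ltnP s M; last by rewrite shuffle_gt //; apply: T_pos0.
  by apply: (IH _ _ _ _ Z) => [|j ij|j ij]; [lia|apply: b1; lia|apply: b0; lia].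
have [sM|Ms] := leqP s M; last by rewrite shuffle_gt //; apply: T_pos0.
have [||j ij|k' Z'] := @raised_carry _ (o + s) (M - s) _ _ _ Z.
- by lia.
- by apply: b1; lia.
- by apply: b0; lia.
apply: (IH _ _ _ _ Z') => [|j ij|j ij] /=; first by lia.
  by rewrite b1 ?orbT //; lia.
by rewrite negb_or negb_and; lia.
Qed.

End Positivity.

(** * Column polynomials *)

Section ScalarHecke.
Variables (R : idomainType) (N : nat) (t : R).
Local Notation n := N.+1.
Local Notation A := {mpoly R[n]}.
Local Notation word := (n.-tuple state).
Local Notation W := {ffun word -> A}.
Local Notation x := (xvar R N).
Local Notation adj := (adj N).

(* Bundled, so that no structure has to be inferred when T_i occurs in a term. *)
Definition hecke (i : nat) : {linear W -> W} := Hecke t i.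

(* The action of T_i on the coefficient of a word with equal letters at i, i + 1. *)
Definition tau i (f : A) : A := msym (adj i) f + (1 - t) *: (x i * dd i f).

Fact tau_is_linear i : linear (tau i).
Proof.
move=> c f g; rewrite /tau !linearP /= mulrDr !scalerDr addrACA -scalerAr.
by rewrite !scalerA [(1 - t) * c]mulrC.
Qed.
HB.instance Definition _ i :=
  GRing.isLinear.Build R A A *:%R (tau i) (tau_is_linear i).

Definition stau (i : nat) : {linear A -> A} := tau i.

Definition multo (v : W) (p : A) : W := mulw p v.
Fact multo_is_linear v : linear (multo v).
Proof. by move=> c p q; rewrite /multo mulwDl mulwZl. Qed.
HB.instance Definition _ v :=
  GRing.isLinear.Build R A W *:%R (multo v) (multo_is_linear v).

Definition mulv (v : W) : {linear A -> W} := multo v.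

Lemma hecke_mulv i v p : (i.+1 < n)%N -> hecke i v = v ->
  hecke i (mulv v p) = mulv v (stau i p).
Proof.
move=> iN; rewrite -[hecke i v]/(Hecke t i v) => Tv.
rewrite -[LHS]/(Hecke t i (mulw p v)) Hecke_mulw // Tv.
by rewrite -mulwZl -mulwDl.
Qed.

Lemma heckeE i v : hecke i v = Hecke t i v.
Proof. by []. Qed.

Lemma stauE i p : stau i p = msym (adj i) p + (1 - t) *: (x i * dd i p).
Proof. by []. Qed.

Lemma mulvE v p : mulv v p = mulw p v.
Proof. by []. Qed.

Definition ones : seq state := nseq n st1.
Definition vac : W := basisw R N ones.

(** Since T_i fixes the word of ones, this embedding lets the scalar operators inherit the Hecke
    relations from the vectors. *)
Lemma mulv_vac_inj : injective (mulv vac).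
Proof.
move=> p q /ffunP /(_ [tuple st1 | i < n]); rewrite !ffunE.
suff -> : (val [tuple st1 | i < n] == ones) by rewrite !mulr1.
apply/eqP/(@eq_from_nth _ st1) => [|i]; first by rewrite size_tuple size_nseq.
rewrite size_tuple => iN; rewrite nth_nseq iN.
by rewrite -[nth _ _ _](tnth_nth st1 [tuple st1 | i < n] (Ordinal iN)) tnth_mktuple.
Qed.

Lemma hecke_eqletters i p a q : size p = i -> (size p + (size q).+2 = n)%N ->
  hecke i (basisw R N (p ++ a :: a :: q)) = basisw R N (p ++ a :: a :: q).
Proof. by move=> pi pq; rewrite -[LHS]/(Hecke t i _) Hecke_basisw //; case: a. Qed.

Lemma hecke_vac i : (i.+1 < n)%N -> hecke i vac = vac.
Proof.
move=> iN; have E : ones = nseq i st1 ++ st1 :: st1 :: nseq (n - i.+2) st1.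
  by rewrite -[st1 :: _]/(nseq (n - i.+2).+2 st1) -nseqD; congr nseq; lia.
by rewrite /vac E hecke_eqletters ?size_nseq //; lia.
Qed.

Lemma mulv_tau i p : (i.+1 < n)%N -> mulv vac (stau i p) = hecke i (mulv vac p).
Proof. by move=> iN; rewrite hecke_mulv // hecke_vac. Qed.

Lemma hecke_quad i (v : W) : (i.+1 < n)%N ->
  hecke i (hecke i v) = (1 - t) *: hecke i v + t *: v.
Proof. exact: Hecke_quad. Qed.

Lemma hecke_braid i (v : W) : (i.+2 < n)%N ->
  hecke i (hecke i.+1 (hecke i v)) = hecke i.+1 (hecke i (hecke i.+1 v)).
Proof. exact: Hecke_braid. Qed.

Lemma hecke_far i j (v : W) : (i.+1 < j)%N -> (j.+1 < n)%N ->
  hecke i (hecke j v) = hecke j (hecke i v).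
Proof. exact: Hecke_far. Qed.

Lemma Tbar_hecke i p (v : W) : (i.+1 < n)%N -> msym (adj i) p = p ->
  Tbar t hecke i (mulw (x i * p) v) = mulw (x i.+1 * p) (hecke i v).
Proof. exact: Tbar_mulw. Qed.

Opaque stau mulv hecke.

Lemma tau_quad i p : (i.+1 < n)%N ->
  stau i (stau i p) = (1 - t) *: stau i p + t *: p.
Proof.
move=> iN; apply: mulv_vac_inj.
have Ei q : _ = _ := mulv_tau q iN.
have El := etrans (Ei _) (congr1 _ (Ei p)).
have Er : mulv vac ((1 - t) *: stau i p + t *: p) =
    (1 - t) *: mulv vac (stau i p) + t *: mulv vac p.
  by rewrite (linearD (mulv vac)); congr (_ + _); apply: (linearZ_LR (mulv vac)).
rewrite Ei in Er; exact: etrans El (etrans (hecke_quad _ iN) (esym Er)).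
Qed.

Lemma tau_braid i p : (i.+2 < n)%N ->
  stau i (stau i.+1 (stau i p)) = stau i.+1 (stau i (stau i.+1 p)).
Proof.
move=> iN; have iN' := ltnW iN; apply: mulv_vac_inj.
have Ei q : _ = _ := mulv_tau q iN'; have Ej q : _ = _ := mulv_tau q iN.
have El := etrans (Ei _) (congr1 _ (etrans (Ej _) (congr1 _ (Ei p)))).
have Er := etrans (Ej _) (congr1 _ (etrans (Ei _) (congr1 _ (Ej p)))).
exact: etrans El (etrans (hecke_braid _ iN) (esym Er)).
Qed.

Lemma tau_far i j p : (i.+1 < j)%N -> (j.+1 < n)%N ->
  stau i (stau j p) = stau j (stau i p).
Proof.
move=> ij jN; have iN : (i.+1 < n)%N by lia.
apply: mulv_vac_inj.
have El := etrans (mulv_tau _ iN) (congr1 _ (mulv_tau p jN)).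
have Er := etrans (mulv_tau _ jN) (congr1 _ (mulv_tau p iN)).
exact: etrans El (etrans (hecke_far _ ij jN) (esym Er)).
Qed.

Lemma tau_mul_sym i p q : (i.+1 < n)%N -> msym (adj i) p = p ->
  stau i (p * q) = p * stau i q.
Proof.
move=> iN E; rewrite !stauE.
by rewrite msymM E dd_mul // E dd_sym // mul0r add0r mulrDr -scalerAr mulrCA.
Qed.

Lemma Tbar_tau_x i p : (i.+1 < n)%N ->
  Tbar t stau i (x i * p) = x i.+1 * stau i p.
Proof.
move=> iN; rewrite /Tbar !stauE.
rewrite msymM msym_x ?eqxx; try lia.
rewrite dd_mul // dd_x // msym_x ?eqxx; try lia.
rewrite mul1r !mulrDr !scalerDr -!scalerAr [x i * (x i.+1 * _)]mulrCA.
by rewrite addrCA addrAC subrr add0r.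
Qed.

End ScalarHecke.

Global Opaque hecke stau mulv.

Section Columns.
Variables (R : idomainType) (N : nat) (t : R).
Local Notation n := N.+1.
Local Notation A := {mpoly R[n]}.
Local Notation word := (n.-tuple state).
Local Notation W := {ffun word -> A}.
Local Notation x := (xvar R N).
Local Notation adj := (adj N).
Local Notation T := (@hecke R N t).
Local Notation tau := (@stau R N t).

Definition xprod (b : nat -> bool) : A := \prod_(j < n | b j) x j.

Lemma adjV i (b : nat -> bool) (j : 'I_n) : (i.+1 < n)%N -> b (adj i j) = bswap i b j.
Proof.
move=> iN; rewrite -{1}(inord_val j) adjE // /bswap inordK //.
by have := ltn_ord j; repeat case: eqP => //; lia.
Qed.

Lemma msym_xprod i (b : nat -> bool) : (i.+1 < n)%N ->
  msym (adj i) (xprod b) = xprod (bswap i b).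
Proof.
move=> iN; rewrite /xprod rmorph_prod /=.
rewrite [RHS](reindex_inj (@perm_inj _ (adj i))) /=; apply: eq_big => j.
  by rewrite -adjV // -permM adjK perm1.
by rewrite /xvar msymXU !inord_val.
Qed.

Lemma xprodD1 i (b : nat -> bool) : (i < n)%N -> b i ->
  xprod b = x i * xprod (fun j => b j && (j != i)).
Proof.
move=> iN bi; rewrite /xprod (bigD1 (inord i)) /= ?inordK //; congr (_ * _).
by apply: eq_bigl => j; rewrite -val_eqE /= inordK.
Qed.

Lemma bswap_id i (b : nat -> bool) : b i = b i.+1 -> bswap i b = b.
Proof.
move=> E; apply/funext=> j; rewrite /bswap.
by case: eqP => [->|_]; [|case: eqP => [->|]].
Qed.

Lemma hecke_mulw_sym i p (v : W) : (i.+1 < n)%N -> msym (adj i) p = p ->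
  T i (mulw p v) = mulw p (T i v).
Proof. by move=> iN E; rewrite !heckeE Hecke_mulw_sym. Qed.

Lemma hecke_xprod i (b : nat -> bool) (v : W) : (i.+1 < n)%N -> b i = b i.+1 ->
  T i (mulw (xprod b) v) = mulw (xprod b) (T i v).
Proof.
by move=> iN bE; apply: hecke_mulw_sym => //; rewrite msym_xprod // bswap_id.
Qed.

Lemma Tbar_xprod i (b : nat -> bool) (v : W) : (i.+1 < n)%N -> b i -> ~~ b i.+1 ->
  Tbar t T i (mulw (xprod b) v) = mulw (xprod (bswap i b)) (T i v).
Proof.
move=> iN bi bi'; set c := fun j => b j && (j != i).
have cE : bswap i c = c.
  by apply: bswap_id; rewrite /c eqxx (negPf bi') andbF.
rewrite -msym_xprod // (xprodD1 _ bi) -/c; last by lia.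
rewrite msymM msym_xprod // cE msym_x ?eqxx; try lia.
by apply: Tbar_hecke => //; rewrite msym_xprod // cE.
Qed.

(* [colpoly c n] will be the Hall-Littlewood polynomial with columns [c], and
   [colpoly c j] its restriction to the first j variables. *)
Fixpoint colpoly (c : seq nat) (j : nat) : A :=
  if c is r :: c' then shuffle t tau 0 r j (xprod (fun i => i < r)%N * colpoly c' r)
  else 1.

Lemma shuffle_mulw o r M (v : W) p : (o + M <= n)%N ->
  (forall i, (o <= i)%N -> (i.+1 < o + M)%N -> T i v = v) ->
  shuffle t T o r M (mulw p v) = mulw (shuffle t tau o r M p) v.
Proof.
move=> oM Tv; rewrite -!mulvE; apply/esym; apply: (@map_shuffle _ _ _ _ _ _ (mulv v)).
by move=> j u oj jM; rewrite hecke_mulv ?Tv //; lia.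
Qed.

Lemma hecke_ones i k q : (i.+1 < k)%N -> (k + size q = n)%N ->
  T i (basisw R N (nseq k st1 ++ q)) = basisw R N (nseq k st1 ++ q).
Proof.
move=> ik kn; have -> : nseq k st1 = nseq i st1 ++ st1 :: st1 :: nseq (k - i.+2) st1.
  by rewrite -[st1 :: _]/(nseq (k - i.+2).+2 st1) -nseqD; congr nseq; lia.
by rewrite -catA /= hecke_eqletters ?size_nseq // size_cat size_nseq; lia.
Qed.

End Columns.

Section ColumnPositivity.
Variables (R : numDomainType) (N : nat) (t : R).
Hypotheses (t_ge0 : 0 <= t) (t_le1 : t <= 1).
Local Notation n := N.+1.
Local Notation A := {mpoly R[n]}.
Local Notation word := (n.-tuple state).
Local Notation W := {ffun word -> A}.
Local Notation x := (xvar R N).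
Local Notation T := (@hecke R N t).
Local Notation basisw := (basisw R N).

Definition nonneg_coefs (p : A) : Prop := forall m, 0 <= p@_m.
Definition nonnegw (v : W) : Prop := forall e, nonneg_coefs (v e).

Lemma nonneg_coefsM p q : nonneg_coefs p -> nonneg_coefs q -> nonneg_coefs (p * q).
Proof.
move=> p0 q0 m; rewrite mcoeffM; apply: sumr_ge0 => k _; exact: mulr_ge0.
Qed.

Lemma nonneg_xprod b : nonneg_coefs (xprod R N b).
Proof.
apply: (big_ind nonneg_coefs); [|exact: nonneg_coefsM|].
  by move=> m; rewrite mcoeff1 ler0n.
by move=> i _ m; rewrite mcoeffX ler0n.
Qed.

Lemma nonnegw0 : nonnegw 0.
Proof. by move=> e m; rewrite ffunE mcoeff0. Qed.

Lemma nonnegwD u v : nonnegw u -> nonnegw v -> nonnegw (u + v).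
Proof. by move=> u0 v0 e m; rewrite ffunE mcoeffD addr_ge0 ?u0 ?v0. Qed.

Lemma nonnegwZ (c : R) v : 0 <= c -> nonnegw v -> nonnegw (c *: v).
Proof. by move=> c0 v0 e m; rewrite ffunE mcoeffZ mulr_ge0 ?v0. Qed.

Lemma nonnegw_xprod b v : nonnegw v -> nonnegw (mulw (xprod R N b) v).
Proof. by move=> v0 e; rewrite ffunE; apply: nonneg_coefsM; [apply: nonneg_xprod|]. Qed.

Definition Xmul (b : nat -> bool) (v : W) : W := mulw (xprod R N b) v.

Definition Tpos : W -> Prop := T_pos n T nonnegw.

Lemma Tpos_basisw s : size s = n -> Tpos (basisw s).
Proof.
move=> sn l; elim/last_ind: l s sn => [|l i IH] s sn.
  by move=> _ e m; rewrite ffunE; case: eqP; rewrite ?mcoeff1 ?mcoeff0 ?ler0n.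
rewrite all_rcons foldr_rcons => /andP[iN ln].
have [p [a [b [q [E pi]]]]] : exists p a b q, s = p ++ a :: b :: q /\ size p = i.
  exists (take i s), (nth st1 s i), (nth st1 s i.+1), (drop i.+2 s).
  rewrite size_takel ?sn; last by lia.
  by rewrite -!drop_nth ?sn ?cat_take_drop //; lia.
have szE c d : size (p ++ c :: d :: q) = n by move: sn; rewrite E !size_cat.
have pq : (size p + (size q).+2 = n)%N by move: sn; rewrite E !size_cat.
rewrite heckeE E Hecke_basisw //.
case: a E => E; case: b E => E; try by apply: IH.
rewrite (foldr_T_linear T) ; apply: nonnegwD; first by apply: nonnegwZ => //; apply: IH.
rewrite -[_ *: basisw _]addr0 (foldr_T_linear T).
apply: nonnegwD; first by apply: nonnegwZ; rewrite ?subr_ge0 //; apply: IH.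
exact: (T_pos0 T nonnegw0 ln).
Qed.

Lemma Tpos0 : Tpos 0.
Proof. exact: T_pos0 nonnegw0. Qed.

Lemma TposD u v : Tpos u -> Tpos v -> Tpos (u + v).
Proof. exact: T_posD nonnegwD nonnegwZ _ _. Qed.

Lemma TposT i v : (i.+1 < n)%N -> Tpos v -> Tpos (T i v).
Proof. exact: T_pos_T. Qed.

Definition Raised := raised t n T nonnegw Xmul.

Lemma Raised_shuffle r o s M k b w : Raised r k b w -> (o + M <= n)%N ->
  (forall j, (o <= j < o + s)%N -> b j) ->
  (forall j, (o + s <= j < o + M)%N -> ~~ b j) ->
  Tpos (shuffle t T o s M w).
Proof.
apply: (raised_shuffle (@hecke_quad R N t) (@hecke_braid R N t) (@hecke_far R N t)
  t_ge0 t_le1 nonnegw0 nonnegwD nonnegwZ nonnegw_xprod).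
  exact: Tbar_xprod.
exact: hecke_xprod.
Qed.

(** Induction on the columns: the polynomial of the remaining columns times the word is T-positive,
    the factor x_0 ... x_(r-1) makes it a base case of [raised], and the shuffle of the first column
    only moves variables to the right. *)
Lemma Tpos_colpoly c j q : (j + size q = n)%N ->
  Tpos (mulw (colpoly N t c j) (basisw (nseq j st1 ++ q))).
Proof.
elim: c j q => [|r c IH] j q jq.
  by rewrite mulw1; apply: Tpos_basisw; rewrite size_cat size_nseq.
rewrite /= -shuffle_mulw; try lia; last first.
  by move=> i _ ij; apply: hecke_ones.
have [rj|jr] := leqP r j; last by rewrite shuffle_gt //; apply: Tpos0.
rewrite -mulwA; set v := mulw (colpoly N t c r) _.
have Pv : Tpos v.
  rewrite /v -(subnKC rj) nseqD -catA; apply: IH.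
  by rewrite size_cat size_nseq; lia.
have Z : Raised r 0 (fun i => i < r)%N (mulw (xprod R N (fun i => i < r)%N) v).
  exact: raised_base.
by apply: (Raised_shuffle Z) => [|i|i]; lia.
Qed.

End ColumnPositivity.

(** * Restriction of column polynomials to fewer variables *)

Section Restriction.
Variables (R : idomainType) (N : nat) (t : R).
Local Notation n := N.+1.
Local Notation A := {mpoly R[n]}.
Local Notation x := (xvar R N).
Local Notation adj := (adj N).
Local Notation tau := (@stau R N t).
Local Notation colpoly := (@colpoly R N t).
Local Notation xprod := (@xprod R N).

Definition evL (j : nat) : {lrmorphism A -> A} :=
  comp_mpoly [tuple (if (i < j)%N then 'X_i else 0) | i < n].

Lemma evX j (i : 'I_n) : evL j 'X_i = if (i < j)%N then 'X_i else 0.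
Proof. by rewrite -[LHS]/('X_i \mPo _) comp_mpolyXU -tnth_nth tnth_mktuple. Qed.

Lemma ev_x j i : (i < n)%N -> evL j (x i) = if (i < j)%N then x i else 0.
Proof. by move=> iN; rewrite /xvar evX inordK. Qed.

Lemma evC j c : evL j c%:MP = c%:MP.
Proof. exact: comp_mpolyC. Qed.

Opaque evL.

Lemma ev_msym i j p : (i.+1 < j)%N -> (i.+1 < n)%N ->
  evL j (msym (adj i) p) = msym (adj i) (evL j p).
Proof.
move=> ij iN; elim/mpoly_alg_ind: p => [c|k|p q IHp IHq|p q IHp IHq].
- by rewrite msymC !evC msymC.
- rewrite msymXU !evX (adjV (fun k => k < j)%N) // /bswap.
  have -> : ((if val k == i then i.+1 else if val k == i.+1 then i else k) < j)%N
    = (k < j)%N by repeat case: eqP => [->|_]; lia.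
  by case: ifP; rewrite ?msymXU ?msym0.
- by rewrite msymD !rmorphD /= IHp IHq.
by rewrite msymM !rmorphM /= IHp IHq.
Qed.

Lemma ev_dd i j p : (i.+1 < j)%N -> (i.+1 < n)%N ->
  evL j (dd i p) = dd i (evL j p).
Proof.
move=> ij iN; apply/esym; apply: dd_eq => //.
rewrite -ev_msym // -rmorphB -(ddP p iN) rmorphM rmorphB /= !ev_x; try lia.
by rewrite ij (ltnW ij).
Qed.

Lemma ev_tau i j p : (i.+1 < j)%N -> (i.+1 < n)%N ->
  evL j (tau i p) = tau i (evL j p).
Proof.
move=> ij iN; rewrite !stauE rmorphD /= ev_msym // linearZ /= rmorphM /= ev_dd //.
by rewrite ev_x ?(ltnW ij) //; lia.
Qed.

Lemma ev_xprod r j : (r <= j)%N ->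
  evL j (xprod (fun i => i < r)%N) = xprod (fun i => i < r)%N.
Proof.
move=> rj; rewrite /(xprod _) rmorph_prod; apply: eq_bigr => i ir /=.
by rewrite ev_x // (leq_trans ir rj).
Qed.

Lemma ev_colpoly_ge c r j : (r <= j)%N -> (j <= n)%N ->
  evL j (colpoly c r) = colpoly c r.
Proof.
elim: c r => [|s c IH] r rj jn; first by rewrite /= rmorph1.
have [sr|rs] := leqP s r; last by rewrite /= shuffle_gt // rmorph0.
rewrite /= (@map_shuffle _ _ _ _ tau tau (evL j)); last first.
  by move=> i u _ ir; apply: ev_tau; lia.
by rewrite rmorphM /= IH ?ev_xprod //; lia.
Qed.

Definition mulx (p q : A) : A := p * q.
Fact mulx_is_linear p : linear (mulx p).
Proof. by move=> c u v; rewrite /mulx mulrDr scalerAr. Qed.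
HB.instance Definition _ p :=
  GRing.isLinear.Build R A A *:%R (mulx p) (mulx_is_linear p).

Lemma carry_x i k p : (i + k < n)%N ->
  exists q, carry t tau i k (x i * p) = x (i + k) * q.
Proof.
elim: k => [|k IH] ik; first by exists p; rewrite addn0.
have [|q E] := IH; first by lia.
by exists (tau (i + k) q); rewrite /= E Tbar_tau_x ?addnS //; lia.
Qed.

(** The terms of the shuffle that reach the new site j carry a variable to it, and by [Tbar_tau_x]
    the factor x_j comes out in front. Setting x_j = 0 therefore removes them. *)
Lemma colpolyS c j : (j < n)%N -> exists q, colpoly c j.+1 = colpoly c j + x j * q.
Proof.
case: c => [|[|r] c] jn.
- by exists 0; rewrite /= mulr0 addr0.
- by exists 0; rewrite /= shuffle0 mulr0 addr0.
have [rj|jr] := leqP r j; last first.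
  by exists 0; rewrite mulr0 addr0 /= !shuffle_gt ?addr0 //; lia.
rewrite /= (@xprodD1 R N r (fun i => i < r.+1)%N) ?ltnSn //; last by lia.
rewrite -mulrA; set F := xprod _ * _.
have [|q] := @carry_x r (j - r) F; first by lia.
rewrite subnKC // add0n => ->; exists (shuffle t tau 0 r j q); congr (_ + _).
rewrite -[x j * q]/(mulx (x j) q); apply/esym.
apply: (@map_shuffle _ _ _ _ tau tau (mulx (x j))) => i u _ ij.
rewrite /= /mulx tau_mul_sym //; try lia.
by rewrite msym_x; [case: eqP; [|case: eqP]|..]; lia || rewrite //.
Qed.

Lemma ev_colpoly c j : (j <= n)%N -> evL j (colpoly c n) = colpoly c j.
Proof.
move=> jn; suff H k : (j + k <= n)%N -> evL j (colpoly c (j + k)) = colpoly c j.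
  by have := H (n - j)%N; rewrite subnKC //; apply.
elim: k => [|k IH] jk; first by rewrite addn0 ev_colpoly_ge.
have [|q] := @colpolyS c (j + k); first by lia.
rewrite addnS => ->; rewrite rmorphD rmorphM /= IH; last by lia.
by rewrite ev_x; [rewrite ltnNge leq_addr mul0r addr0 | lia].
Qed.

End Restriction.

Global Opaque evL.

(** * The six-vertex row *)

Section Rows.
Variables (K : comNzRingType) (t : K).

(* (1 - t x) times the weight of the vertex with parameter x. *)
Definition vweight (x : K) (b l u r : state) : K :=
  match b, l, u, r with
  | st2, st2, st2, st2 => 1 - t * x
  | st1, st1, st1, st1 => 1 - t * x
  | st2, st1, st2, st1 => 1 - x
  | st2, st1, st1, st2 => (1 - t) * x
  | st1, st2, st2, st1 => 1 - t
  | st1, st2, st1, st2 => t * (1 - x)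
  | _, _, _, _ => 0
  end.

(* Left edge [l], bottom edges [e], top edges [f], free right edge. *)
Fixpoint vrow (l : state) (xs : seq K) (e f : seq state) : K :=
  match xs, e, f with
  | x :: xs', b :: e', u :: f' =>
      vweight x b l u st1 * vrow st1 xs' e' f' +
      vweight x b l u st2 * vrow st2 xs' e' f'
  | _, _, _ => 1
  end.

(** [Tin] lets T act on the bottom word; [Tout] is the transpose, giving the coefficient at the top
    word after T. *)
Definition Tin (F : state -> state -> K) (a b : state) : K :=
  match a, b with
  | st1, st2 => F st2 st1
  | st2, st1 => t * F st1 st2 + (1 - t) * F st2 st1
  | _, _ => F a b
  end.

Definition Tout (F : state -> state -> K) (c d : state) : K :=
  match c, d with
  | st1, st2 => t * F st2 st1
  | st2, st1 => (1 - t) * F st2 st1 + F st1 st2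
  | _, _ => F c d
  end.

(** The Yang-Baxter equation for two adjacent columns, with the divided difference multiplied out.
    It is linear in the row, so the vertices on the left are peeled off by induction, and the rest
    of the row on the right enters only through its values for the two possible edges; 32 polynomial
    identities remain. *)
Lemma row_exchange l ps pe pf x y xs e f a b c d :
  size ps = size pe -> size ps = size pf ->
  let F x y c d a b :=
    vrow l (ps ++ x :: y :: xs) (pe ++ a :: b :: e) (pf ++ c :: d :: f) in
  (x - y) * Tin (F x y c d) a b =
  (x - y) * Tout (fun c d => F y x c d a b) c d
  + (1 - t) * x * (F x y c d a b - F y x c d a b).
Proof.
elim: ps pe pf l => [|z ps IH] [|a' pe] [|c' pf] l //= => [_ _|[spe] [spf]].
  move: (vrow st1 xs e f) (vrow st2 xs e f) => r1 r2.
  by case: l; case: a; case: b; case: c; case: d; rewrite /Tin /Tout /=; ring.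
have := IH pe pf st2 spe spf; have := IH pe pf st1 spe spf; move=> /= {IH}.
move: (vweight z a' l c' st1) (vweight z a' l c' st2) => v1 v2.
have comb (L1 R1 L2 R2 : K) : L1 = R1 -> L2 = R2 ->
    v1 * L1 + v2 * L2 = v1 * R1 + v2 * R2 by move=> -> ->.
move=> /comb H /H {comb}H; apply: (etrans _ (etrans H _)); rewrite /Tin /Tout.
  by case: (a); case: (b); ring.
by case: (c); case: (d); ring.
Qed.

(** The coefficient of the word [e] in (2 - t^(M-1) 1) ... (2 - t 1) (2 - 1), where M is its
    length. *)
Fixpoint psic (e : seq state) : K :=
  match e with
  | [::] => 1
  | st2 :: e' => psic e'
  | st1 :: e' => - t ^+ size e' * psic e'
  end.

End Rows.

Section Eigenvectors.
Variables (R K : comNzRingType) (t : R) (L : lmodType R).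

Lemma psi_cons (B : seq state -> L) a p M q :
  psi t B (a :: p) M q = psi t (fun s => B (a :: s)) p M q.
Proof. by elim: M p => //= M IH p; rewrite !IH. Qed.

Lemma psi_ext (B B' : seq state -> L) p M q : B =1 B' -> psi t B p M q = psi t B' p M q.
Proof. by move=> E; elim: M p => //= M IH p; rewrite !IH. Qed.

End Eigenvectors.

Section RowEigenvectors.
Variables (R : comNzRingType) (K : comAlgType R) (t : R).
Local Notation tK := (t%:A : K).
Local Notation vrow := (vrow tK).
Local Notation psiK := (@psi R t K^o).

Lemma psi_comb (c1 c2 : K) (B1 B2 : seq state -> K) p M q :
  psi t (fun s => c1 * B1 s + c2 * B2 s) p M q =
  c1 * psi t B1 p M q + c2 * psi t B2 p M q.
Proof.
elim: M p => //= M IH p.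
by rewrite !IH scalerDr !mulrBr opprD addrACA !scalerAr.
Qed.

Lemma scale_exp k (v : K) : t ^+ k *: v = tK ^+ k * v.
Proof.
elim: k v => [|k IH] v; first by rewrite !expr0 scale1r mul1r.
by rewrite !exprS -scalerA IH -[LHS]mulr_algl mulrA.
Qed.

(** The powers of t in [psi] are made for this. With left edge 1 and top edge 1, the bottom letter 2
    sends an edge 2 to the right, which costs t^(size xs); hence (1 - t) x and -(1 - t x) carry the
    same power and combine to -(1 - x). Each site thus contributes 1 - x whatever its top letter
    is. *)
Lemma psi_row l xs f : size xs = size f ->
  psi t (fun s => vrow l xs s f) [::] (size xs) [::] =
  (if l is st2 then tK ^+ size xs else 1) * \prod_(x <- xs) (1 - x) * psic tK f.
Proof.
elim: xs f l => [|x xs IH] [|u f] l //= => [_|[sz]].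
  by rewrite big_nil; case: l; rewrite ?expr0 !mulr1.
rewrite !psi_cons !psi_comb !IH // big_cons scale_exp -sz exprS.
by case: l; case: u => /=; ring.
Qed.

Lemma psi_delta f :
  psi t (fun s => (f == s)%:R : K) [::] (size f) [::] = psic tK f.
Proof.
elim: f => [|u f IH] //=.
rewrite !psi_cons -IH.
have E b : psi t (fun s => (u :: f == b :: s)%:R : K) [::] (size f) [::] =
    (u == b)%:R * psi t (fun s => (f == s)%:R : K) [::] (size f) [::].
  rewrite -[RHS]addr0 -(mul0r (psi t (fun s => (f == s)%:R : K) [::] (size f) [::])).
  rewrite -psi_comb; apply: psi_ext => s.
  by rewrite eqseq_cons -natrM mulnb mul0r addr0.
rewrite !E scale_exp.
by case: u {E} => /=; rewrite !(eqxx, mul0r, mul1r, mulr0, subr0, sub0r, mulNr).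
Qed.

(** A vertex with bottom and left edges 1 has only edges 1, with weight 1 - t x; so the row runs
    through the j ones unchanged and meets the factors of [psi] with left edge 1. *)
Lemma psi_row_ones j M xs f : size xs = (j + M)%N -> size f = size xs ->
  psi t (fun s => vrow st1 xs s f) (nseq j st1) M [::] =
  \prod_(x <- take j xs) (1 - tK * x) * \prod_(x <- drop j xs) (1 - x) *
  psi t (fun s => (f == s)%:R : K) (nseq j st1) M [::].
Proof.
elim: j xs f => [|j IH] xs f sxs sf.
  rewrite take0 drop0 big_nil mul1r; have -> : M = size xs by rewrite sxs.
  by rewrite psi_row // mul1r -sf psi_delta.
case: xs sxs sf => [|x xs] //= [sxs]; case: f => [|u f] //= [sf].
rewrite !psi_cons psi_comb IH // big_cons.
have E : psi t (fun s => (u :: f == st1 :: s)%:R : K) (nseq j st1) M [::] =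
    (u == st1)%:R * psi t (fun s => (f == s)%:R : K) (nseq j st1) M [::].
  rewrite -[RHS]addr0 -(mul0r (psi t (fun s => (f == s)%:R : K) (nseq j st1) M [::])).
  rewrite -psi_comb; apply: psi_ext => s.
  by rewrite eqseq_cons -natrM mulnb mul0r addr0.
by rewrite E; case: u {E} => /=; ring.
Qed.

End RowEigenvectors.

(** * Power series as coefficient sequences *)

Section Convolution.
Variable A : comNzRingType.

Definition conv (q : {poly A}) (u : nat -> A) (k : nat) : A :=
  \sum_(i < k.+1) q`_i * u (k - i)%N.

Lemma convE q u k M : (k < M)%N -> conv q u k = (q * \poly_(i < M) u i)`_k.
Proof.
move=> kM; rewrite coefM; apply: eq_bigr => i _; rewrite coef_poly.
by rewrite (leq_ltn_trans (leq_subr _ _) kM).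
Qed.

Lemma eq_conv q u v k : (forall i, (i <= k)%N -> u i = v i) -> conv q u k = conv q v k.
Proof. by move=> uv; apply: eq_bigr => i _; rewrite uv // leq_subr. Qed.

Lemma convM p q u k : conv (p * q) u k = conv p (conv q u) k.
Proof.
rewrite (@convE _ _ k k.+1) // -mulrA coefM; apply: eq_bigr => i _.
by rewrite -convE // ltnS leq_subr.
Qed.

Lemma conv_coef (q p : {poly A}) k : conv q (fun i => p`_i) k = (q * p)`_k.
Proof. by rewrite coefM. Qed.

Lemma conv0 q u : conv q u 0%N = q`_0 * u 0%N.
Proof. by rewrite /conv big_ord1. Qed.

Lemma conv_uniq (q : {poly A}) u v : q`_0 = 1 -> conv q u =1 conv q v -> u =1 v.
Proof.
move=> q0 E; elim/ltn_ind => k IH; have := E k.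
rewrite /conv !big_ord_recl q0 !mul1r !subn0 => H.
have S : \sum_(i < k) q`_(lift ord0 i) * u (k - lift ord0 i)%N =
         \sum_(i < k) q`_(lift ord0 i) * v (k - lift ord0 i)%N.
  apply: eq_bigr => i _; rewrite IH // lift0.
  by have := ltn_ord i; lia.
by move: H; rewrite S => /addIr.
Qed.

Lemma conv_lin b u k :
  conv (1 - b%:P * 'X) u k = u k - b * (if k is k'.+1 then u k' else 0).
Proof.
have cE i : (1 - b%:P * 'X : {poly A})`_i = (i == 0%N)%:R - b * (i == 1%N)%:R.
  by rewrite coefB coef1 coefCM coefX.
case: k => [|k]; first by rewrite conv0 cE /= mulr0 !subr0 mul1r.
rewrite /conv !big_ord_recl !cE /= mulr0 subr0 mul1r mulr1 sub0r subn0 subSS subn0.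
by rewrite big1 ?addr0 ?mulNr // => i _; rewrite cE /= mulr0 subr0 mul0r.
Qed.

Lemma eq_convl q u v k : u =1 v -> conv q u k = conv q v k.
Proof. by move=> uv; apply: eq_conv => i _. Qed.

End Convolution.

Lemma big_state (M : nmodType) (F : state -> M) : \sum_s F s = F st1 + F st2.
Proof.
rewrite (bigD1 st1) // (bigD1 st2) //= big1 ?addr0 // => s.
by case: s.
Qed.

Section RowSum.
Variables (K : comNzRingType) (t : K).

Lemma rowE n l (xs : seq K) (e f : seq state) :
  size xs = n -> size e = n -> size f = n ->
  vrow t l xs e f = \sum_(h : n.-tuple state) \prod_(i < n)
    vweight t (nth 0 xs i) (nth st1 e i) (nth st1 (l :: h) i) (nth st1 f i)
      (nth st1 h i).
Proof.
elim: n l xs e f => [|n IH] l [|x xs] [|b e] [|u f] //= => [_ _ _|[sx] [se] [sf]].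
  rewrite (bigD1 [tuple]) //= big_ord0 big1 ?addr0 // => h.
  by move/eqP; case; apply: tuple0.
rewrite (reindex (fun p : state * n.-tuple state => [tuple of p.1 :: p.2])); last first.
  exists (fun h : n.+1.-tuple state => (thead h, [tuple of behead h])).
    by case=> s h _; congr pair; apply: val_inj.
  by move=> h _; rewrite -tuple_eta.
rewrite -(pair_bigA _ (fun s (h : n.-tuple state) => \prod_(i < n.+1)
    vweight t (nth 0 (x :: xs) i) (nth st1 (b :: e) i) (nth st1 (l :: s :: h) i)
      (nth st1 (u :: f) i) (nth st1 (s :: h) i))) /= big_state.
by rewrite !(IH _ xs e f) // !mulr_sumr; congr (_ + _); apply: eq_bigr => h _;
  rewrite big_ord_recl.
Qed.

End RowSum.

Lemma vweight_six (K : fieldType) (a t : K) b l u r : 1 - t * a != 0 ->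
  (1 - t * a) * six_vertex a t b l u r = vweight t a b l u r.
Proof.
move=> nz; case: b; case: l; case: u; case: r;
  by rewrite /= ?mulr0 ?mulr1 // mulrCA divff ?mulr1.
Qed.

Lemma map_vweight (K K' : comNzRingType) (f : {rmorphism K -> K'}) t x b l u r :
  f (vweight t x b l u r) = vweight (f t) (f x) b l u r.
Proof.
by case: b; case: l; case: u; case: r;
  rewrite /= ?rmorph0 ?(rmorphM, rmorphB) ?rmorph1 ?rmorphM.
Qed.

Section TransferRow.
Variables (R : idomainType) (N : nat) (t : R).
Local Notation n := N.+1.
Local Notation A := {mpoly R[n]}.
Local Notation word := (n.-tuple state).
Local Notation x := (xvar R N).

Definition alphax (i : nat) : {poly A} := (x i)%:P * 'X.
Definition alphaxs : seq {poly A} := [seq alphax i | i <- iota 0 n].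
Definition tP : {poly A} := (t%:MP)%:P.

Definition Qpoly : {poly A} := \prod_(y <- alphaxs) (1 - y).

Lemma nth_alphaxs (i : 'I_n) : nth 0 alphaxs i = ('X_i)%:P * 'X.
Proof.
have iN := ltn_ord i.
rewrite /alphaxs (nth_map 0%N); last by rewrite size_iota.
by rewrite nth_iota; [rewrite add0n /alphax /xvar inord_val|].
Qed.

Definition trow (f e : word) : {poly A} := vrow tP st1 alphaxs e f.

Lemma size_alphaxs : size alphaxs = n.
Proof. by rewrite size_map size_iota. Qed.

Lemma QpolyE : Qpoly = \prod_(i < n) (1 - nth 0 alphaxs i).
Proof. by rewrite /Qpoly (big_nth 0) size_alphaxs big_mkord. Qed.

Lemma coef0_1MX (b : A) : (1 - b%:P * 'X)`_0 = 1.
Proof. by rewrite coefB coef1 coefMX subr0. Qed.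

Lemma Qpoly0 : Qpoly`_0 = 1.
Proof.
rewrite /Qpoly big_map; apply: (big_ind (fun q : {poly A} => q`_0 = 1)).
- by rewrite coef1.
- by move=> p q p0 q0; rewrite coef0M p0 q0 mulr1.
by move=> i _; apply: coef0_1MX.
Qed.

Lemma poly0_neq0 (q : {poly A}) : q`_0 = 1 -> q%:F != 0.
Proof.
move=> q0; rewrite tofrac_eq0; apply/eqP=> E.
by move: q0; rewrite E coef0 => /esym/eqP; rewrite oner_eq0.
Qed.

(** The prefactor of the normalized operator clears the denominators 1 - t alpha x_i of the weights,
    which leaves a polynomial row over the common denominator [Qpoly]. *)
Lemma transfer_tilde_row (f e : word) :
  transfer_tilde t f e = (trow f e)%:F / Qpoly%:F.
Proof.
have aE i : alphaF R n * aF R i = (nth 0 alphaxs i)%:F.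
  by rewrite nth_alphaxs tofracM mulrC.
rewrite /transfer_tilde /transfer big_split /= mulrAC; congr (_ * _); last first.
  rewrite QpolyE rmorph_prod /= -prodfV.
  by apply: eq_bigr => i _; rewrite aE tofracB tofrac1.
rewrite /trow (@rowE _ _ n) ?size_tuple ?size_alphaxs // rmorph_sum mulr_sumr.
apply: eq_bigr => h _; rewrite rmorph_prod -big_split; apply: eq_bigr => i _ /=.
rewrite -mulrA aE vweight_six; last first.
  rewrite nth_alphaxs /constF -tofracM -tofrac1 -tofracB mulrA -polyCM.
  by apply: poly0_neq0; apply: coef0_1MX.
by rewrite map_vweight !(tnth_nth st1).
Qed.

Lemma conv_transfer (f e : word) k :
  conv Qpoly (fun i => mxel (transfer_coef n t i) f e) k = (trow f e)`_k.
Proof.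
set u := fun i => _.
have [p [q [q0 E Hu]]] : is_expansion (transfer_tilde t f e) u := transfer_coefP t f e.
have QF := poly0_neq0 Qpoly0; have qF : q%:F != 0 by rewrite tofrac_eq0.
suff : conv Qpoly u =1 (fun i => (trow f e)`_i) by apply.
apply: (@is_expansion_uniq _ (trow f e)%:F).
  exists (p * Qpoly), q; split=> //.
    have := E; rewrite transfer_tilde_row => /(canRL (mulfVK QF)) ->.
    by rewrite tofracM mulrAC.
  move=> i; rewrite -[LHS]/(conv q (conv Qpoly u) i) -convM mulrC convM.
  by rewrite mulrC -conv_coef; apply: eq_convl => j; apply: Hu.
exists (trow f e), 1; split; [exact: oner_neq0 | by rewrite tofrac1 divr1 |].
by move=> i; rewrite -[LHS]/(conv 1 (fun i => (trow f e)`_i) i) conv_coef mul1r.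
Qed.

End TransferRow.

(** * Operators commuting with the Hecke action *)

Lemma map_vrow (K K' : comNzRingType) (f : {rmorphism K -> K'}) t l xs e g :
  f (vrow t l xs e g) = vrow (f t) l (map f xs) e g.
Proof.
elim: xs l e g => [|x xs IH] l [|b e] [|u g] //=; rewrite ?rmorph1 //.
by rewrite rmorphD !rmorphM !map_vweight !IH.
Qed.

(** For vertex parameters proportional to alpha the exchange relation has an overall factor alpha,
    so its coefficient of degree k + 1 is the relation for the k-th coefficients. *)
Lemma row_exchange_coef (A : comNzRingType) (t x y : A) l ps pe pf xs e f a b c d k :
  size ps = size pe -> size ps = size pf ->
  let F x y c d a b := vrow t%:P l (ps ++ x%:P * 'X :: y%:P * 'X :: xs)
    (pe ++ a :: b :: e) (pf ++ c :: d :: f) in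
  (x - y) * Tin t (fun a b => (F x y c d a b)`_k) a b =
  (x - y) * Tout t (fun c d => (F y x c d a b)`_k) c d
  + (1 - t) * x * ((F x y c d a b)`_k - (F y x c d a b)`_k).
Proof.
move=> spe spf F.
have t1 : 1 - t%:P = (1 - t)%:P :> {poly A} by rewrite polyCB polyC1.
have cX u (p : {poly A}) : (u%:P * 'X * p)`_k.+1 = u * p`_k.
  by rewrite -mulrA coefCM coefXM.
have XY : x%:P * 'X - y%:P * 'X = (x - y)%:P * 'X :> {poly A}.
  by rewrite polyCB mulrBl.
have tX : (1 - t%:P) * (x%:P * 'X) = ((1 - t) * x)%:P * 'X :> {poly A}.
  by rewrite t1 mulrA -polyCM.
have := row_exchange t%:P l (x%:P * 'X) (y%:P * 'X) xs e f a b c d spe spf.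
rewrite /= XY tX => /(congr1 (fun p : {poly A} => p`_k.+1)).
rewrite coefD !cX coefB => H; apply: (etrans _ (etrans H _)).
  by rewrite /Tin t1; case: (a); case: (b); rewrite ?coefD ?coefCM.
by rewrite /Tout t1; case: (c); case: (d); rewrite ?coefD ?coefCM.
Qed.

Lemma map_iota_split (X : Type) (f : X -> X) (a : nat -> X) i n : (i.+1 < n)%N ->
  f (a i) = a i.+1 -> f (a i.+1) = a i ->
  (forall j, (j < n)%N -> j != i -> j != i.+1 -> f (a j) = a j) ->
  exists ps qs,
  [/\ map a (iota 0 n) = ps ++ a i :: a i.+1 :: qs, size ps = i &
      map f (map a (iota 0 n)) = ps ++ a i.+1 :: a i :: qs].
Proof.
move=> iN fL fR fa; exists (map a (iota 0 i)), (map a (iota i.+2 (n - i.+2))).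
have E : iota 0 n = iota 0 i ++ i :: i.+1 :: iota i.+2 (n - i.+2).
  by rewrite -[_ :: _]/(iota i (n - i.+2).+2) -{2}[i]add0n -iotaD; congr iota; lia.
have inv s : {in s, forall j, (j < n)%N && (j != i) && (j != i.+1)} ->
    map f (map a s) = map a s.
  move=> H; rewrite -map_comp; apply/eq_in_map => j /H /andP[/andP[jN ji] ji'].
  exact: fa.
split; first by rewrite E map_cat.
  by rewrite size_map size_iota.
have i1 : map f (map a (iota 0 i)) = map a (iota 0 i).
  by apply: inv => j; rewrite mem_iota; lia.
have i2 : map f (map a (iota i.+2 (n - i.+2))) = map a (iota i.+2 (n - i.+2)).
  by apply: inv => j; rewrite mem_iota; lia.
by rewrite E !map_cat !map_cons fL fR i1 i2.
Qed.

Section Operators.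
Variables (R : idomainType) (N : nat) (t : R).
Local Notation n := N.+1.
Local Notation A := {mpoly R[n]}.
Local Notation word := (n.-tuple state).
Local Notation W := {ffun word -> A}.
Local Notation x := (xvar R N).
Local Notation adj := (adj N).
Local Notation T := (@hecke R N t).
Local Notation basisw := (basisw R N).

Lemma mulw_at p (v : W) e : mulw p v e = p * v e.
Proof. by rewrite ffunE. Qed.

Lemma addw_at (u v : W) e : (u + v) e = u e + v e.
Proof. by rewrite ffunE. Qed.

Lemma scalew_at (c : R) (v : W) e : (c *: v) e = c *: v e.
Proof. by rewrite ffunE. Qed.

Lemma basisw_at s e : basisw s e = (val e == s)%:R.
Proof. by rewrite ffunE. Qed.

Definition act (M : operator A n) (v : W) : W :=
  [ffun f => \sum_e mxel M f e * v e].

Lemma actE M v f : act M v f = \sum_e mxel M f e * v e.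
Proof. by rewrite ffunE. Qed.

Fact act_is_linear M : linear (act M).
Proof.
move=> c u v; apply/ffunP=> f; rewrite !ffunE scaler_sumr -big_split.
by apply: eq_bigr => e _; rewrite !ffunE mulrDr -scalerAr.
Qed.
HB.instance Definition _ M :=
  GRing.isLinear.Build R W W *:%R (act M) (act_is_linear M).
Definition actL M : {linear W -> W} := act M.

Lemma actLE M v f : actL M v f = \sum_e mxel M f e * v e.
Proof. exact: actE. Qed.

Opaque actL.

Lemma act_mulw M p v : actL M (mulw p v) = mulw p (actL M v).
Proof.
apply/ffunP=> f; rewrite mulw_at !actLE mulr_sumr; apply: eq_bigr => e _.
by rewrite mulw_at mulrCA.
Qed.

Lemma actLD M M' v : actL (M + M') v = actL M v + actL M' v.
Proof.
apply/ffunP=> f; rewrite addw_at !actLE -big_split; apply: eq_bigr => e _.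
by rewrite /mxel mxE mulrDl.
Qed.

Lemma actL0 v : actL 0 v = 0.
Proof.
apply/ffunP=> f; rewrite actLE big1 => [|e _]; first by rewrite ffunE.
by rewrite /mxel mxE mul0r.
Qed.

Lemma actLZ c M v : actL (c *: M) v = mulw c (actL M v).
Proof.
apply/ffunP=> f; rewrite mulw_at !actLE mulr_sumr; apply: eq_bigr => e _.
by rewrite /mxel mxE mulrA.
Qed.

Lemma actL1 v : actL 1 v = v.
Proof.
apply/ffunP=> f; rewrite actLE (bigD1 f) //= /mxel mxE eqxx mul1r big1 ?addr0 //.
move=> e ef; rewrite mxE (inj_eq enum_rank_inj) eq_sym (negPf ef) mul0r //.
Qed.

Lemma actLM M M' v : actL (M * M') v = actL M (actL M' v).
Proof.
apply/ffunP=> f; rewrite !actLE.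
under [RHS]eq_bigr do rewrite actLE mulr_sumr.
rewrite exchange_big; apply: eq_bigr => e _; rewrite {1}/mxel mxE mulr_suml.
rewrite (reindex (@enum_rank word)) /=; last first.
  by exists enum_val => k _; rewrite ?enum_rankK ?enum_valK.
by apply: eq_bigr => g _; rewrite mulrA.
Qed.

Lemma act_basisw M (e : word) f : actL M (basisw e) f = mxel M f e.
Proof.
rewrite actLE (bigD1 e) //= basisw_at eqxx mulr1 big1 ?addr0 // => g ge.
by rewrite basisw_at val_eqE (negPf ge) mulr0.
Qed.

Lemma basisw_sum (v : W) : v = \sum_e mulw (v e) (basisw (val e)).
Proof.
apply/ffunP=> f; rewrite sum_ffunE (bigD1 f) //=.
rewrite mulw_at basisw_at eqxx mulr1 big1 ?addr0 //.
by move=> g gf; rewrite mulw_at basisw_at val_eqE eq_sym (negPf gf) mulr0.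
Qed.

Definition commutesH (M : operator A n) : Prop :=
  forall i v, (i.+1 < n)%N -> T i (actL M v) = actL M (T i v).

Lemma hecke_mulw i p (v : W) : (i.+1 < n)%N ->
  T i (mulw p v) = mulw (msym (adj i) p) (T i v) + (1 - t) *: mulw (x i * dd i p) v.
Proof. by move=> iN; rewrite !heckeE Hecke_mulw. Qed.

(** Operators are linear over polynomials, and T_i (p v) differs from s_i(p) T_i v only by a
    polynomial multiple of v, so words are enough. *)
Lemma commutesH_basis M :
  (forall i (e f : word), (i.+1 < n)%N ->
     T i (actL M (basisw e)) f = actL M (T i (basisw e)) f) -> commutesH M.
Proof.
move=> H i v iN; rewrite (basisw_sum v) !linear_sum; apply: eq_bigr => e _.
rewrite act_mulw !hecke_mulw // linearD linearZ /= !act_mulw.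
by congr (mulw _ _ + _); apply/ffunP => f; apply: H.
Qed.

Lemma commutesHD M M' : commutesH M -> commutesH M' -> commutesH (M + M').
Proof. by move=> H H' i v iN; rewrite !actLD linearD /= H ?H'. Qed.

Lemma commutesH0 : commutesH 0.
Proof. by move=> i v iN; rewrite !actL0 linear0. Qed.

Lemma commutesH1 : commutesH 1.
Proof. by move=> i v iN; rewrite !actL1. Qed.

Lemma commutesHM M M' : commutesH M -> commutesH M' -> commutesH (M * M').
Proof. by move=> H H' i v iN; rewrite !actLM H // H'. Qed.

Lemma commutesHZ c M : (forall i, (i.+1 < n)%N -> msym (adj i) c = c) ->
  commutesH M -> commutesH (c *: M).
Proof.
move=> cs H i v iN; rewrite !actLZ hecke_mulw_sym ?cs // H //.
Qed.

Lemma commutesH_sum I (r : seq I) (P : pred I) F :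
  (forall i, P i -> commutesH (F i)) -> commutesH (\sum_(i <- r | P i) F i).
Proof. exact: (big_ind _ commutesH0 commutesHD). Qed.

Definition row_coef k : operator A n :=
  \matrix_(i, j) (trow t (enum_val i) (enum_val j))`_k.

Lemma mxel_row_coef k f e : mxel (row_coef k) f e = (trow t f e)`_k.
Proof. by rewrite /mxel mxE !enum_rankK. Qed.

Local Notation alphax := (@alphax R N).
Local Notation alphaxs := (@alphaxs R N).

Definition smap (i : nat) : {rmorphism {poly A} -> {poly A}} := map_poly (msym (adj i)).

Lemma smap_alphax i j : (i.+1 < n)%N -> (j < n)%N ->
  smap i (alphax j) = alphax (if j == i then i.+1 else if j == i.+1 then i else j).
Proof.
move=> iN jN; rewrite /(alphax _) rmorphM /= map_polyC /= map_polyX.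
by rewrite -[X in X%:P]/(msym (adj i) (x j)) msym_x.
Qed.

Lemma smapC i c : smap i c%:P = (msym (adj i) c)%:P.
Proof. exact: map_polyC. Qed.

Lemma coef_smap i p k : (smap i p)`_k = msym (adj i) p`_k.
Proof. exact: coef_map. Qed.

Opaque smap.

Lemma alphaxs_split i : (i.+1 < n)%N -> exists ps qs,
  [/\ alphaxs = ps ++ alphax i :: alphax i.+1 :: qs, size ps = i &
      map (smap i) alphaxs = ps ++ alphax i.+1 :: alphax i :: qs].
Proof.
move=> iN; apply: map_iota_split => // [||j jN ji ji'].
- by apply: (etrans (smap_alphax iN (ltnW iN))); congr alphax; rewrite eqxx.
- apply: (etrans (smap_alphax iN iN)); congr alphax.
  by rewrite eqxx; case: eqP => //; lia.
by apply: (etrans (smap_alphax iN jN)); rewrite (negPf ji) (negPf ji').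
Qed.

Lemma exchange_dd i (G G2 : state -> state -> state -> state -> A) a b c d :
  (i.+1 < n)%N ->
  (forall c d a b, G2 c d a b = msym (adj i) (G c d a b)) ->
  (x i - x i.+1) * Tin t%:MP (G c d) a b =
    (x i - x i.+1) * Tout t%:MP (fun c d => G2 c d a b) c d
    + (1 - t%:MP) * x i * (G c d a b - G2 c d a b) ->
  Tin t%:MP (G c d) a b = Tout t%:MP (fun c d => msym (adj i) (G c d a b)) c d
    + (1 - t%:MP) * (x i * dd i (G c d a b)).
Proof.
move=> iN sG H; have nz : x i - x i.+1 != 0 by apply: subX_neq0; apply: inord_succ_neq.
apply: (mulfI nz); apply: (etrans H).
apply: (etrans _ (esym (mulrDr _ _ _))); congr (_ + _).
  by congr (_ * _); rewrite /Tout; case: (c); case: (d); rewrite !sG.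
by rewrite sG -mulrA -(ddP (G c d a b) iN) [RHS]mulrCA; congr (_ * _); rewrite mulrCA.
Qed.

(** Exchanging the parameters of columns i and i + 1 is the action of s_i on the entries of the row.
    Dividing the exchange relation by x_i - x_(i+1) therefore yields the very formula of T_i on both
    sides. *)
Lemma commutesH_row_coef k : commutesH (row_coef k).
Proof.
apply: commutesH_basis => i e f iN.
have [ps [qs [xsE ips xsE']]] := alphaxs_split iN.
have [pe [a [b [qe [eE ipe]]]]] := split_word e iN.
have [pf [c [d [qf [fE ipf]]]]] := split_word f iN.
have tPs : smap i (tP N t) = tP N t by rewrite smapC msymC.
pose F X Y c d a b := vrow (tP N t) st1 (ps ++ X :: Y :: qs)
  (pe ++ a :: b :: qe) (pf ++ c :: d :: qf).
pose G c d a b := (F (alphax i) (alphax i.+1) c d a b)`_k.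
pose G2 c d a b := (F (alphax i.+1) (alphax i) c d a b)`_k.
have sG c' d' a' b' : G2 c' d' a' b' = msym (adj i) (G c' d' a' b').
  by rewrite -coef_smap map_vrow tPs -xsE xsE'.
have szpe : size ps = size pe by rewrite ips ipe.
have szpf : size ps = size pf by rewrite ips ipf.
have key := exchange_dd iN sG
  (row_exchange_coef t%:MP (x i) (x i.+1) st1 qs qe qf a b c d k szpe szpf).
have GE (f' e' : word) c' d' a' b' : val f' = pf ++ c' :: d' :: qf ->
    val e' = pe ++ a' :: b' :: qe -> (trow t f' e')`_k = G c' d' a' b'.
  by move=> fE' eE'; rewrite /trow fE' eE' xsE.
have Lf : T i (actL (row_coef k) (basisw e)) f =
    Tout t%:MP (fun c d => msym (adj i) (G c d a b)) c d
    + (1 - t%:MP) * (x i * dd i (G c d a b)).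
  rewrite heckeE HeckeE !act_basisw !mxel_row_coef.
  rewrite (GE f e c d a b fE eE) (GE (swapw i f) e d c a b (swapw_cat iN fE ipf) eE).
  rewrite !tnth_nth_inord ?fE ?nth_cat ?ipf; try lia.
  rewrite ltnn [(i.+1 < i)%N]ltnNge leqnSn subnn subSnn /= -!mul_mpolyC.
  rewrite mpolyCB mpolyC1; congr (_ + _).
  by case: (c); case: (d); rewrite /= ?mpolyC0 ?mpolyC1 ?mpolyCB ?mpolyC1 ?mul0r
    ?mul1r ?add0r ?addr0.
apply: (etrans Lf); apply: (etrans (esym key)).
have sz a' b' : size (pe ++ a' :: b' :: qe) == n.
  by rewrite -(size_tuple e) eE !size_cat.
have aB a' b' : actL (row_coef k) (basisw (pe ++ a' :: b' :: qe)) f = G c d a' b'.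
  rewrite -[pe ++ _]/(val (Tuple (sz a' b'))) act_basisw mxel_row_coef.
  exact: GE.
have pq : (size pe + (size qe).+2 = n)%N by have /eqP := sz a b; rewrite size_cat.
rewrite heckeE eE Hecke_basisw // /Tin.
case: (a); case: (b); [exact/esym/aB | exact/esym/aB | | exact/esym/aB].
apply/esym; have := aB st1 st2; have := aB st2 st1.
move: (basisw _) (basisw _) (G c d st1 st2) (G c d st2 st1) => u v g1 g2 Hu Hv.
rewrite linearD 2!linearZ addw_at 2!scalew_at.
rewrite -2!mul_mpolyC mpolyCB mpolyC1.
by congr (_ * _ + _ * _).
Qed.

End Operators.

Lemma prod_map_swap (K : comNzRingType) (f : {rmorphism K -> K}) s ps y z qs :
  s = ps ++ y :: z :: qs -> map f s = ps ++ z :: y :: qs ->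
  f (\prod_(u <- s) (1 - u)) = \prod_(u <- s) (1 - u).
Proof.
move=> sE sE'; rewrite rmorph_prod /=.
under eq_bigr do rewrite rmorphB rmorph1.
rewrite -(big_map f xpredT (fun u => 1 - u)) sE' sE.
by rewrite !big_cat !big_cons /= [X in _ * X]mulrCA.
Qed.

(** * One-row polynomials *)

Section OneRow.
Variables (R : idomainType) (N : nat) (t : R).
Local Notation n := N.+1.
Local Notation A := {mpoly R[n]}.
Local Notation x := (xvar R N).
Local Notation adj := (adj N).
Local Notation tau := (@stau R N t).
Local Notation colpoly := (@colpoly R N t).

(* The part of the one-row polynomial of degree k in x_0, ..., x_j that
   involves x_j, up to the factor 1 - t. *)
Definition gnew j k : A := if k is 0 then 0 else carry t tau 0 j (x 0 ^+ k).

(** This is g_k in x_0, ..., x_(j-1). Since g_0 = 1 for any number of variables, [gnew] has to be 0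
    at k = 0; carrying x_0^0 would give t^j. *)
Fixpoint gpart j k : A :=
  if j is j'.+1 then gpart j' k + (1 - t) *: gnew j' k else (k == 0%N)%:R.

Lemma gpart0 j : gpart j 0 = 1.
Proof. by elim: j => //= j ->; rewrite scaler0 addr0. Qed.

Lemma ev_msym_ge i j (p : A) : (j <= i)%N -> (i.+1 < n)%N ->
  msym (adj i) (evL R N j p) = evL R N j p.
Proof.
move=> ij iN; elim/mpoly_alg_ind: p => [c|k|p q IHp IHq|p q IHp IHq].
- by rewrite evC msymC.
- rewrite evX; case: ifP => kj; last by rewrite msym0.
  rewrite msymXU; congr 'X_ _; rewrite -(inord_val k) adjE //.
  by case: eqP => [|_]; [lia|case: eqP => //; lia].
- by rewrite rmorphD msymD IHp IHq.
by rewrite rmorphM msymM IHp IHq.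
Qed.

Lemma ev_gnew i j k : (j < i)%N -> (i <= n)%N -> evL R N i (gnew j k) = gnew j k.
Proof.
move=> ji iN; case: k => [|k]; first by rewrite /= rmorph0.
rewrite /gnew (@map_carry _ _ _ _ tau tau (evL R N i)); last first.
  by move=> l u lj; apply: ev_tau; lia.
by rewrite rmorphXn /= ev_x //; have -> : (0 < i)%N by lia.
Qed.

Lemma ev_gpart i j k : (j <= i)%N -> (i <= n)%N -> evL R N i (gpart j k) = gpart j k.
Proof.
elim: j => [|j IH] ji iN; first by rewrite /= rmorph_nat.
by rewrite /= rmorphD /= linearZ /= IH ?ev_gnew //; lia.
Qed.

(** Induction on j by applying Tbar_j to the identity: a factor x_j turns into x_(j+1) T_j, the
    polynomial g_k of the earlier variables is fixed by T_j, and T_j = Tbar_j + (1 - t) supplies the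
    term that completes [gpart j.+1]. *)
Lemma gnew_rec j k : (j < n)%N -> gnew j k.+1 - x j * gnew j k = x j * gpart j k.
Proof.
elim: j k => [|j IH] k jN.
  case: k => [|k] /=; first by rewrite expr1 mulr0 subr0 mulr1.
  by rewrite mulr0 exprS subrr.
have gnewS k' : gnew j.+1 k' = Tbar t tau j (gnew j k').
  by case: k' => [|k']; rewrite /gnew ?add0n //= linear0.
have sg : msym (adj j) (gpart j k) = gpart j k.
  by rewrite -(@ev_gpart j) // ?ev_msym_ge // ltnW // ltnW.
have := congr1 (Tbar t tau j) (IH k (ltnW jN)).
have TbB (u v : A) : Tbar t tau j (u - v) = Tbar t tau j u - Tbar t tau j v.
  exact: linearB.
rewrite TbB -gnewS !Tbar_tau_x // => H.
have tg : tau j (gpart j k) = gpart j k.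
  by rewrite stauE sg dd_sym // mulr0 scaler0 addr0.
rewrite tg (T_TbarD t tau j) -gnewS in H.
rewrite -[gpart j.+1 k]/(gpart j k + (1 - t) *: gnew j k).
move: (gnew j.+1 k.+1) (gnew j.+1 k) (_ *: gnew j k) (gpart j k) (x j.+1) H
  => a b c g y H.
by rewrite [RHS]mulrDr -H mulrDr opprD addrA subrK.
Qed.

(** In terms of generating functions, the variable x_j contributes the factor (1 - t x_j alpha) / (1
    - x_j alpha). *)
Lemma gpart_lin j k : (j < n)%N ->
  conv (1 - (x j)%:P * 'X) (gpart j.+1) k = conv (1 - (t *: x j)%:P * 'X) (gpart j) k.
Proof.
move=> jN; apply: (etrans (conv_lin _ _ _)); apply: (etrans _ (esym (conv_lin _ _ _))).
case: k => [|k]; first by apply: (congr2 (fun a b => a - b)); rewrite ?gpart0 // !mulr0.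
have gpartS k' : gpart j.+1 k' = gpart j k' + (1 - t) *: gnew j k' by [].
have := gnew_rec k jN; rewrite !gpartS.
move: (gnew j k.+1) (gnew j k) (gpart j k.+1) (gpart j k) (x j) => c1 c g1 g y.
move=> /(canRL (subrK _)) ->; rewrite -!mul_mpolyC mpolyCB mpolyC1.
ring.
Qed.

(** Columns of length 1 form a single row: their variables multiply to a power of x_0, and shuffling
    one letter sums the carries of this power. *)
Lemma gpart_colpoly j k : gpart j k.+1 = (1 - t) *: colpoly (nseq k.+1 1%N) j.
Proof.
have c1 : (0 < n)%N by [].
have X1 k' : xprod R N (fun i => i < 1)%N * colpoly (nseq k' 1%N) 1 = x 0 ^+ k'.+1.
  have X0 : xprod R N (fun i => i < 1)%N = x 0.
    rewrite (@xprodD1 R N 0 (fun i => i < 1)%N) // /xprod big1 ?mulr1 //.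
    by move=> i; lia.
  elim: k' => [|k' IH]; first by rewrite X0 /= mulr1 expr1.
  rewrite -[colpoly _ 1]/(shuffle t tau 0 1 1 (xprod R N (fun i => i < 1)%N *
    colpoly (nseq k' 1%N) 1)).
  by rewrite shuffle_full IH X0 -exprS.
have colE i : colpoly (nseq k.+1 1%N) i = shuffle t tau 0 1 i (x 0 ^+ k.+1).
  by rewrite -X1.
elim: j => [|j IH]; first by rewrite colE /= scaler0.
have sE v : shuffle t tau 0 1 j.+1 v =
    shuffle t tau 0 1 j v + shuffle t tau 0 0 j (carry t tau 0 (j - 0) v) by [].
by rewrite colE sE shuffle0 subn0 scalerDr -colE -IH.
Qed.

End OneRow.

(** * Spectrum of the transfer operators *)

Section Spectrum.
Variables (R : idomainType) (N : nat) (t : R).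
Local Notation n := N.+1.
Local Notation A := {mpoly R[n]}.
Local Notation word := (n.-tuple state).
Local Notation W := {ffun word -> A}.
Local Notation x := (xvar R N).
Local Notation adj := (adj N).
Local Notation Q := (Qpoly R N).
Local Notation alphaxs := (alphaxs R N).
Local Notation basisw := (basisw R N).

Lemma Qpoly_sym i k : (i.+1 < n)%N -> msym (adj i) Q`_k = Q`_k.
Proof.
move=> iN; have [ps [qs [xsE _ xsE']]] := @alphaxs_split R N i iN.
by have /(congr1 (fun p : {poly A} => p`_k)) := prod_map_swap xsE xsE'; rewrite coef_smap.
Qed.

Lemma transfer_coef_rec k : transfer_coef n t k = row_coef N t k -
  \sum_(j < k) Q`_j.+1 *: transfer_coef n t (k - j.+1)%N.
Proof.
apply/matrixP => a b.
have := conv_transfer t (enum_val a) (enum_val b) k.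
rewrite /conv big_ord_recl subn0 Qpoly0 mul1r -mxel_row_coef.
rewrite /mxel !enum_valK => /(canRL (addrK _)) ->.
rewrite [RHS]mxE [X in _ = _ + X]mxE summxE; congr (_ - _).
by apply: eq_bigr => j _; rewrite [RHS]mxE lift0.
Qed.

(** The coefficients of [Qpoly] are symmetric, so multiplication by them commutes with T_i, and the
    property passes from the row to its quotient by [Qpoly]. *)
Lemma commutesH_transfer k : commutesH t (transfer_coef n t k).
Proof.
elim/ltn_ind: k => k IH; rewrite transfer_coef_rec -scaleN1r.
apply: commutesHD; first exact: commutesH_row_coef.
apply: commutesHZ => [i iN|]; first by rewrite msymN msym1.
apply: commutesH_sum => j _; apply: commutesHZ => [i iN|].
  exact: Qpoly_sym.
by apply: IH; have := ltn_ord j; lia.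
Qed.

End Spectrum.

Section Eigenvectors.
Variables (R : idomainType) (N : nat) (t : R).
Local Notation n := N.+1.
Local Notation A := {mpoly R[n]}.
Local Notation word := (n.-tuple state).
Local Notation W := {ffun word -> A}.
Local Notation x := (xvar R N).
Local Notation Q := (Qpoly R N).
Local Notation alphaxs := (alphaxs R N).
Local Notation basisw := (basisw R N).

Definition eigvec j : W := psi t basisw (nseq j st1) (n - j) [::].

Definition eigval j : {poly A} :=
  \prod_(y <- take j alphaxs) (1 - tP N t * y) * \prod_(y <- drop j alphaxs) (1 - y).

Lemma mpolyC_exp k : (t ^+ k)%:MP = t%:MP ^+ k :> A.
Proof. exact: rmorphXn. Qed.

Lemma trow_psi (f : word) p M q : (size p + M + size q = n)%N ->
  \sum_e trow t f e * (psi t basisw p M q e)%:P =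
  psi t%:MP (fun s => vrow (tP N t) st1 alphaxs s f : {poly A}) p M q.
Proof.
elim: M p => [|M IH] p sz /=.
  have szs : size (p ++ q) == n by rewrite size_cat; lia.
  rewrite (bigD1 (Tuple szs)) //= basisw_at eqxx mulr1 big1 ?addr0 // => e ne.
  have -> : basisw (p ++ q) e = 0; last by rewrite polyC0 mulr0.
  by rewrite basisw_at -[p ++ q]/(val (Tuple szs)) val_eqE (negPf ne).
rewrite -!IH ?size_rcons; try lia.
rewrite scaler_sumr -sumrB; apply: eq_bigr => e _.
rewrite addw_at -scaleNr scalew_at scaleNr polyCB mulrBr; congr (_ - _).
by rewrite -!mul_polyC -mul_mpolyC polyCM mpolyC_exp mulrCA.
Qed.

Lemma psi_at (f : word) p M q :
  (psi t basisw p M q f)%:P =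
  psi t%:MP (fun s => (val f == s)%:R : {poly A}) p M q.
Proof.
elim: M p => [|M IH] p /=; first by rewrite basisw_at rmorph_nat.
rewrite -!IH addw_at -scaleNr scalew_at scaleNr polyCB; congr (_ - _).
by rewrite -mul_polyC -mul_mpolyC polyCM mpolyC_exp.
Qed.

Lemma trow_eigvec (f : word) j : (j <= n)%N ->
  \sum_e trow t f e * (eigvec j e)%:P = eigval j * (eigvec j f)%:P.
Proof.
move=> jn; rewrite trow_psi ?size_nseq ?addn0 ?subnKC // psi_at.
have tE : tP N t = (t%:MP_[n])%:A by rewrite alg_polyC.
rewrite /eigval tE; apply: psi_row_ones.
  by rewrite size_alphaxs subnKC.
by rewrite size_alphaxs size_tuple.
Qed.

Lemma row_coef_eigvec j k : (j <= n)%N ->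
  actL (row_coef N t k) (eigvec j) = mulw (eigval j)`_k (eigvec j).
Proof.
move=> jn; apply/ffunP=> f; rewrite actLE mulw_at -coefMC -trow_eigvec //.
by rewrite coef_sum; apply: eq_bigr => e _; rewrite coefMC mxel_row_coef.
Qed.

Lemma conv_gpart j k : (j <= n)%N ->
  conv (\prod_(y <- take j alphaxs) (1 - y)) (gpart N t j) k =
  (\prod_(y <- take j alphaxs) (1 - tP N t * y))`_k.
Proof.
elim: j k => [|j IH] k jn.
  rewrite take0 !big_nil (eq_convl _ _ (v := fun i => (1 : {poly A})`_i)).
    by rewrite conv_coef mul1r.
  by move=> i; rewrite coef1.
have tk : take j.+1 alphaxs = rcons (take j alphaxs) (alphax R N j).
  rewrite (take_nth 0) ?size_alphaxs //; congr rcons.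
  rewrite (nth_map 0%N); last by rewrite size_iota.
  by rewrite nth_iota.
rewrite tk -cats1 !big_cat !big_seq1 /= convM.
rewrite (eq_convl _ _ (v := conv (1 - (t *: x j)%:P * 'X) (gpart N t j))); last first.
  by move=> i; apply: gpart_lin.
rewrite -convM mulrC convM.
have -> : 1 - tP N t * alphax R N j = 1 - (t *: x j)%:P * 'X.
  by rewrite mulrA -polyCM mul_mpolyC.
rewrite [in RHS]mulrC -conv_coef; apply: eq_convl => i.
exact: (IH i (ltnW jn)).
Qed.

(** The factors 1 - alpha x_i with i >= j occur both in [Qpoly] and in the eigenvalue of the row;
    they cancel, which is why only the first j variables survive. *)
Lemma conv_gpart_eigval j k : (j <= n)%N -> conv Q (gpart N t j) k = (eigval j)`_k.
Proof.
move=> jn; have QE : Q = \prod_(y <- drop j alphaxs) (1 - y) *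
    \prod_(y <- take j alphaxs) (1 - y).
  by rewrite mulrC -big_cat cat_take_drop.
rewrite QE convM /eigval mulrC -conv_coef; apply: eq_convl => i.
exact: conv_gpart.
Qed.

(** After multiplication by [Qpoly], both sides are the coefficients of the eigenvalue of the row;
    the constant term 1 of [Qpoly] permits cancellation. *)
Lemma transfer_eigvec j k : (j <= n)%N ->
  actL (transfer_coef n t k) (eigvec j) = mulw (gpart N t j k) (eigvec j).
Proof.
move=> jn; apply/ffunP=> f; rewrite mulw_at; move: k.
apply: (conv_uniq (Qpoly0 R N)) => k.
have -> : conv Q (fun k => gpart N t j k * eigvec j f) k =
    (eigval j)`_k * eigvec j f.
  by rewrite -conv_gpart_eigval // mulr_suml; apply: eq_bigr => i _; rewrite mulrA.
rewrite -mulw_at -row_coef_eigvec // actLE.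
rewrite /conv; under eq_bigr do rewrite actLE mulr_sumr.
rewrite exchange_big; apply: eq_bigr => e _ /=.
rewrite mxel_row_coef -conv_transfer mulr_suml.
by apply: eq_bigr => i _; rewrite mulrA.
Qed.

End Eigenvectors.

(** * Symmetrization and Hall-Littlewood polynomials *)

Lemma big_perm_first (M : nmodType) n (F : 'S_n.+1 -> M) :
  \sum_s F s = \sum_(k < n.+1) \sum_(u : 'S_n) F (lift_perm ord0 k u).
Proof.
rewrite (partition_big (fun s : 'S_n.+1 => s ord0) xpredT) //=.
apply: eq_bigr => k _.
rewrite (reindex (lift_perm ord0 k)) /=.
  by apply: eq_bigl => u; rewrite lift_perm_id eqxx.
pose g (s : 'S_n.+1) j := odflt j (unlift (s ord0) (s (lift ord0 j))).
have gK (s : 'S_n.+1) j : lift (s ord0) (g s j) = s (lift ord0 j).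
  have /unlift_some[j' E] : s ord0 != s (lift ord0 j).
    by rewrite (inj_eq perm_inj) neq_lift.
  by rewrite /g => ->.
have g_inj s : injective (g s).
  by move=> i j /(congr1 (lift (s ord0))); rewrite !gK => /perm_inj/lift_inj.
exists (fun s => perm (@g_inj s)) => [u _|s].
  by apply/permP=> j; rewrite permE /g lift_perm_id lift_perm_lift liftK.
rewrite inE => /eqP s0; apply/permP=> j.
case: (unliftP ord0 j) => [j'|] ->; last by rewrite lift_perm_id.
by rewrite lift_perm_lift -s0 permE gK.
Qed.

Section SymmetrizedOne.
Variables (K : fieldType) (t : K).

Definition qnum (i : nat) : K := (1 - t ^+ i) / (1 - t).

Lemma prod_lift n (F : 'I_n.+1 -> K) k :
  \prod_(j < n.+1 | j != k) F j = \prod_(j < n) F (lift k j).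
Proof.
rewrite big_mkcond (bigD1_ord k) //= eqxx mul1r.
by apply: eq_bigr => j _; rewrite eq_sym neq_lift.
Qed.

(* The polynomial prod_j (z - t x_j) - prod_j (z - x_j) has degree < n, so it
   is given by Lagrange interpolation at the x_i; evaluate at z = 0. *)
Lemma sum_prod_ratio n (x : 'I_n -> K) : t != 1 ->
  injective x -> (forall i, x i != 0) ->
  \sum_i \prod_(j | j != i) ((x i - t * x j) / (x i - x j)) = qnum n.
Proof.
move=> t1 x_inj x0.
pose p c : {poly K} := \prod_(j < n) ('X - (c * x j)%:P).
pose L i : {poly K} := \prod_(j < n | j != i) ((x i - x j)^-1 *: ('X - (x j)%:P)).
have xx i j : j != i -> x i - x j != 0.
  by rewrite subr_eq0 (inj_eq x_inj) eq_sym.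
have LE i k : (L i).[x k] = (i == k)%:R.
  rewrite /L horner_prod; have [->|ik] := eqVneq i k.
    rewrite big1 // => j jk; rewrite hornerZ hornerXsubC mulVf //.
    exact: xx.
  rewrite (bigD1 k) /=; last by rewrite eq_sym.
  by rewrite hornerZ hornerXsubC subrr mulr0 mul0r.
have pm c : p c \is monic by apply: monic_prod => j _; apply: monicXsubC.
have sp c : size (p c) = n.+1.
  by rewrite /p size_prod_XsubC /index_enum -enumT size_enum_ord.
pose d := p t - p 1.
have sd : (size d <= n)%N.
  apply/leq_sizeP => j nj; rewrite coefB; move: nj; rewrite leq_eqVlt.
  case/predU1P => [<-|nj]; last first.
    by rewrite !nth_default ?sp ?subrr.
  have lc c : (p c)`_n = 1.
    by have /monicP := pm c; rewrite /lead_coef sp.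
  by rewrite !lc subrr.
pose e := \sum_i d.[x i] *: L i.
have sL i : (size (L i) <= n)%N.
  have Ln0 : L i != 0.
    apply/eqP=> L0; have := LE i i.
    by rewrite L0 horner0 eqxx => /eqP; rewrite eq_sym oner_eq0.
  have LX : L i * ('X - (x i)%:P) = (\prod_(j < n | j != i) (x i - x j)^-1) *: p 1.
    rewrite /L scaler_prod -scalerAl; congr (_ *: _).
    rewrite /p [RHS](bigD1 i) //= [RHS]mulrC mul1r; congr (_ * _).
    by apply: eq_bigr => j _; rewrite mul1r.
  have := size_Mmonic Ln0 (monicXsubC (x i)); rewrite LX size_XsubC addn2 /= => E.
  by have := size_scale_leq (\prod_(j < n | j != i) (x i - x j)^-1) (p 1); rewrite sp E.
have de : d = e.
  apply/eqP; rewrite -subr_eq0; apply/negPn/negP => nz.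
  have rt : all (root (d - e)) [seq x i | i <- enum 'I_n].
    apply/allP=> _ /mapP[i _ ->]; rewrite /root hornerD hornerN horner_sum (bigD1 i) //=.
    rewrite hornerZ LE eqxx mulr1 big1 ?addr0 ?subrr // => j ji.
    by rewrite hornerZ LE (negPf ji) mulr0.
  have := max_poly_roots nz rt; rewrite map_inj_uniq // enum_uniq => /(_ isT).
  rewrite size_map size_enum_ord ltnNge => /negP; apply.
  apply: (leq_trans (size_polyD _ _)); rewrite size_polyN geq_max sd.
  apply: (leq_trans (size_sum _ _ _)); apply/bigmax_leqP => i _.
  exact: leq_trans (size_scale_leq _ _) (sL i).
pose X := \prod_(j < n) - x j.
have X0 : X != 0 by apply/prodf_neq0 => j _; rewrite oppr_eq0.
have pE c z : (p c).[z] = \prod_(j < n) (z - c * x j).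
  by rewrite horner_prod; apply: eq_bigr => j _; rewrite hornerXsubC.
have d0 : d.[0] = (t ^+ n - 1) * X.
  rewrite hornerD hornerN !pE mulrBl mul1r; congr (_ - _); last first.
    by apply: eq_bigr => j _; rewrite sub0r mul1r.
  rewrite -[n in t ^+ n]card_ord -prodr_const -big_split; apply: eq_bigr => j _.
  by rewrite /= sub0r mulrN.
have e0 : e.[0] = - ((1 - t) * X) *
    \sum_i \prod_(j | j != i) ((x i - t * x j) / (x i - x j)).
  rewrite horner_sum mulr_sumr; apply: eq_bigr => i _; rewrite hornerZ.
  rewrite hornerD hornerN !pE [in X in _ - X](bigD1 i) //= mul1r subrr mul0r subr0.
  rewrite /L horner_prod (bigD1 i) //= /X [in RHS](bigD1 i) //=.
  rewrite (_ : x i - t * x i = (1 - t) * x i); last by rewrite mulrBl mul1r.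
  have -> : \prod_(j < n | j != i) ((x i - x j)^-1 *: ('X - (x j)%:P)).[0] =
      \prod_(j < n | j != i) (x i - x j)^-1 * \prod_(j < n | j != i) - x j.
    by rewrite -big_split; apply: eq_bigr => j _; rewrite /= hornerZ hornerXsubC sub0r.
  by rewrite big_split /=; ring.
have t1' : 1 - t != 0 by rewrite subr_eq0 eq_sym.
apply: (mulfI (mulf_neq0 t1' X0)).
by rewrite -[LHS]opprK -mulNr -e0 -de d0 /qnum; field.
Qed.

(** Induction by the value of w at the first index: the pairs containing this index form the product
    in [sum_prod_ratio], and the other pairs give the same sum without that variable. *)
Lemma sum_perm_ratio n (x : 'I_n -> K) : t != 1 ->
  injective x -> (forall i, x i != 0) ->
  \sum_(w : 'S_n) \prod_(i < n) \prod_(j < n | (i < j)%N)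
    ((x (w i) - t * x (w j)) / (x (w i) - x (w j))) =
  \prod_(1 <= i < n.+1) qnum i.
Proof.
move=> t1; elim: n x => [|n IH] x x_inj x0.
  rewrite big_geq // (big_pred1 1%g) ?big_ord0 // => w.
  by rewrite /= [w]permS0 eqxx.
rewrite big_perm_first big_nat_recr //= mulrC -(sum_prod_ratio t1 x_inj x0) mulr_suml.
apply: eq_bigr => k _; rewrite -(IH (fun i => x (lift k i))) //; last first.
  by move=> i j /x_inj /lift_inj.
rewrite mulr_sumr; apply: eq_bigr => u _.
rewrite big_ord_recl; congr (_ * _).
  rewrite prod_lift lift_perm_id big_mkcond big_ord_recl /= mul1r.
  rewrite [RHS](reindex_inj (@perm_inj _ u)) /=.
  by apply: eq_bigr => j _; rewrite lift_perm_lift.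
apply: eq_bigr => i _; rewrite big_mkcond [RHS]big_mkcond big_ord_recl /= mul1r.
by apply: eq_bigr => j _; rewrite !lift_perm_lift /= ltnS.
Qed.

End SymmetrizedOne.

Section PairProducts.
Variables (K : comNzRingType) (N : nat).
Local Notation n := N.+1.
Local Notation adj := (adj N).

Lemma prod_pairs_adj i (G : 'I_n -> 'I_n -> K) : (i.+1 < n)%N ->
  let C := \prod_(u : 'I_n * 'I_n | (u.1 < u.2)%N && (u != (inord i, inord i.+1)))
    G u.1 u.2 in
  \prod_(p < n) \prod_(q < n | (p < q)%N) G p q = G (inord i) (inord i.+1) * C /\
  \prod_(p < n) \prod_(q < n | (p < q)%N) G (adj i p) (adj i q) =
    G (inord i.+1) (inord i) * C.
Proof.
move=> iN C; have iN' := ltnW iN.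
have Di : ((inord i : 'I_n) < (inord i.+1 : 'I_n))%N by rewrite !inordK.
split; rewrite pair_big_dep /= (bigD1 (inord i, inord i.+1)) //=.
rewrite adjL // adjR //; congr (_ * _).
have adjKK p : adj i (adj i p) = p by rewrite -permM adjK perm1.
pose s (u : 'I_n * 'I_n) := (adj i u.1, adj i u.2).
have sK : involutive s by case=> p q; rewrite /s /= !adjKK.
rewrite [RHS](reindex_inj (inv_inj sK)); apply: eq_big => [[p q]|//] /=.
have aE r : (adj i r : nat) =
    (if r == i :> nat then i.+1 else if r == i.+1 :> nat then i else r).
  rewrite -{1}(inord_val r) adjE // inordK //.
  by case: eqP => _ //; case: eqP => _; lia || exact: ltn_ord.
rewrite /s /= !xpair_eqE -!val_eqE /= !aE !inordK //.
by repeat case: eqP => //=; lia.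
Qed.

End PairProducts.

Section Symmetrization.
Variables (R : idomainType) (N : nat) (t : R) (K : fieldType).
Local Notation n := N.+1.
Local Notation A := {mpoly R[n]}.
Local Notation x := (xvar R N).
Local Notation adj := (adj N).
Local Notation tau := (@stau R N t).
Variable phi : {rmorphism A -> K}.
Hypothesis phi_inj : injective phi.

Let z (i : 'I_n) : K := phi 'X_i.
Let s : K := phi t%:MP.

Definition pratio (a b : K) : K := (a - s * b) / (a - b).
Definition Delta (w : 'S_n) : K :=
  \prod_(i < n) \prod_(j < n | (i < j)%N) pratio (z (w i)) (z (w j)).
(** For a monomial x^lambda this is v_lambda P_lambda, computed in a field where the denominators
    exist. *)
Definition Symm (f : A) : K := \sum_(w : 'S_n) phi (msym w f) * Delta w.

Lemma z_inj : injective z.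
Proof. by move=> i j /phi_inj /mpolyX_inj. Qed.

Lemma Symm_add f g : Symm (f + g) = Symm f + Symm g.
Proof.
rewrite -big_split; apply: eq_bigr => w _.
by rewrite msymD rmorphD mulrDl.
Qed.

Lemma Symm_scale c f : Symm (c *: f) = phi c%:MP * Symm f.
Proof.
rewrite mulr_sumr; apply: eq_bigr => w _.
by rewrite msymZ -mul_mpolyC rmorphM mulrA.
Qed.

Lemma Symm0 : Symm 0 = 0.
Proof. by rewrite /Symm big1 // => w _; rewrite msym0 rmorph0 mul0r. Qed.

Lemma Symm_mul_sym f g : f \is symmetric -> Symm (f * g) = phi f * Symm g.
Proof.
move=> /issymP fs; rewrite mulr_sumr; apply: eq_bigr => w _.
by rewrite msymM fs rmorphM mulrA.
Qed.

(** After reindexing by w -> s_i w, the weights [Delta w] and [Delta (adj i * w)] differ only in the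
    factor of the pair i, i + 1; with it the two coefficients of [msym w f] add up to [Delta w]. So
    the symmetrizer sees T_i as 1, and hence Tbar_i as t. *)
Lemma Symm_tau i f : (i.+1 < n)%N -> Symm (tau i f) = Symm f.
Proof.
move=> iN; have iN' := ltnW iN.
pose a (w : 'S_n) := z (w (inord i)); pose b (w : 'S_n) := z (w (inord i.+1)).
have ab w : a w - b w != 0.
  by rewrite subr_eq0 (inj_eq z_inj) (inj_eq perm_inj) inord_succ_neq.
have abE w : a w - b w = phi (msym w (x i - x i.+1)).
  by rewrite msymB !msymXU rmorphB.
have sE : phi (1 - t)%:MP = 1 - s by rewrite mpolyCB rmorphB /= mpolyC1 rmorph1.
have E w : phi (msym w (tau i f)) = phi (msym w f) * ((1 - s) * a w / (a w - b w))
    + phi (msym (adj i * w)%g f) * (1 - (1 - s) * a w / (a w - b w)).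
  have D : phi (msym w (dd i f)) =
      (phi (msym w f) - phi (msym (adj i * w)%g f)) / (a w - b w).
    apply: (canRL (mulfK (ab w))); rewrite mulrC abE -rmorphM -msymM ddP //.
    by rewrite msymB msymMm rmorphB.
  rewrite stauE msymD msymZ -mul_mpolyC msymM -msymMm.
  rewrite rmorphD !rmorphM /= sE D msymXU -/(z _) -/(a w).
  by field; apply: ab.
rewrite /Symm; under eq_bigr do rewrite E mulrDl.
rewrite big_split /=.
rewrite [X in _ + X](reindex_inj (mulgI (adj i))) /= -big_split /=.
apply: eq_bigr => w _; rewrite mulgA adjK mul1g.
have aE : a (adj i * w)%g = b w by rewrite /a permM adjL.
have bE : b (adj i * w)%g = a w by rewrite /b permM adjR.
rewrite aE bE.
have [D1 D2] := prod_pairs_adj (fun p q => pratio (z (w p)) (z (w q))) iN.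
have DE : Delta (adj i * w)%g =
    \prod_(p < n) \prod_(q < n | (p < q)%N) pratio (z (w (adj i p))) (z (w (adj i q))).
  by apply: eq_bigr => p _; apply: eq_bigr => q _; rewrite !permM.
rewrite DE D2 [Delta w]D1 -/(a w) -/(b w) /pratio.
have ba : b w - a w != 0 by rewrite -opprB oppr_eq0.
by field; rewrite ab ba.
Qed.

Lemma Symm_Tbar i f : (i.+1 < n)%N -> Symm (Tbar t tau i f) = s * Symm f.
Proof.
move=> iN; rewrite /Tbar -scaleN1r scalerA Symm_add Symm_tau // Symm_scale.
rewrite -[X in X + _]mul1r -mulrDl; congr (_ * _).
by rewrite mulN1r mpolyCN mpolyCB mpolyC1 rmorphN rmorphB rmorph1 opprB addrC subrK.
Qed.

Lemma Symm_carry i k f : (i + k < n)%N -> Symm (carry t tau i k f) = s ^+ k * Symm f.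
Proof.
elim: k => [|k IH] ik; first by rewrite mul1r.
by rewrite /= Symm_Tbar ?IH ?exprS ?mulrA //; lia.
Qed.

(** The Gaussian binomial coefficient, by the Pascal rule that follows the recursion of [shuffle]: a
    carry over k sites counts as t^k. *)
Fixpoint qbin (t : K) (r M : nat) {struct M} : K :=
  match r, M with
  | 0, _ => 1
  | _.+1, 0 => 0
  | r'.+1, M'.+1 => qbin t r M' + t ^+ (M' - r') * qbin t r' M'
  end.

Lemma Symm_shuffle r M f : (M <= n)%N ->
  Symm (shuffle t tau 0 r M f) = qbin s r M * Symm f.
Proof.
elim: M r f => [|M IH] [|r] f Mn; rewrite ?shuffle0 /= ?mul1r ?Symm0 ?mul0r //.
rewrite Symm_add !IH ?(ltnW Mn) // mulrDl; congr (_ + _).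
have [rM|Mr] := leqP r M.
  by rewrite Symm_carry ?mulrA 1?[qbin _ _ _ * _]mulrC //; lia.
have q0 u v : (v < u)%N -> qbin s u v = 0.
  elim: v u => [|v IHv] [|u] //= uv; rewrite !IHv ?mulr0 ?addr0 //; lia.
by rewrite q0 // mulr0 !mul0r.
Qed.

End Symmetrization.

(** * Gaussian binomials and q-factorials *)

Section QFactorials.
Variables (K : fieldType) (t : K).
Hypothesis t1 : t != 1.

Definition qfact (m : nat) : K := \prod_(1 <= i < m.+1) qnum t i.

Lemma qfactS m : qfact m.+1 = qfact m * qnum t m.+1.
Proof. by rewrite /qfact big_nat_recr. Qed.

Lemma qfact0 : qfact 0 = 1.
Proof. by rewrite /qfact big_geq. Qed.

Lemma qnumD a b : qnum t a + t ^+ a * qnum t b = qnum t (a + b).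
Proof. by rewrite /qnum mulrA -mulrDl mulrBr mulr1 addrA subrK exprD. Qed.

Lemma qbin_gt r M : (M < r)%N -> qbin t r M = 0.
Proof.
by elim: M r => [|M IH] [|r] //= Mr; rewrite !IH ?mulr0 ?addr0 //; lia.
Qed.

Lemma qbinE r M : (r <= M)%N -> qbin t r M * (qfact r * qfact (M - r)) = qfact M.
Proof.
elim: M r => [|M IH] [|r] //= rM; rewrite ?qfact0 ?mul1r ?subn0 //.
rewrite subSS mulrDl (qfactS r).
have E2 : t ^+ (M - r) * qbin t r M * (qfact r * qnum t r.+1 * qfact (M - r)) =
    qfact M * (t ^+ (M - r) * qnum t r.+1).
  rewrite -(IH r rM); ring.
rewrite E2; have [rM'|Mr] := ltnP r M; last first.
  rewrite qbin_gt // mul0r add0r qfactS; have -> : M = r by lia.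
  by rewrite subnn expr0 mul1r.
have E1 : qbin t r.+1 M * (qfact r * qnum t r.+1 * qfact (M - r)) =
    qfact M * qnum t (M - r).
  by rewrite -(IH r.+1 rM') -(subnSK rM') !qfactS; ring.
rewrite E1 -mulrDr qnumD qfactS; congr (_ * qnum t _); lia.
Qed.

Fixpoint cbin (c : seq nat) (j : nat) : K :=
  if c is r :: c' then qbin t r j * cbin c' r else 1.
(** Successive differences of column lengths are the multiplicities of the parts, zero included, so
    for the columns of lambda and j = n this product is v_lambda. *)
Fixpoint cfact (c : seq nat) (j : nat) : K :=
  if c is r :: c' then qfact (j - r) * cfact c' r else qfact j.

Lemma cbinE c j : path geq j c -> cbin c j * cfact c j = qfact j.
Proof.
elim: c j => [|r c IH] j /=; first by rewrite mul1r.
move=> /andP[rj pc]; rewrite -(qbinE rj) -(IH r pc); ring.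
Qed.

End QFactorials.

Section ColumnsSymmetric.
Variables (R : idomainType) (N : nat) (t : R).
Local Notation n := N.+1.
Local Notation A := {mpoly R[n]}.
Local Notation x := (xvar R N).
Local Notation adj := (adj N).
Local Notation tau := (@stau R N t).
Local Notation colpoly := (@colpoly R N t).
Local Notation xprod := (@xprod R N).
Local Notation xpref r := (xprod (fun i => i < r)%N).

Lemma xpref_sym i r : (i.+1 < n)%N -> (i.+1 < r)%N || (r <= i)%N ->
  msym (adj i) (xpref r) = xpref r.
Proof. by move=> iN ir; rewrite msym_xprod // bswap_id //; lia. Qed.

Lemma tau_sym i p : (i.+1 < n)%N -> msym (adj i) p = p -> tau i p = p.
Proof. by move=> iN E; rewrite stauE E dd_sym // mulr0 scaler0 addr0. Qed.

(** [shuffle_inv] applies to the polynomial under the shuffle: on the sites before r it is fixed by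
    induction, and from r on because it involves none of these variables. *)
Lemma tau_colpoly c i j : (i.+1 < j)%N -> (j <= n)%N ->
  tau i (colpoly c j) = colpoly c j.
Proof.
elim: c i j => [|r c IH] i j ij jn.
  by rewrite tau_sym ?msym1 //; lia.
have [rj|jr] := leqP r j; last by rewrite /= shuffle_gt // linear0.
rewrite -[colpoly (r :: c) j]/(shuffle t tau 0 r j (xpref r * colpoly c r)).
have H := @shuffle_inv R t A n tau (@tau_quad R N t) (@tau_braid R N t)
  (@tau_far R N t) 0 r j (xpref r * colpoly c r) rj jn.
apply: H => //.
  move=> l _ lr; have lN : (l.+1 < n)%N by lia.
  rewrite tau_mul_sym //; last by apply: xpref_sym => //; apply/orP; left; lia.
  by rewrite IH //; lia.
move=> l rl lj; have lN : (l.+1 < n)%N by lia.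
rewrite tau_sym // msymM xpref_sym //; last by apply/orP; right; lia.
by rewrite -(@ev_colpoly_ge _ _ _ _ r r) ?ev_msym_ge //; lia.
Qed.

(** Multiplied by x_i - x_(i+1), the equation says that (x_(i+1) - t x_i) (p - s_i p) vanishes. *)
Lemma tau_fixed_sym i (p : A) : (i.+1 < n)%N -> tau i p = p -> msym (adj i) p = p.
Proof.
move=> iN; rewrite stauE => E.
have nz : x i.+1 - t *: x i != 0.
  apply/eqP=> /(congr1 (mcoeff U_(inord i.+1))).
  rewrite mcoeffB mcoeffZ !mcoeffX mcoeff0 eqxx.
  have -> : (U_(inord i) == U_(inord i.+1) :> 'X_{1..n})%MM = false.
    apply/eqP=> /mnmP /(_ (inord i)); rewrite !mnm1E eqxx.
    by rewrite eq_sym (negPf (inord_succ_neq iN)).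
  by rewrite mulr0 subr0 => /eqP; rewrite oner_eq0.
apply/esym/subr0_eq; apply: (mulIf nz); rewrite mul0r.
have D := ddP p iN.
have : (x i - x i.+1) * (msym (adj i) p + (1 - t) *: (x i * dd i p)) =
  (x i - x i.+1) * p by rewrite E.
rewrite mulrDr -scalerAr mulrCA D; move: (msym _ p) => q.
rewrite -!mul_mpolyC mpolyCB mpolyC1 => /eqP; rewrite -subr_eq0 => /eqP H.
by rewrite -H; ring.
Qed.

Lemma adj_fixed_sym (p : A) :
  (forall i, (i.+1 < n)%N -> msym (adj i) p = p) -> p \is symmetric.
Proof.
move=> H.
have H1 i k : (i + k < n)%N -> msym (tperm (inord i) (inord (i + k))) p = p.
  elim: k => [|k IH] ik; first by rewrite addn0 tperm1 msym1m.
  case: k IH ik => [|k] IH ik; first by rewrite addn1; apply: H; lia.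
  have ikN : ((i + k.+1).+1 < n)%N by lia.
  have -> : tperm (inord i) (inord (i + k.+2)) =
      (tperm (inord i) (inord (i + k.+1)) ^ adj (i + k.+1))%g :> 'S_n.
    rewrite tpermJ adjL // adjD ?addnS //; lia.
  rewrite conjgE !msymMm tpermV -/(adj (i + k.+1)) H // IH; last by lia.
  by rewrite H.
apply/issymP=> w; have [ts -> _] := prod_tpermP w.
elim: ts => [|[u v] ts IH]; first by rewrite big_nil msym1m.
rewrite big_cons msymMm /=.
have -> : msym (tperm u v) p = p; last exact: IH.
have Huv (u' v' : 'I_n) : (u' <= v')%N -> msym (tperm u' v') p = p.
  move=> uv; have := H1 u' (v' - u')%N; rewrite subnKC // !inord_val; apply.
  exact: ltn_ord.
by case/orP: (leq_total u v) => uv; [|rewrite tpermC]; apply: Huv.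
Qed.

Lemma colpoly_sym c : colpoly c n \is symmetric.
Proof.
by apply: adj_fixed_sym => i iN; apply: tau_fixed_sym => //; apply: tau_colpoly.
Qed.

End ColumnsSymmetric.

Section SymmColumns.
Variables (R : idomainType) (N : nat) (t : R) (K : fieldType).
Local Notation n := N.+1.
Local Notation A := {mpoly R[n]}.
Local Notation adj := (adj N).
Local Notation tau := (@stau R N t).
Local Notation colpoly := (@colpoly R N t).
Local Notation xpref r := (@xprod R N (fun i => i < r)%N).
Variable phi : {rmorphism A -> K}.
Hypothesis phi_inj : injective phi.
Local Notation Symm := (@Symm R N t K phi).
Local Notation s := (phi t%:MP).

(** Symmetrization turns the shuffle of each column into a Gaussian binomial. [P] collects the
    column monomials already extracted; its symmetry in the first j variables lets it pass into the
    next shuffle. *)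
Lemma Symm_colpoly c j P : path geq j c -> (j <= n)%N ->
  (forall i, (i.+1 < j)%N -> msym (adj i) P = P) ->
  Symm (P * colpoly c j) = cbin s c j * Symm (P * \prod_(r <- c) xpref r).
Proof.
elim: c j P => [|r c IH] j P /=; first by rewrite big_nil mul1r.
move=> /andP[rj pc] jn PS.
have -> : P * shuffle t tau 0 r j (xpref r * colpoly c r) =
    shuffle t tau 0 r j (P * (xpref r * colpoly c r)).
  apply: (@map_shuffle _ _ _ _ tau tau (mulx P)) => i u _ ij.
  by rewrite /= /mulx tau_mul_sym ?PS //; lia.
rewrite Symm_shuffle // mulrA (IH r) //; first by rewrite big_cons !mulrA.
  by lia.
move=> i ir; rewrite msymM PS ?xpref_sym //; by rewrite ?ir; lia.
Qed.

Lemma Symm1 : s != 1 -> Symm 1 = qfact s n.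
Proof.
move=> s1; rewrite /qfact -(sum_perm_ratio (x := fun i => phi 'X_i)) //.
- by apply: eq_bigr => w _; rewrite msym1 rmorph1 mul1r.
- by move=> i j /phi_inj /mpolyX_inj.
move=> i; rewrite -(rmorph0 phi) (inj_eq phi_inj).
apply/eqP=> /(congr1 (mcoeff U_(i))); rewrite mcoeffX eqxx mcoeff0 => /eqP.
by rewrite oner_eq0.
Qed.

(** A symmetric polynomial comes out of its own symmetrization, leaving [Symm 1], which is the
    q-factorial of n. *)
Lemma colpoly_Symm c : path geq n c -> s != 1 ->
  phi (colpoly c n) * qfact s n = cbin s c n * Symm (\prod_(r <- c) xpref r).
Proof.
move=> pc s1; rewrite -Symm1 // -(Symm_mul_sym t phi 1 (colpoly_sym N t c)) mulr1.
by rewrite -[colpoly c n]mul1r Symm_colpoly // ?mul1r // => i _; rewrite msym1.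
Qed.

End SymmColumns.

(** * Conjugate partitions and the normalization v_lambda *)

Section ConjugatePartition.
Variables (n : nat) (la : seq nat).

(* Columns are numbered from 1; [col_len 0] is n. *)
Definition col_len (k : nat) : nat := #|[set i : 'I_n | k <= nth 0%N la i]%N|.
Definition conj_part : seq nat := mkseq (fun j => col_len j.+1) (head 0%N la).

Lemma col_len0 : col_len 0 = n.
Proof.
by rewrite /col_len (_ : [set i : 'I_n | _] = setT) ?cardsT ?card_ord.
Qed.

Lemma col_lenS k : (mult n la k + col_len k.+1 = col_len k)%N.
Proof.
rewrite /mult /col_len -cardsUI (_ : _ :&: _ = set0) ?cards0 ?addn0.
  by apply: eq_card => i; rewrite !inE [in RHS]leq_eqVlt eq_sym.
by apply/setP=> i; rewrite !inE; case: eqP => // ->; rewrite ltnn.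
Qed.

Hypothesis la_sorted : sorted geq la.

Lemma nth_sorted i j : (i <= j)%N -> (nth 0%N la j <= nth 0%N la i)%N.
Proof.
move=> ij; have [js|sj] := ltnP j (size la); last by rewrite nth_default.
have geq_trans : transitive geq by move=> a b c ab bc; apply: leq_trans bc ab.
have is' := leq_ltn_trans ij js.
by apply: (sorted_leq_nth geq_trans leqnn 0%N la_sorted).
Qed.

Lemma card_ord_ltn i : (i <= n)%N -> #|[set j : 'I_n | j < i]%N| = i.
Proof.
move=> im; rewrite -sum1_card (eq_bigl (fun j : 'I_n => (j < i)%N)); last first.
  by move=> j; rewrite inE.
by rewrite (big_ord_narrow im) sum1_card card_ord.
Qed.

Lemma col_lenE k (i : 'I_n) : (i < col_len k)%N = (k <= nth 0%N la i)%N.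
Proof.
have iN := ltn_ord i; rewrite /col_len; have [ki|ik] := leqP k (nth 0%N la i).
  rewrite -[X in (X <= _)%N](card_ord_ltn iN); apply: subset_leq_card.
  apply/subsetP=> j; rewrite !inE ltnS => ji; apply: leq_trans ki _.
  exact: nth_sorted.
apply/negbTE; rewrite -leqNgt -[X in (_ <= X)%N](card_ord_ltn (ltnW iN)).
apply: subset_leq_card; apply/subsetP=> j; rewrite !inE => kj.
by rewrite ltnNge; apply/negP=> /nth_sorted; lia.
Qed.

Lemma nth_head i : (nth 0%N la i <= head 0%N la)%N.
Proof. by rewrite -nth0; apply: nth_sorted. Qed.

Lemma col_len_head : col_len (head 0%N la).+1 = 0%N.
Proof.
apply/eqP; rewrite cards_eq0; apply/eqP/setP=> i; rewrite !inE.
by rewrite ltnNge nth_head.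
Qed.

Lemma path_col_len a m :
  path geq (col_len a) (mkseq (fun j => col_len (a + j).+1) m).
Proof.
elim: m a => //= m IH a; rewrite addn0 -[X in (_ <= X)%N](col_lenS a) leq_addl /=.
rewrite (_ : map _ _ = mkseq (fun j => col_len (a.+1 + j).+1) m) ?IH //.
by rewrite (iotaDl 1 0) -map_comp; apply: eq_map => j /=; rewrite addnA addn1.
Qed.

Lemma path_conj_part : path geq n conj_part.
Proof. by have := path_col_len 0 (head 0%N la); rewrite col_len0. Qed.

Lemma cfact_col_len (K : fieldType) (t : K) a m :
  cfact t (mkseq (fun j => col_len (a + j).+1) m) (col_len a) =
  (\prod_(k < m) qfact t (mult n la (a + k))) * qfact t (col_len (a + m)).
Proof.
elim: m a => [|m IH] a; first by rewrite big_ord0 mul1r addn0.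
rewrite big_ord_recl /= !addn0 -[X in (X - _)%N](col_lenS a) addnK -mulrA.
rewrite (_ : map _ _ = mkseq (fun j => col_len (a.+1 + j).+1) m); last first.
  by rewrite (iotaDl 1 0) -map_comp; apply: eq_map => j /=; rewrite addnA addn1.
rewrite IH addSnnS; congr (_ * (_ * _)); apply: eq_bigr => k _.
by rewrite addSnnS.
Qed.

Lemma HL_vE (R : fieldType) (t : R) : HL_v n t la = cfact t conj_part n.
Proof.
have := cfact_col_len t 0 (head 0%N la); rewrite col_len0 => ->.
rewrite /HL_v big_mkord big_ord_recr /= add0n; congr (_ * qfact _ _).
by rewrite -(col_lenS (head 0%N la)) col_len_head addn0.
Qed.

End ConjugatePartition.

Lemma conj_part_row n k : conj_part n.+1 [:: k] = nseq k 1%N.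
Proof.
apply: (@eq_from_nth _ 0%N) => [|j]; rewrite size_mkseq ?size_nseq // => jk.
rewrite nth_mkseq // nth_nseq jk /col_len.
rewrite (_ : [set _ | _] = [set ord0]) ?cards1 //.
by apply/setP=> i; rewrite !inE; case: (unliftP ord0 i) => [i'|] -> /=;
   rewrite ?nth_nil // ?eqxx ?jk // eq_sym; apply/esym/negbTE/neq_lift.
Qed.

Lemma solve_ratio (K : fieldType) (b c q p u : K) :
  q != 0 -> b * c = q -> p * q = b * u -> c^-1 * u = p.
Proof.
move=> q0 bc H; move: q0; rewrite -bc mulf_eq0 negb_or => /andP[b0 c0].
apply: (mulfI (mulf_neq0 b0 c0)); rewrite [RHS]mulrC bc H -bc.
by field.
Qed.

(** * Column polynomials are Hall-Littlewood polynomials *)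

Section HallLittlewood.
Variables (R : numFieldType) (N : nat) (t : R).
Hypotheses (t_ge0 : 0 <= t) (t_lt1 : t < 1).
Local Notation n := N.+1.
Local Notation A := {mpoly R[n]}.
Local Notation x := (xvar R N).

Lemma qnum_neq0 i : (0 < i)%N -> qnum t i != 0.
Proof.
move=> i0; have d k : (0 < k)%N -> 1 - t ^+ k != 0.
  by move=> k0; rewrite gt_eqF // subr_gt0 exprn_ilt1 // -lt0n.
by rewrite /qnum mulf_neq0 ?invr_eq0 ?d // -[t]expr1 d.
Qed.

Lemma qfact_neq0 m : qfact t m != 0.
Proof.
elim: m => [|m IH]; first by rewrite qfact0 oner_neq0.
by rewrite qfactS mulf_neq0 ?qnum_neq0.
Qed.

Lemma prod_xpref la : sorted geq la -> (size la <= n)%N ->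
  \prod_(r <- conj_part n la) xprod R N (fun i => i < r)%N =
  \prod_(i < n) 'X_i ^+ nth 0%N la i.
Proof.
move=> las lan; rewrite big_map.
have -> : \prod_(j <- iota 0 (head 0%N la)) xprod R N (fun i => i < col_len n la j.+1)%N
    = \prod_(0 <= j < head 0%N la) \prod_(i < n | (j < nth 0%N la i)%N) ('X_i : A).
  rewrite /index_iota subn0; apply: eq_bigr => j _.
  by apply: eq_big => [i|i _]; [rewrite col_lenE | rewrite /xvar inord_val].
rewrite (exchange_big_dep xpredT) //=; apply: eq_bigr => i _.
have -> : 'X_i ^+ nth 0%N la i = \prod_(0 <= j < nth 0%N la i) ('X_i : A).
  by rewrite prodr_const_nat subn0.
by rewrite (big_nat_widen _ _ _ _ _ (nth_head las i)).
Qed.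

(** Both sides are multiples of the symmetrization of x^lambda. The constants agree because the
    product of Gaussian binomials along the columns times v_lambda is the q-factorial of n, which is
    nonzero for 0 <= t < 1. *)
Lemma HL_colpoly la : is_partition la -> (size la <= n)%N ->
  sympoly_val (HL n t la) = colpoly N t (conj_part n la) n.
Proof.
move=> /andP[las _] lan; apply: tofrac_injective; rewrite HLE //.
set phi := (@FracField.tofrac A).
pose phiR : {rmorphism A -> {fraction A}} := phi.
have phi_inj : injective phiR by apply: tofrac_injective.
have t1 : t != 1 by rewrite lt_eqF.
pose psi : {rmorphism R -> {fraction A}} := phiR \o @mpolyC n R.
have s1 : psi t != 1 by rewrite fmorph_eq1.
have qnE i : qnum (psi t) i = psi (qnum t i).
  by rewrite /qnum fmorph_div !rmorphB rmorphXn rmorph1.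
have qfE m : qfact (psi t) m = psi (qfact t m).
  by rewrite /qfact rmorph_prod; apply: eq_bigr => i _; apply: qnE.
have cfE c j : cfact (psi t) c j = psi (cfact t c j).
  by elim: c j => [|r c IH] j /=; rewrite ?rmorphM ?qfE ?IH.
have pc := path_conj_part n la.
have H := colpoly_Symm phi_inj pc s1.
have C := cbinE s1 pc.
have q0 : qfact (psi t) n != 0 by rewrite qfE fmorph_eq0 qfact_neq0.
have HE : HL_frac n t la = (cfact (psi t) (conj_part n la) n)^-1 *
    Symm t phiR (\prod_(i < n) 'X_i ^+ nth 0%N la i).
  rewrite /HL_frac; apply: (congr2 (fun a b => a^-1 * b)).
    by apply: etrans (esym (cfE _ _)); apply: (congr1 psi); apply: HL_vE.
  apply: eq_bigr => w _; apply: (congr2 *%R).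
    rewrite rmorph_prod (rmorph_prod phiR); apply: eq_bigr => i _.
    rewrite rmorphXn (rmorphXn phiR); apply: (congr1 (fun a => a ^+ _)).
    by rewrite /= msymXU.
  by apply: eq_bigr => i _; apply: eq_bigr => j _.
have E := congr1 (Symm t phiR) (prod_xpref las lan).
exact: etrans HE (etrans (congr1 (fun u => _^-1 * u) (esym E)) (solve_ratio q0 C H)).
Qed.

End HallLittlewood.

(** * The representation of symmetric polynomials *)

Section ElementarySymmetric.
Variables (R : idomainType) (N : nat) (t : R).
Local Notation n := N.+1.
Local Notation A := {mpoly R[n]}.

Lemma coef_prod_mesym (c : A) k :
  (\prod_(i < n) (1 - (c * 'X_i)%:P * 'X))`_k = (- c) ^+ k * mesym n R k.
Proof.
have -> : \prod_(i < n) (1 - (c * 'X_i)%:P * 'X) =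
    \sum_(J : {set 'I_n}) (\prod_(i in J) (- c * 'X_i))%:P * 'X^#|J| :> {poly A}.
  under eq_bigr do rewrite addrC.
  rewrite bigA_distr; apply: eq_big => [J|J _]; first by rewrite inE.
  rewrite -big_mkcond /= rmorph_prod -prodr_const -big_split /=.
  by apply: eq_bigr => i _; rewrite mulNr polyCN mulNr.
rewrite coef_sum (bigID (fun J : {set 'I_n} => #|J| == k)) /= addrC big1 => [|J Jk].
  rewrite add0r mulr_sumr; apply: eq_bigr => J /eqP Jk.
  by rewrite coefCM coefXn Jk eqxx mulr1 big_split prodr_const Jk.
by rewrite coefCM coefXn eq_sym (negPf Jk) mulr0.
Qed.

Lemma coef_Qpoly k : (Qpoly R N)`_k = (-1) ^+ k * mesym n R k.
Proof.
rewrite QpolyE -coef_prod_mesym; congr (polyseq _)`_k.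
by apply: eq_bigr => i _; rewrite nth_alphaxs mul1r.
Qed.

(** The coefficient of alpha^k in E(-alpha) G(alpha) = E(-t alpha), for the generating functions E
    of the elementary and G of the one-row polynomials, solved for the terms with e_k. *)
Lemma mesym_gpart k : (0 < k)%N -> ((-1) ^+ k * (t ^+ k - 1)) *: mesym n R k =
  \sum_(i < k) (-1) ^+ i *: (mesym n R i * gpart N t n (k - i)%N).
Proof.
move=> k0; have H := @conv_gpart R N t n k (leqnn n).
rewrite !take_oversize ?size_alphaxs // in H.
have E : (\prod_(y <- alphaxs R N) (1 - tP N t * y))`_k = (- t) ^+ k *: mesym n R k.
  rewrite -mul_mpolyC rmorphXn rmorphN /= -coef_prod_mesym.
  congr (polyseq _)`_k; rewrite (big_nth 0) size_alphaxs big_mkord.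
  by apply: eq_bigr => i _; rewrite nth_alphaxs mulrA -polyCM.
have convS : conv (Qpoly R N) (gpart N t n) k =
    \sum_(i < k) (Qpoly R N)`_i * gpart N t n (k - i)%N + (Qpoly R N)`_k.
  by rewrite /conv big_ord_recr subnn gpart0 mulr1.
have {}H := etrans (esym convS) (etrans H E).
have S : \sum_(i < k) (Qpoly R N)`_i * gpart N t n (k - i)%N =
    \sum_(i < k) (-1) ^+ i *: (mesym n R i * gpart N t n (k - i)%N).
  apply: eq_bigr => i _; rewrite coef_Qpoly -mulrA -mul_mpolyC.
  by rewrite rmorphXn rmorphN rmorph1.
rewrite S coef_Qpoly in H; apply/esym; rewrite -[LHS](addrK ((-1) ^+ k * mesym n R k)) H.
rewrite -[- t]mulN1r exprMn mulrBr mulr1 scalerBl; congr (_ - _).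
by rewrite -mul_mpolyC rmorphXn rmorphN rmorph1.
Qed.

End ElementarySymmetric.

Section Representation.
Variables (R : numFieldType) (N : nat) (t : R).
Hypotheses (t_ge0 : 0 <= t) (t_lt1 : t < 1).
Local Notation n := N.+1.
Local Notation A := {mpoly R[n]}.
Variable Theta : {rmorphism sympoly R n -> operator A n}.
Hypothesis ThetaZ : forall (c : R) (f : sympoly R n),
  Theta (c *: f) = c%:MP_[n] *: Theta f.
Hypothesis Theta_g : forall k : nat, (1 <= k <= n)%N ->
  Theta (HL_g n t k) = transfer_coef n t k.

(** These two properties determine the operator, because sorted words are shuffles of the
    eigenvectors and all words come from sorted ones by the T_i. *)
Definition spectral (f : sympoly R n) : Prop :=
  commutesH t (Theta f) /\
  forall j, (j <= n)%N ->
    actL (Theta f) (eigvec N t j) = mulw (evL R N j (sympoly_val f)) (eigvec N t j).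

Lemma spectralD f g : spectral f -> spectral g -> spectral (f + g).
Proof.
move=> [cf ef] [cg eg]; split; first by rewrite rmorphD; apply: commutesHD.
by move=> j jn; rewrite rmorphD actLD ef // eg // -mulwDl -rmorphD.
Qed.

Lemma spectralM f g : spectral f -> spectral g -> spectral (f * g).
Proof.
move=> [cf ef] [cg eg]; split; first by rewrite rmorphM; apply: commutesHM.
by move=> j jn; rewrite rmorphM actLM eg // act_mulw ef // mulwA mulrC -rmorphM.
Qed.

Lemma spectralZ c f : spectral f -> spectral (c *: f).
Proof.
move=> [cf ef]; split.
  by rewrite ThetaZ; apply: commutesHZ => // i _; rewrite msymC.
move=> j jn; have vZ : sympoly_val (c *: f) = c *: sympoly_val f by [].
rewrite ThetaZ actLZ ef // mulwA vZ.
by rewrite -mul_mpolyC rmorphM /= evC.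
Qed.

Lemma spectral1 : spectral 1.
Proof.
split; first by rewrite rmorph1; apply: commutesH1.
by move=> j jn; rewrite rmorph1 actL1 rmorph1 mulw1.
Qed.

Lemma spectral_g k : (1 <= k <= n)%N -> spectral (HL_g n t k).
Proof.
move=> kn; split; first by rewrite Theta_g //; apply: commutesH_transfer.
move=> j jn; rewrite Theta_g // transfer_eigvec //; congr (mulw _ _).
have k1 : is_partition [:: k] by rewrite /is_partition /= inE; lia.
rewrite -[sympoly_val _]/((1 - t) *: sympoly_val (HL n t [:: k])).
rewrite (HL_colpoly t_ge0 t_lt1 k1) // conj_part_row.
case: k kn k1 => [//|k] kn k1.
have evZ (p : A) : evL R N j ((1 - t) *: p) = (1 - t) *: evL R N j p.
  by rewrite linearZ.
by rewrite evZ ev_colpoly // -gpart_colpoly.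
Qed.

Lemma val_g k : (0 < k)%N -> sympoly_val (HL_g n t k) = gpart N t n k.
Proof.
case: k => [//|k] _; rewrite gpart_colpoly.
have k1 : is_partition [:: k.+1] by [].
rewrite -[LHS]/((1 - t) *: sympoly_val (HL n t [:: k.+1])).
by rewrite (HL_colpoly t_ge0 t_lt1 k1) // conj_part_row.
Qed.

(** Phrased for bare polynomials, so that the fundamental theorem on symmetric polynomials can be
    followed by an induction on an arbitrary polynomial in e_1, ..., e_n. *)
Definition spectral_poly (p : A) : Prop :=
  exists2 f : sympoly R n, sympoly_val f = p & spectral f.

Lemma spectral_polyD p q : spectral_poly p -> spectral_poly q -> spectral_poly (p + q).
Proof. by move=> [f <- sf] [g <- sg]; exists (f + g); last apply: spectralD. Qed.

Lemma spectral_polyM p q : spectral_poly p -> spectral_poly q -> spectral_poly (p * q).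
Proof. by move=> [f <- sf] [g <- sg]; exists (f * g); last apply: spectralM. Qed.

Lemma spectral_polyZ c p : spectral_poly p -> spectral_poly (c *: p).
Proof. by move=> [f <- sf]; exists (c *: f); last apply: spectralZ. Qed.

Lemma spectral_poly1 : spectral_poly 1.
Proof. by exists 1 => //; apply: spectral1. Qed.

Lemma spectral_poly0 : spectral_poly 0.
Proof. by rewrite -(scale0r (1 : A)); apply/spectral_polyZ/spectral_poly1. Qed.

(** The hypothesis on Theta concerns the g_k, whereas the fundamental theorem provides the e_k. As
    t^k - 1 is nonzero for k > 0, [mesym_gpart] expresses e_k by smaller ones and g_1, ..., g_k. *)
Lemma spectral_mesym k : (k <= n)%N -> spectral_poly (mesym n R k).
Proof.
elim/ltn_ind: k => [[|k]] IH kn; first by rewrite mesym0E; apply: spectral_poly1.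
have c0 : (-1) ^+ k.+1 * (t ^+ k.+1 - 1) != 0.
  rewrite mulf_neq0 ?signr_eq0 // lt_eqF // subr_lt0 exprn_ilt1 //.
rewrite -[mesym n R k.+1](scalerK c0) mesym_gpart //; apply: spectral_polyZ.
apply: (big_ind spectral_poly spectral_poly0 spectral_polyD) => i _; have ik := ltn_ord i.
apply/spectral_polyZ/spectral_polyM; first by apply: IH; lia.
rewrite -val_g; last by lia.
by exists (HL_g n t (k.+1 - i)%N) => //; apply: spectral_g; lia.
Qed.

Lemma spectral_all f : spectral f.
Proof.
have fs : sympoly_val f \is symmetric by case: f.
have [p [pE _]] := sym_fundamental fs.
suff [g gE sg] : spectral_poly (sympoly_val f) by have -> : f = g by apply: val_inj.
rewrite -pE; elim/mpoly_alg_ind: p {pE} => [c|i|p q sp sq|p q sp sq].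
- by rewrite comp_mpolyC -[c%:MP]mulr1 mul_mpolyC; apply/spectral_polyZ/spectral_poly1.
- by rewrite comp_mpolyXU -tnth_nth tnth_mktuple; apply: spectral_mesym.
- by rewrite raddfD; apply: spectral_polyD.
by rewrite rmorphM; apply: spectral_polyM.
Qed.

End Representation.

(** * Positivity of the matrix elements *)

Section Mix.
Variables (R : numDomainType) (N : nat) (t : R).
Hypotheses (t_ge0 : 0 <= t) (t_le1 : t <= 1).
Local Notation n := N.+1.
Local Notation A := {mpoly R[n]}.
Local Notation word := (n.-tuple state).
Local Notation W := {ffun word -> A}.
Local Notation adj := (adj N).
Local Notation T := (@hecke R N t).
Local Notation tau := (@stau R N t).
Local Notation basisw := (basisw R N).
Local Notation S := (shuffle t T).
Local Notation Tpos := (@Tpos R N t).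
Local Notation Raised := (@Raised R N t).
Local Notation psiw := (psi t basisw).

Lemma hecke_basisw i p a b q : size p = i -> (size p + (size q).+2 = n)%N ->
  T i (basisw (p ++ a :: b :: q)) =
  match a, b with
  | st1, st2 => basisw (p ++ st2 :: st1 :: q)
  | st2, st1 => t *: basisw (p ++ st1 :: st2 :: q)
                + (1 - t) *: basisw (p ++ st2 :: st1 :: q)
  | _, _ => basisw (p ++ a :: b :: q)
  end.
Proof. exact: Hecke_basisw. Qed.

Lemma hecke_psi_ones i j M q : (i.+1 < j)%N -> (j + M + size q = n)%N ->
  T i (psiw (nseq j st1) M q) = psiw (nseq j st1) M q.
Proof.
move=> ij sz.
have -> : nseq j st1 = nseq i st1 ++ st1 :: st1 :: nseq (j - i.+2) st1.
  by rewrite -[st1 :: _]/(nseq (j - i.+2).+2 st1) -nseqD; congr nseq; lia.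
have := @T_psi _ _ _ _ _ _ hecke_basisw (nseq i st1) st1 st1 (nseq (j - i.+2) st1) M q.
by rewrite !size_nseq; apply; lia.
Qed.

Lemma shuffle_mulw_sym o r M p (v : W) : (o + M <= n)%N ->
  (forall i, (o <= i)%N -> (i.+1 < n)%N -> msym (adj i) p = p) ->
  S o r M (mulw p v) = mulw p (S o r M v).
Proof.
move=> oM ps; apply/esym.
pose mp : {linear W -> W} := mulw p.
apply: (@map_shuffle _ _ _ _ T T mp) => i u oi iM.
by rewrite -[mp (T i u)]/(mulw p (T i u)) -[mp u]/(mulw p u) hecke_mulw_sym ?ps //; lia.
Qed.

Lemma psi_resolution_mulw m k p : (m + k = n)%N ->
  (forall i, (m <= i)%N -> (i.+1 < n)%N -> msym (adj i) p = p) ->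
  \sum_(j < k.+1) S m j k (mulw p (psiw (nseq (m + j) st1) (k - j) [::])) =
  mulw p (basisw (nseq m st1 ++ nseq k st2)).
Proof.
move=> mk ps.
have := @psi_resolution _ _ _ _ _ _ hecke_basisw m k [::].
rewrite addn0 cats0 => /(_ mk) <-.
rewrite (linear_sum (mulw p)); apply: eq_bigr => j _.
by apply: shuffle_mulw_sym => //; rewrite mk.
Qed.

Lemma foldr_Tbar_mulw o l p (u : W) :
  (forall i, (o <= i < o + l)%N -> (i.+1 < n)%N /\ T i u = u) ->
  foldr (Tbar t T) (mulw p u) (iota o l) = mulw (foldr (Tbar t tau) p (iota o l)) u.
Proof.
elim: l o => //= l IH o Tu.
rewrite IH => [|i oi]; last by apply: Tu; lia.
have [oN Tou] := Tu o ltac:(lia).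
rewrite -!mulvE; apply/esym; apply: (@map_Tbar _ _ _ _ _ _ (mulv u)).
by rewrite hecke_mulv.
Qed.

Lemma foldr_Tbar_far o l i (p : A) : (o + l < i)%N -> (i.+1 < n)%N ->
  tau i (foldr (Tbar t tau) p (iota o l)) = foldr (Tbar t tau) (tau i p) (iota o l).
Proof.
elim: l o => //= l IH o ol iN.
by rewrite (far_Tbar t (@tau_far R N t)) ?IH //; lia.
Qed.

(* Tb_o (Tb_(o+1) ( ... Tb_(o+q-1) w)) shifts the pattern of variables by one. *)
Lemma Raised_foldr r o q k b w : Raised r k b w -> (o + q < n)%N ->
  (forall j, (o <= j < o + q)%N -> b j) -> ~~ b (o + q)%N ->
  exists k' b', [/\ Raised r k' b' (foldr (Tbar t T) w (iota o q)), ~~ b' o,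
    forall j, (o < j <= o + q)%N -> b' j &
    forall j, (o + q < j)%N || (j < o)%N -> b' j = b j].
Proof.
move=> Z; elim: q o => [|q IH] o oq b1 b0.
  by exists k, b; split=> // [|j]; [rewrite addn0 in b0 | lia].
have [|||k' [b' [Z' b0' b1' b2']]] := IH o.+1.
- by lia.
- by move=> j ij; apply: b1; lia.
- by rewrite addSnnS.
have bo : b' o by rewrite b2' ?b1 //; lia.
exists k'.+1, (bswap o b'); split=> [||j oj|j oj] /=.
- by apply: raised_step => //; lia.
- by rewrite bswapL.
- have [->|jo] := eqVneq j o.+1; first by rewrite bswapR.
  by rewrite bswapN ?b1' //; lia.
by rewrite bswapN ?b2' //; lia.
Qed.

(* The left recursion for shuffles splits off the first of the m letters; for
   m = 0 the double shuffle is reassociated and the inner sum resolved. *)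
Lemma mix_pos m o k q r G : (o + m + k = n)%N ->
  (forall i, (o + q <= i)%N -> (i.+1 < n)%N -> msym (adj i) G = G) ->
  (forall l, (l <= k)%N -> (q <= m + l)%N -> exists kb b,
    [/\ Raised r kb b (mulw G (basisw (nseq (o + m + l) st1 ++ nseq (k - l) st2))),
        forall j, (o <= j < o + q)%N -> b j &
        forall j, (o + q <= j < n)%N -> ~~ b j]) ->
  Tpos (\sum_(j < k.+1) S (o + m) j k (S o q (m + j)
    (mulw G (psiw (nseq (o + m + j) st1) (k - j) [::])))).
Proof.
elim: m o q G => [|m IH] o q G omk Gs GZ.
  rewrite addn0 in omk *.
  (* If q exceeds k, it exceeds every j as well, and all inner shuffles are empty. *)
  have [kq|qk] := ltnP k q.
    rewrite big1 => [|j _]; first exact: Tpos0.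
    rewrite [X in S o j k X]shuffle_gt ?linear0 //; have := ltn_ord j; lia.
  have -> : \sum_(j < k.+1) S o j k (S o q (0 + j)
      (mulw G (psiw (nseq (o + j) st1) (k - j) [::]))) =
    S o q k (mulw G (basisw (nseq (o + q) st1 ++ nseq (k - q) st2))).
    (* The resolution is read backwards on the sites from o + q on, where G is symmetric; [shuffleA]
       then matches the terms with j = q + i, and those with j < q are empty. *)
    rewrite -psi_resolution_mulw; try lia; last by move=> i oi iN; apply: Gs.
    have linS (I : finType) (F : I -> W) : S o q k (\sum_i F i) = \sum_i S o q k (F i).
      exact: linear_sum.
    pose f j := S o j k (S o q j (mulw G (psiw (nseq (o + j) st1) (k - j) [::]))).
    rewrite linS (eq_bigr (fun j : 'I_k.+1 => f j)) // -(big_mkord xpredT f).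
    rewrite (big_cat_nat (n := q)) //=; last by lia.
    rewrite big_nat big1 ?add0r => [|j /andP[_ jq]]; last first.
      by rewrite /f [X in S o j k X]shuffle_gt ?linear0.
    rewrite -{1}[q]add0n big_addn subSn // big_mkord.
    apply: eq_bigr => i _; have ik := ltn_ord i; rewrite /f.
    rewrite (shuffleA (@hecke_quad R N t) (@hecke_braid R N t) (@hecke_far R N t));
      try lia.
    by rewrite addnK subnDA -subnDA [(i + q)%N]addnC subnDA addnA.
  have [||kb [b [Z b1 b0]]] := GZ q; try lia.
  rewrite addn0 in Z.
  apply: (Raised_shuffle t_ge0 t_le1 Z) => [|j ij|j ij].
  - by rewrite omk.
  - exact: b1.
  by apply: b0; lia.
case: q => [|q] in Gs GZ *.
  under eq_bigr do rewrite shuffle0.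
  (* With q = 0 the inner shuffles are trivial, and the sum is the resolution of a sorted word at
     once. *)
  rewrite psi_resolution_mulw //; last by move=> i oi iN; apply: Gs; lia.
  have [||kb [b [Z b1 b0]]] := GZ 0%N; try lia.
  rewrite addn0 subn0 in Z.
  by have := @Raised_shuffle R N t t_ge0 t_le1 r 0 0 0 kb b _ Z; apply => // j; lia.
(* If site o receives no variable, the q + 1 variable sites shift to the right by one. The vector
   behind G begins with enough ones to be fixed by the T_i involved, so the Tbar act on G alone. *)
pose G' := foldr (Tbar t tau) G (iota o q.+1).
pose v j := mulw G (psiw (nseq (o + m.+1 + j) st1) (k - j) [::]).
pose v' j := mulw G' (psiw (nseq (o + m.+1 + j) st1) (k - j) [::]).
have step (j : 'I_k.+1) : S o q.+1 (m.+1 + j) (v j) =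
    S o.+1 q (m + j) (v j) + S o.+1 q.+1 (m + j) (v' j).
  have jk := ltn_ord j; rewrite addSn (shuffle_left t (@hecke_far R N t)); last by lia.
  congr (_ + _); have [qm|mq] := ltnP q (m + j); last by rewrite !shuffle_gt //; lia.
  congr (S _ _ _ _); rewrite /v /v' /G'.
  apply: foldr_Tbar_mulw => i oi; split; first by lia.
  by apply: hecke_psi_ones => /=; lia.
rewrite (eq_bigr _ (fun (j : 'I_k.+1) _ => congr1 (S (o + m.+1) j k) (step j))).
have linS j (u w : W) : S (o + m.+1) j k (u + w) = S (o + m.+1) j k u + S (o + m.+1) j k w.
  exact: linearD.
rewrite (eq_bigr _ (fun (j : 'I_k.+1) _ => linS j _ _)) big_split /=.
rewrite /v /v' -addSnnS; apply: TposD.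
  apply: IH => [|i oi iN|l lk ql]; first by lia.
    by apply: Gs; lia.
  have [||kb [b [Z b1 b0]]] := GZ l; try lia.
  by exists kb, b; rewrite addSnnS; split=> // j ij; [apply: b1 | apply: b0]; lia.
apply: IH => [|i oi iN|l lk ql]; first by lia.
  (* Symmetry of G' is proved through T_i, which commutes with the Tbar that built G', whose indices
     are all too far to the left. *)
  apply: (tau_fixed_sym (t := t) iN).
  have Gi : tau i G = G by apply: (tau_sym _ iN); apply: Gs; lia.
  have oqi : (o + q.+1 < i)%N by lia.
  apply: (etrans (foldr_Tbar_far G oqi iN)).
  exact: (congr1 (fun p => foldr (Tbar t tau) p (iota o q.+1)) Gi).
have [||kb [b [Z b1 b0]]] := GZ l; try lia.
have [|||k' [b' [Z' _ b1' b2']]] := @Raised_foldr r o q.+1 _ b _ Z.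
- by lia.
- exact: b1.
- by apply: b0; lia.
exists k', b'; split.
- rewrite addSnnS /G' -foldr_Tbar_mulw // => i oi; split; first by lia.
  by apply: hecke_ones; rewrite ?size_nseq; lia.
- by move=> j ij; apply: b1'; lia.
by move=> j ij; rewrite b2' ?b0 //; lia.
Qed.

End Mix.

Section OperatorPositivity.
Variables (R : numDomainType) (N : nat) (t : R).
Hypotheses (t_ge0 : 0 <= t) (t_le1 : t <= 1).
Local Notation n := N.+1.
Local Notation A := {mpoly R[n]}.
Local Notation W := {ffun n.-tuple state -> A}.
Local Notation T := (@hecke R N t).
Local Notation S := (shuffle t T).
Local Notation basisw := (basisw R N).
Local Notation Tpos := (@Tpos R N t).
Local Notation colpoly := (@colpoly R N t).
Variables (M : operator A n) (c : seq nat).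
Hypothesis M_comm : commutesH t M.
Hypothesis M_eig : forall j, (j <= n)%N ->
  actL M (eigvec N t j) = mulw (colpoly c j) (eigvec N t j).

Lemma act_sorted_word m k : (m + k = n)%N ->
  actL M (basisw (nseq m st1 ++ nseq k st2)) =
  \sum_(j < k.+1) S m j k (mulw (colpoly c (m + j))
    (psi t basisw (nseq (m + j) st1) (k - j) [::])).
Proof.
move=> mk; have := @psi_resolution _ _ _ _ _ _ (@hecke_basisw R N t) m k [::].
rewrite addn0 cats0 => /(_ mk) <-; rewrite (linear_sum (actL M)).
apply: eq_bigr => j _; have jk := ltn_ord j.
rewrite (@map_shuffle _ _ _ _ T T (actL M)) => [|i u mi ik]; last first.
  by apply/esym/M_comm; lia.
have kj : (k - j = n - (m + j))%N by lia.
have mj : (m + j <= n)%N by lia.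
by have := M_eig mj; rewrite /eigvec -kj => ->.
Qed.

(** Only the shuffle of the first column is interchanged with the resolution; the later columns stay
    inside [F] and are covered by [Tpos_colpoly], which makes the required products base cases of
    [raised]. *)
Lemma act_sorted_pos m k : (m + k = n)%N ->
  Tpos (actL M (basisw (nseq m st1 ++ nseq k st2))).
Proof.
move=> mk; rewrite act_sorted_word //.
case: c => [|r c'].
  rewrite psi_resolution_mulw //; last by move=> i _ _; rewrite msym1.
  by rewrite mulw1; apply: Tpos_basisw => //; rewrite size_cat !size_nseq.
pose F := xprod R N (fun i => i < r)%N * colpoly c' r.
have -> : \sum_(j < k.+1) S m j k (mulw (colpoly (r :: c') (m + j))
      (psi t basisw (nseq (m + j) st1) (k - j) [::])) =
    \sum_(j < k.+1) S (0 + m) j k (S 0 r (m + j)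
      (mulw F (psi t basisw (nseq (0 + m + j) st1) (k - j) [::]))).
  apply: eq_bigr => j _; have jk := ltn_ord j; congr (S _ _ _ _).
  rewrite -[colpoly _ _]/(shuffle t (stau N t) 0 r (m + j) F).
  apply/esym; apply: shuffle_mulw => [|i _ ij]; first by lia.
  by apply: hecke_psi_ones => //=; lia.
apply: (@mix_pos R N t t_ge0 t_le1 m 0 k r r F) => // [i ri iN|l lk rl].
  have rn : (r <= n)%N by lia.
  rewrite msymM xpref_sym //; last by apply/orP; right; lia.
  congr (_ * _); rewrite -(ev_colpoly_ge t c' (leqnn r) rn).
  by apply: ev_msym_ge.
exists 0%N, (fun i => i < r)%N; split=> [|j|j]; try lia.
rewrite /F -mulwA; apply: raised_base.
have -> : nseq (0 + m + l) st1 ++ nseq (k - l) st2 =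
    nseq r st1 ++ (nseq (m + l - r) st1 ++ nseq (k - l) st2).
  by rewrite catA -nseqD; congr (nseq _ _ ++ _); lia.
by apply: Tpos_colpoly => //; rewrite size_cat !size_nseq; lia.
Qed.

(** Insertion sort on the prefix 1^a 2^b: a following 2 lengthens the block, and a following 1 is
    reached from the front of the twos by exchanges T(12) = 21, which commute with M and preserve
    [Tpos]. *)
Lemma act_word_pos a b q : (a + b + size q = n)%N ->
  Tpos (actL M (basisw (nseq a st1 ++ nseq b st2 ++ q))).
Proof.
elim: q a b => [|[] q IH] a b /= abq.
- by rewrite cats0; apply: act_sorted_pos; lia.
- have H i j : (i + j = b)%N ->
      Tpos (actL M (basisw ((nseq a st1 ++ nseq i st2) ++ st1 :: nseq j st2 ++ q))).
    elim: i j => [|i IHi] j ijb.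
      rewrite cats0 -cat_rcons.
      have -> : rcons (nseq a st1) st1 = nseq a.+1 st1 by elim: (a) => //= ? ->.
      by apply: IH; lia.
    have [p Ep] : exists p, nseq a st1 ++ nseq i st2 = p by exists (nseq a st1 ++ nseq i st2).
    have sp : size p = (a + i)%N by rewrite -Ep size_cat !size_nseq.
    have -> : (nseq a st1 ++ nseq i.+1 st2) ++ st1 :: nseq j st2 ++ q =
        p ++ st2 :: st1 :: nseq j st2 ++ q.
      rewrite -Ep -catA -[RHS]catA; congr (_ ++ _).
      by elim: (i) => //= ? ->.
    have Tw : T (a + i) (basisw (p ++ st1 :: st2 :: nseq j st2 ++ q)) =
        basisw (p ++ st2 :: st1 :: nseq j st2 ++ q).
      by rewrite hecke_basisw // sp size_cat size_nseq; lia.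
    rewrite -Tw -M_comm; last by lia.
    apply: TposT; first by lia.
    by have := IHi j.+1; rewrite Ep; apply; lia.
  by have := H b 0%N; rewrite addn0 catA; apply.
have -> : nseq b st2 ++ st2 :: q = nseq b.+1 st2 ++ q.
  by elim: (b) => //= ? ->.
by apply: IH; lia.
Qed.

Lemma mxel_nonneg (e' e : n.-tuple state) : nonneg_coefs (mxel M e' e).
Proof.
have := @act_word_pos 0 0 e; rewrite size_tuple => /(_ erefl) /T_posW /(_ e').
by rewrite act_basisw.
Qed.

End OperatorPositivity.

Theorem theorem1p6 (R : realType) (n : nat) (t : R)
    (n_ge1 : (1 <= n)%N) (t_ge0 : 0 <= t) (t_lt1 : t < 1)
    (Theta : {rmorphism sympoly R n -> operator {mpoly R[n]} n})
    (ThetaZ : forall (c : R) (f : sympoly R n),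
       Theta (c *: f) = c%:MP_[n] *: Theta f)
    (Theta_g : forall k : nat, (1 <= k <= n)%N ->
       Theta (HL_g n t k) = transfer_coef n t k)
    (la : seq nat) (la_part : is_partition la)
    (e' e : word n) (m : 'X_{1..n}) :
  0 <= (mxel (Theta (HL n t la)) e' e)@_m.
Proof.
case: n n_ge1 Theta ThetaZ Theta_g e' e m => [//|N] _ Theta ThetaZ Theta_g e' e m.
have [lan|nla] := leqP (size la) N.+1; last first.
  by rewrite /HL leqNgt nla rmorph0 /mxel mxE mcoeff0.
have [comm eig] := spectral_all t_ge0 t_lt1 ThetaZ Theta_g (HL N.+1 t la).
apply: (mxel_nonneg t_ge0 (ltW t_lt1) comm (c := conj_part N.+1 la)) => j jn.
by rewrite eig // (HL_colpoly t_ge0 t_lt1) // ev_colpoly.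
Qed.
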